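(* Let $0<k<n$, let $\Omega\subset\mathbb{R}^n$ be open, let $v_1,\dots,v_k$ be vectorfields of class $C^1$ on $\Omega$ such that the simple $k$-vectorfield $v:=v_1\wedge\dots\wedge v_k$ satisfies $|v(x)|=1$ for every $x\in\Omega$, and let $V(x):=\mathrm{span}\{v_1(x),\dots,v_k(x)\}$ for every $x\in\Omega$. If $T$ is an integral $k$-current in $\Omega$ which is tangent to $V$, then $V$ is involutive at every point in the support of $T$.
   Context: Sets, maps and vectorfields are always (at least) Borel measurable. $\mathscr{H}^h$ is the $h$-dimensional Hausdorff measure; $|\cdot|$ is the Euclidean norm on $h$-vectors and $h$-covectors. Involutivity: $V$ is involutive at $x\in\Omega$ if $[v_i,v_j](x)\in V(x)$ for all $1\le i,j\le k$, where $[v_i,v_j]=\frac{\partial v_j}{\partial v_i}-\frac{\partial v_i}{\partial v_j}$ is the Lie bracket (here $\frac{\partial v_j}{\partial v_i}(x)$ is the derivative of $v_j$ at $x$ in the direction $v_i(x)$). Rectifiable sets: a set $\Sigma\subset\Omega$ is $h$-rectifiable if it has finite $\mathscr{H}^h$ measure and can be covered, except for an $\mathscr{H}^h$-null subset, by countably many surfaces of dimension $h$ and class $C^1$. At $\mathscr{H}^h$-a.e. $x\in\Sigma$ there is an approximate tangent space $\mathrm{Tan}(\Sigma,x)$, characterized ($\mathscr{H}^h$-a.e.) by: for every $h$-surface $S$ of class $C^1$, $\mathrm{Tan}(\Sigma,x)=\mathrm{Tan}(S,x)$ for $\mathscr{H}^h$-a.e. $x\in\Sigma\cap S$. An orientation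 of $\Sigma$ is a simple $h$-vectorfield $\tau$ on $\Sigma$ such that $\tau(x)$ spans $\mathrm{Tan}(\Sigma,x)$ and has norm $1$ for $\mathscr{H}^h$-a.e. $x\in\Sigma$. Currents: an $h$-current in $\Omega$ is a continuous linear functional on the smooth $h$-forms with compact support in $\Omega$. The boundary of $T$ is the $(h-1)$-current $\langle\partial T;\omega\rangle:=\langle T;\mathrm{d}\omega\rangle$. An $h$-current $T$ is rectifiable (with integral multiplicity) if there are an $h$-rectifiable set $\Sigma$, an orientation $\tau$ of $\Sigma$ and a positive integer-valued multiplicity $\theta\in L^1(\Sigma,\mathscr{H}^h)$ such that $\langle T;\omega\rangle=\int_\Sigma\langle\tau(x);\omega(x)\rangle\,\theta(x)\,d\mathscr{H}^h(x)$ for all $\omega$; one writes $T=[\![\Sigma,\tau,\theta]\!]$. $T$ is integral if both $T$ and $\partial T$ are rectifiable. The support of $T=[\![\Sigma,\tau,\theta]\!]$ is the support of the measure $\mu$ given by $\theta\,\mathscr{H}^h$ restricted to $\Sigma$, that is, the smallest closed set $F$ whose complement is $\mu$-null. Tangency: a rectifiable $k$-current $[\![\Sigma,\tau,\theta]\!]$ is tangent to $V$ if $\mathrm{Tan}(\Sigma,x)\subset V(x)$ for $\mathscr{H}^k$-a.e. $x\in\Sigma$. *)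

(* Defs.v *)
From HB Require Import structures.
From mathcomp Require Import all_boot all_order all_algebra.
From mathcomp Require Import all_classical all_reals all_analysis.

Set Implicit Arguments.
Unset Strict Implicit.
Unset Printing Implicit Defensive.

Import Order.TTheory GRing.Theory Num.Theory.
Import numFieldNormedType.Exports.

Local Open Scope classical_set_scope.
Local Open Scope ring_scope.

(* The topology and the differential calculus on ['rV[R]_n] are the library's,
   i.e. those of the sup norm, which is equivalent to the Euclidean one.  The
   metric notions (diameter, hence Hausdorff measure) use [enorm]. *)

Definition borel_rV (R : realType) (n : nat) :=
  g_sigma_algebraType (@open 'rV[R]_n).

Section HausdorffMeasure.
Variables (R : realType) (n : nat).
Implicit Types (h : nat) (A : set (borel_rV R n)).

Definition enorm (x : 'rV[R]_n) : R := Num.sqrt (\sum_i x 0 i ^+ 2).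

Definition ediam A : \bar R :=
  ereal_sup [set (enorm (x - y))%:E | x in A & y in A].

(* Lebesgue measure of the Euclidean unit ball of R^h, pi^(h/2)/Gamma(h/2+1). *)
Fixpoint unit_ball_volume h : R :=
  match h with
  | 0%N => 1
  | 1%N => 2
  | h'.+2 => 2 * pi / h'.+2%:R * unit_ball_volume h'
  end.

(* The case distinction makes the empty set weigh 0 also when h = 0, so that
   the 0-dimensional measure is the counting measure. *)
Definition hausdorff_gauge h A : \bar R :=
  if A == set0 then 0%E
  else ((unit_ball_volume h)%:E * (ediam A * (2^-1)%:E) ^+ h)%E.

Definition hausdorff_size h (delta : R) A : \bar R :=
  ereal_inf [set (\sum_(0 <= i <oo) hausdorff_gauge h (E i))%E |
    E in [set E : (set (borel_rV R n))^nat |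
      A `<=` \bigcup_i E i /\ forall i, (ediam (E i) <= delta%:E)%E]].

(* Defined on all subsets as an outer measure. *)
Definition hausdorff h A : \bar R :=
  ereal_sup [set hausdorff_size h delta A | delta in [set d : R | 0 < d]].

Definition hausdorff_ae h A (Q : 'rV[R]_n -> Prop) : Prop :=
  hausdorff h [set x | A x /\ ~ Q x] = 0%E.

End HausdorffMeasure.

Section MultilinearAlgebra.
Variables (R : realType) (n : nat).

(* Elements of the exterior algebra of R^n (or of its dual) are given by their
   coordinates w I on e_I = e_(i_1) /\ ... /\ e_(i_h), for
   I = {i_1 < ... < i_h} a subset of {0, ..., n-1}.  The elements of degree h
   are those with w I = 0 whenever #|I| <> h. *)
Definition multivector := {set 'I_n} -> R.

Implicit Types w alpha : multivector.

Definition pairing w alpha : R := \sum_(I : {set 'I_n}) w I * alpha I.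

Definition mvnorm w : R := Num.sqrt (\sum_(I : {set 'I_n}) w I ^+ 2).

(* a_1 /\ ... /\ a_h for a_1, ..., a_h the rows of A: its coordinates are the
   h x h minors of A ([enum_val] enumerates I increasingly). *)
Definition wedge h (A : 'M[R]_(h, n)) : multivector := fun I =>
  match #|I| =P h with
  | ReflectT e => \det (colsub (fun b => enum_val (cast_ord (esym e) b)) A)
  | ReflectF _ => 0
  end.

Definition row_span h (A : 'M[R]_(h, n)) : set 'rV[R]_n :=
  [set u : 'rV[R]_n | (u <= A)%MS].

(* w is a simple h-vector whose span is P (if w is nonzero).  The scalar c
   matters only for h = 0, where [wedge A] is the number 1 whereas every number
   is a simple 0-vector. *)
Definition simple_spanning h w (P : set 'rV[R]_n) : Prop :=
  exists (c : R) (A : 'M[R]_(h, n)),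
    (forall I, w I = c * wedge A I) /\ P = row_span A.

Definition simple_hvector h w : Prop := exists P, simple_spanning h w P.

End MultilinearAlgebra.

Definition C1_on (R : realType) (V W : normedModType R) (U : set V)
    (f : V -> W) : Prop :=
  forall x, U x -> differentiable f x /\
    forall u : V, {for x, continuous (fun y => 'd f y u)}.

Section Rectifiability.
Variables (R : realType) (n : nat).
Local Notation pt := 'rV[R]_n.
Implicit Types (Omega S Sigma : set (borel_rV R n)) (h : nat).

(* Embedded C^1 submanifolds of dimension h, as local zero sets of
   submersions. *)
Definition C1_surface h S : Prop :=
  (h <= n)%N /\
  forall x, S x -> exists (U : set pt) (g : pt -> 'rV[R]_(n - h)),
    [/\ open U, U x, C1_on U g,
        forall y, U y -> forall w, exists u, 'd g y u = w
      & S `&` U = [set y | U y /\ g y = 0]].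

Definition tangent_space S (x : pt) : set pt :=
  [set u | exists gamma : R -> pt,
    [/\ gamma 0 = x, \forall t \near 0, S (gamma t) & is_derive (0 : R) (1 : R) gamma u]].

Definition rectifiable_set Omega h Sigma : Prop :=
  [/\ Sigma `<=` Omega, measurable Sigma, (hausdorff h Sigma < +oo)%E
    & exists S : (set (borel_rV R n))^nat,
        (forall i, C1_surface h (S i)) /\
        hausdorff h (Sigma `\` \bigcup_i S i) = 0%E].

(* x |-> P x is (a version of) the approximate tangent bundle
   x |-> Tan(Sigma, x), which is defined only up to an H^h-null set. *)
Definition approx_tangent_bundle h Sigma (P : pt -> set pt) : Prop :=
  forall S, C1_surface h S ->
    hausdorff_ae h (Sigma `&` S) (fun x => P x = tangent_space S x).

Definition orientation h Sigma (tau : borel_rV R n -> multivector R n) : Prop :=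
  [/\ forall I, measurable_fun Sigma (fun x => tau x I),
      forall x, Sigma x -> simple_hvector h (tau x)
    & exists2 P, approx_tangent_bundle h Sigma P &
        hausdorff_ae h Sigma
          (fun x => simple_spanning h (tau x) (P x) /\ mvnorm (tau x) = 1)].

Definition multiplicity h Sigma (theta : borel_rV R n -> nat) : Prop :=
  (forall x, Sigma x -> (0 < theta x)%N) /\
  (hausdorff h).-integrable Sigma (fun x => (theta x)%:R%:E).

End Rectifiability.

Section Currents.
Variables (R : realType) (n : nat).
Local Notation pt := 'rV[R]_n.

Definition diff_form := pt -> multivector R n.

Implicit Types (Omega Sigma : set (borel_rV R n)) (h : nat) (omega : diff_form).
Implicit Types (theta : borel_rV R n -> nat) (T : diff_form -> R).

Definition basis_vec (j : 'I_n) : pt := delta_mx 0 j.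

Definition iter_partial (s : seq 'I_n) (f : pt -> R) : pt -> R :=
  foldr (fun j g => fun x => 'D_(basis_vec j) g x) f s.

Definition smooth (f : pt -> R) : Prop :=
  forall s x, differentiable (iter_partial s f) x.

(* Smooth h-forms vanishing off K; forms on Omega with compact support are
   identified with their extension by zero to R^n. *)
Definition form_supported_in (K : set pt) h omega : Prop :=
  [/\ forall x (I : {set 'I_n}), #|I| <> h -> omega x I = 0,
      forall I, smooth (fun x => omega x I)
    & forall x I, ~ K x -> omega x I = 0].

Definition test_form Omega h omega : Prop :=
  exists K : set pt,
    [/\ compact K, K `<=` Omega & form_supported_in K h omega].

Definition ext_d omega : diff_form := fun x J =>
  \sum_(j in J) (-1) ^+ #|[set i in J | (i < j)%N]| *
    'D_(basis_vec j) (fun y => omega y (J :\ j)) x.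

(* Only the values of T on test forms are meaningful.  Continuity for the
   inductive limit topology is expressed, as for distributions, by seminorm
   estimates on each compact subset of Omega. *)
Definition current Omega h T : Prop :=
  (forall (a : R) omega eta, test_form Omega h omega -> test_form Omega h eta ->
     T (fun x I => a * omega x I + eta x I) = a * T omega + T eta) /\
  (forall K : set pt, compact K -> K `<=` Omega ->
     exists (C : R) (N : nat), forall omega (M : R),
       form_supported_in K h omega ->
       (forall s I x, (size s <= N)%N ->
          `|iter_partial s (fun y => omega y I) x| <= M) ->
       `|T omega| <= C * M).

Definition boundary T : diff_form -> R := fun omega => T (ext_d omega).

(* T = [[Sigma, tau, theta]] as an h-current in Omega. *)
Definition represents Omega h T Sigma (tau : borel_rV R n -> multivector R n)
    theta : Prop :=
  [/\ rectifiable_set Omega h Sigma, orientation h Sigma tau,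
      multiplicity h Sigma theta
    & forall omega, test_form Omega h omega ->
        ((T omega)%:E = \int[hausdorff h]_(x in Sigma)
          (pairing (tau x) (omega x) * (theta x)%:R)%:E)%E].

Definition rectifiable_current Omega h T : Prop :=
  current Omega h T /\
  exists Sigma tau theta, represents Omega h T Sigma tau theta.

(* 0-currents have no boundary. *)
Definition integral_current Omega h T : Prop :=
  rectifiable_current Omega h T /\
  ((0 < h)%N -> rectifiable_current Omega h.-1 (boundary T)).

Definition tangent_to h Sigma (V : pt -> set pt) : Prop :=
  exists2 P, approx_tangent_bundle h Sigma P &
    hausdorff_ae h Sigma (fun x => P x `<=` V x).

Definition rect_measure h Sigma theta (A : set (borel_rV R n)) : \bar R :=
  (\int[hausdorff h]_(x in Sigma `&` A) (theta x)%:R%:E)%E.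

(* Smallest relatively closed subset of Omega with mu-null complement. *)
Definition measure_support Omega (mu : set (borel_rV R n) -> \bar R) : set pt :=
  [set x | Omega x /\
    forall F : set pt, closed F -> mu (Omega `\` F) = 0%E -> F x].

End Currents.

Section Distributions.
Variables (R : realType) (n k : nat).
Implicit Type v : 'I_k -> 'rV[R]_n -> 'rV[R]_n.

Definition frame v (x : 'rV[R]_n) : 'M[R]_(k, n) := \matrix_i v i x.

Definition lie_bracket (u w : 'rV[R]_n -> 'rV[R]_n) (x : 'rV[R]_n) : 'rV[R]_n :=
  'D_(u x) w x - 'D_(w x) u x.

Definition involutive_at v (x : 'rV[R]_n) : Prop :=
  forall i j, row_span (frame v x) (lie_bracket (v i) (v j) x).

End Distributions.

(* Main.v *)
Require Import Defs.
From HB Require Import structures.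
From mathcomp Require Import all_boot all_order all_algebra.
From mathcomp Require Import all_classical all_reals all_analysis.
From mathcomp Require Import measurable_realfun ring lra.

Import Order.TTheory GRing.Theory Num.Theory.
Import numFieldNormedType.Exports.

Local Open Scope classical_set_scope.
Local Open Scope ring_scope.

(** Why the theorem is true.  Let T = [[Sigma, tau, theta]] and write its
    boundary as [[Sigma', tau', theta']], with k = h + 1.  Both tau and v are
    unit simple k-vectors, and tangency makes them span the same k-plane at
    almost every point of Sigma, so tau = v or tau = - v there
    ([tangent_orientation_sign]).

    Let omega be an h-form of class C1, defined near a point of the support,
    such that <v; alpha /\ omega> = 0 for every covector alpha.  For a cutoff
    phi, the Leibniz rule gives <v; d(phi omega)> = phi <v; d omega>: no
    derivative of phi survives.  Stokes' identity then reads
      int_Sigma phi <tau; d omega> theta dH^k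
        = int_Sigma' phi <tau'; omega> theta' dH^h,
    an equality between two measures tested against phi.  Since H^h(Sigma') is
    finite, H^k(Sigma') = 0, so the measure on the left is carried by the
    complement of Sigma' and the one on the right by Sigma'.  Two equal
    mutually singular measures vanish; hence <v; d omega> = 0 almost everywhere
    on Sigma near the point, and, by continuity, at the point itself because it
    lies in the support ([contraction_identity]).

    The rest is algebra.  Some k x k minor of the frame is nonzero, and V has a
    basis w_a, indexed by the columns a of that minor, whose coordinates in
    those columns are those of the identity matrix.  Up to scalars the w_a are
    contractions of v by elementary covectors, and the contractions of v by
    neighbouring elementary covectors are combinations of two of them
    ([contr_nframe]).  These linear relations are forms omega as above, and the
    identity <v; d omega> = 0 applied to them says exactly that the w_a commute
    at the point.  Fields of class C1 tangent to V are combinations of the w_a,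
    so their brackets stay in V
    ([involutive_of_contraction_identity]).

    Two points need analysis.  A current is tested against smooth forms,
    whereas the omega above is only of class C1; it is approximated, together
    with its first derivatives, by gluing first-order Taylor polynomials with a
    smooth partition of unity on a fine grid ([glue_cvg], [derive_glue_cvg],
    [stokes_C1]).  And integrating against H^h requires H^h to be countably
    additive on Borel sets, which is Caratheodory's criterion for metric outer
    measures ([caratheodory_sublevel], [caratheodory_borel]). *)

Set Implicit Arguments.
Unset Strict Implicit.
Unset Printing Implicit Defensive.

(** * Smooth test functions *)

Section Flat.
Variable R : realType.
Implicit Types (m : nat) (t : R).

(** The classical flat function exp(-1/t), divided by t^m: the powers make the
    family stable under differentiation, see [dflat]. *)
Definition flat m t : R := if 0 < t then expR (- t^-1) / t ^+ m else 0.

Definition dflat m t : R := flat m.+2 t - m%:R * flat m.+1 t.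

Lemma flat_gt0 m t : 0 < t -> 0 < flat m t.
Proof. by move=> t0; rewrite /flat t0 divr_gt0 ?expR_gt0 ?exprn_gt0. Qed.

Lemma flat_ge0 m t : 0 <= flat m t.
Proof.
have [t0|t0] := ltP 0 t; first by rewrite ltW // flat_gt0.
by rewrite /flat ltNge t0.
Qed.

Lemma flat_le0 m t : t <= 0 -> flat m t = 0.
Proof. by move=> t0; rewrite /flat ltNge t0. Qed.

(** Applying e^s >= 1 + s to s = 1 / ((m + 2) t) and raising to the power
    m + 2 beats the pole; the square on the right is what makes the derivative
    at 0 vanish. *)
Lemma flat_le_sqr m t : flat m t <= (m.+2%:R ^+ m.+2) * t ^+ 2.
Proof.
have [t0|t0] := leP t 0.
  by rewrite flat_le0 // mulr_ge0 ?sqr_ge0 ?exprn_ge0.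
rewrite /flat t0 ler_pdivrMr ?exprn_gt0 // -mulrA -exprD addnC.
rewrite addn2 -exprMn expRN -(invrK ((_ * _) ^+ _)) lef_pV2 ?posrE ?expR_gt0 ?invr_gt0 ?exprn_gt0 ?mulr_gt0 //.
rewrite -exprVn invfM -[X in expR X](@mulfVK _ m.+2%:R) ?pnatr_eq0 // mulrC.
rewrite [X in expR X]mulrC expRM_natl ler_pXn2r ?nnegrE ?expR_ge0 ?mulr_ge0 ?invr_ge0 ?(ltW t0) //.
by apply: le_trans (expR_ge1Dx _); rewrite lerDr.
Qed.

Lemma is_derive_flat m t : is_derive t 1 (flat m) (dflat m t).
Proof.
have [t0|t0|->] := ltgtP t 0.
- have -> : dflat m t = 0 by rewrite /dflat !flat_le0 ?ltW // mulr0 subr0.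
  apply: (@near_eq_is_derive _ _ _ (cst 0)).
  by near=> s; rewrite flat_le0 // ltW //; near: s; exact: lt_nbhsl.
- apply: (@near_eq_is_derive R R R (fun s : R => expR (- s^-1) * (s ^+ m)^-1)).
    by near=> s; rewrite /flat ifT //; near: s; exact: lt_nbhsr.
  have tn0 : t != 0 by rewrite gt_eqF.
  have tmn0 : t ^+ m != 0 by rewrite expf_neq0.
  have d1 : is_derive t 1 (fun s : R => expR (- s^-1)) (expR (- t^-1) * t ^- 2).
    have dV : is_derive t 1 (fun s : R => - s^-1) (t ^- 2).
      split; first by apply: derivableN; apply: derivableV.
      rewrite deriveN; last exact: derivableV.
      by rewrite deriveV // derive_id scaleNr opprK /GRing.scale /= mulr1.
    exact: is_derive1_comp.
  have d2 : is_derive t 1 (fun s : R => (s ^+ m)^-1) (- (m%:R * t ^- m.+1)).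
    split; first by apply: derivableV => //; exact: exprn_derivable.
    rewrite deriveV //; last exact: exprn_derivable.
    rewrite exp_derive /GRing.scale /= mulr1 mulNr; congr (- _).
    case: m {tmn0} => [|m] /=; first by rewrite !mul0r mulr0.
    rewrite !exprS; field; rewrite ?tn0 ?expf_neq0 //.
  have := is_deriveM d1 d2; move=> d; apply: is_derive_eq d _.
  rewrite /dflat /flat t0 /GRing.scale /= !exprS; field; rewrite tn0 expf_neq0 //.
- have -> : dflat m 0 = 0 by rewrite /dflat !flat_le0 // mulr0 subr0.
  suff h : (fun h : R => h^-1 *: ((flat m \o shift 0) (h *: 1) - flat m 0)) @ 0^' --> (0 : R).
    by split; [apply/cvg_ex; exists 0|exact: cvg_lim h].
  pose C : R := m.+2%:R ^+ m.+2.
  apply: norm_cvg0.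
  apply: (@squeeze_cvgr _ _ _ _ (cst 0) (fun h => C * `|h|)).
  + near=> h; rewrite /cst normr_ge0 /= [flat m 0]flat_le0 // subr0 addr0.
    rewrite /GRing.scale /= mulr1 normrM normfV.
    rewrite ler_pdivrMl ?normr_gt0; last by near: h; exact: nbhs_dnbhs_neq.
    rewrite (ger0_norm (flat_ge0 _ _)) mulrCA -expr2 real_normK ?num_real //.
    exact: flat_le_sqr.
  + exact: cvg_cst.
  + rewrite -[X in _ --> X](mulr0 C) -[X in _ * X](normr0 R); apply: cvgMr.
    by apply: cvg_norm; apply: cvg_within.
Unshelve. all: by end_near. Qed.

Lemma continuous_flat m : continuous (flat m).
Proof.
move=> t; apply: differentiable_continuous; apply/derivable1_diffP.
exact: (@ex_derive _ _ _ _ _ _ _ (is_derive_flat m t)).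
Qed.

End Flat.

Section SmoothClass.
Variables (R : realType) (n : nat).
Local Notation pt := 'rV[R]_n.
Implicit Types (f g : pt -> R) (x u : pt).

(** A class of functions closed under differentiation by its very
    constructors: membership then gives smoothness in one induction, with no
    calculus of iterated partial derivatives.  The constructor for [flat] is what
    provides cutoffs. *)
Inductive elementary : (pt -> R) -> Prop :=
| elementary_cst c : elementary (fun=> c)
| elementary_coord j : elementary (fun x => x 0 j)
| elementary_add f g : elementary f -> elementary g ->
    elementary (fun x => f x + g x)
| elementary_mul f g : elementary f -> elementary g ->
    elementary (fun x => f x * g x)
| elementary_inv f : (forall x, f x != 0) -> elementary f ->
    elementary (fun x => (f x)^-1)
| elementary_flat m f : elementary f -> elementary (fun x => flat m (f x)).

Lemma elementary_opp f : elementary f -> elementary (fun x => - f x).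
Proof.
move=> ef; rewrite (_ : (fun _ => _) = (fun x => -1 * f x)).
  by apply: elementary_mul => //; exact: elementary_cst.
by apply/funext => x; rewrite mulN1r.
Qed.

Lemma elementary_sub f g : elementary f -> elementary g ->
  elementary (fun x => f x - g x).
Proof. by move=> ef eg; apply: elementary_add => //; exact: elementary_opp. Qed.

Lemma elementary_sum (I : Type) (r : seq I) (P : pred I) (F : I -> pt -> R) :
  (forall i, P i -> elementary (F i)) ->
  elementary (fun x => \sum_(i <- r | P i) F i x).
Proof.
move=> eF; elim: r => [|i r IH].
  by under eq_fun do rewrite big_nil; exact: elementary_cst.
under eq_fun do rewrite big_cons.
by case: (boolP (P i)) => Pi //; apply: elementary_add => //; exact: eF.
Qed.

Lemma elementary_prod (I : Type) (r : seq I) (P : pred I) (F : I -> pt -> R) :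
  (forall i, P i -> elementary (F i)) ->
  elementary (fun x => \prod_(i <- r | P i) F i x).
Proof.
move=> eF; elim: r => [|i r IH].
  by under eq_fun do rewrite big_nil; exact: elementary_cst.
under eq_fun do rewrite big_cons.
by case: (boolP (P i)) => Pi //; apply: elementary_mul => //; exact: eF.
Qed.

Lemma differentiable_flat m (f : pt -> R) x : differentiable f x ->
  differentiable (fun y => flat m (f y)) x.
Proof.
move=> df; apply: (@differentiable_comp _ _ _ _ f (flat m)) => //.
apply/derivable1_diffP.
exact: (@ex_derive _ _ _ _ _ _ _ (is_derive_flat m (f x))).
Qed.

Lemma derive_comp1 (h : R -> R) (dh : R) (f : pt -> R) x u :
  is_derive (f x) 1 h dh -> differentiable f x ->
  'D_u (fun y => h (f y)) x = dh * 'D_u f x.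
Proof.
move=> hh df; have dhf : differentiable h (f x).
  by apply/derivable1_diffP; exact: (@ex_derive _ _ _ _ _ _ _ hh).
rewrite deriveE; last exact: (@differentiable_comp _ _ _ _ f h).
rewrite (@diff_comp _ _ _ _ f h) //= deriveE // diff1E //.
by rewrite derive1E (@derive_val _ _ _ _ _ _ _ hh) /GRing.scale /= mulrC.
Qed.

Lemma elementary_differentiable f x : elementary f -> differentiable f x.
Proof.
elim=> {f} [c|j|f g _ df _ dg|f g _ df _ dg|f f0 _ df|m f _ df].
- exact: differentiable_cst.
- exact: differentiable_coord.
- exact: differentiableD.
- exact: differentiableM.
- exact: differentiableV.
- exact: differentiable_flat.
Qed.

Lemma derive_coord x u j : 'D_u (fun y : pt => y 0 j) x = u 0 j.
Proof.
have := derive_mx (@derivable_id _ _ x u).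
by rewrite derive_id => /matrixP /(_ 0 j); rewrite mxE => ->.
Qed.

Lemma elementary_derive f u : elementary f -> elementary (fun x => 'D_u f x).
Proof.
have d h x : elementary h -> derivable h x u.
  by move=> eh; apply: diff_derivable; exact: elementary_differentiable.
elim=> {f} [c|j|f g ef df eg dg|f g ef df eg dg|f f0 ef df|m f ef df].
- under eq_fun do rewrite derive_cst; exact: elementary_cst.
- rewrite (_ : (fun _ => _) = fun=> u 0 j); first exact: elementary_cst.
  by apply/funext => x; exact: derive_coord.
- rewrite (_ : (fun _ => _) = fun x => 'D_u f x + 'D_u g x).
    exact: elementary_add.
  by apply/funext => x; rewrite deriveD //; exact: d.
- rewrite (_ : (fun _ => _) = fun x => f x * 'D_u g x + g x * 'D_u f x).
    by apply: elementary_add; exact: elementary_mul.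
  by apply/funext => x; rewrite deriveM //; exact: d.
- rewrite (_ : (fun _ => _) = fun x => - ((f x)^-1 * (f x)^-1) * 'D_u f x).
    apply: elementary_mul => //; apply: elementary_opp.
    by apply: elementary_mul; exact: elementary_inv.
  apply/funext => x; rewrite deriveV //; last exact: d.
  by rewrite /GRing.scale /= expr2 invfM.
- rewrite (_ : (fun _ => _) = fun x => (flat m.+2 (f x) - m%:R * flat m.+1 (f x)) * 'D_u f x).
    apply: elementary_mul => //; apply: elementary_sub; first exact: elementary_flat.
    by apply: elementary_mul; [exact: elementary_cst|exact: elementary_flat].
  apply/funext => x; rewrite (derive_comp1 u (is_derive_flat m (f x))) //.
  exact: elementary_differentiable.
Qed.

Lemma elementary_smooth f : elementary f -> smooth f.
Proof.
move=> ef s x; apply: elementary_differentiable; elim: s => //= j s IH.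
exact: elementary_derive.
Qed.

Lemma elementary_continuous f : elementary f -> continuous f.
Proof.
by move=> ef x; apply: differentiable_continuous; exact: elementary_differentiable.
Qed.

End SmoothClass.

Section Step.
Variable R : realType.
Implicit Types t : R.

(** Smooth transition from 0 (for t <= 0) to 1 (for t >= 1); the denominator
    never vanishes. *)
Definition step t : R := flat 0 t / (flat 0 t + flat 0 (1 - t)).

Lemma step_den_gt0 t : 0 < flat 0 t + flat 0 (1 - t).
Proof.
have [t0|t0] := ltP 0 t.
  by rewrite ltr_pwDl ?flat_gt0 ?flat_ge0.
by rewrite ltr_wpDl ?flat_ge0 // flat_gt0 // subr_gt0 (le_lt_trans t0).
Qed.

Lemma step_den_neq0 t : flat 0 t + flat 0 (1 - t) != 0.
Proof. by rewrite gt_eqF // step_den_gt0. Qed.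

Lemma step_le0 t : t <= 0 -> step t = 0.
Proof. by move=> t0; rewrite /step flat_le0 // mul0r. Qed.

Lemma step_ge1 t : 1 <= t -> step t = 1.
Proof.
move=> t1; rewrite /step (@flat_le0 _ _ (1 - t)) ?subr_le0 // addr0 divff //.
by rewrite gt_eqF // flat_gt0 // (lt_le_trans _ t1).
Qed.

Lemma step_ge0 t : 0 <= step t.
Proof. by rewrite /step divr_ge0 ?flat_ge0 // ltW // step_den_gt0. Qed.

Lemma step_le1 t : step t <= 1.
Proof. by rewrite /step ler_pdivrMr ?step_den_gt0 // mul1r lerDl flat_ge0. Qed.

Definition dstep t : R :=
  let d := flat 0 t + flat 0 (1 - t) in
  (dflat 0 t * d - flat 0 t * (dflat 0 t - dflat 0 (1 - t))) / d ^+ 2.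

Lemma is_derive_step t : is_derive t 1 step (dstep t).
Proof.
have d1 := is_derive_flat 0 t.
have d2 : is_derive t 1 (fun s : R => flat 0 (1 - s)) (- dflat 0 (1 - t)).
  have d3 := is_derive_flat 0 (1 - t).
  have d4 : is_derive t 1 (fun s : R => 1 - s) (-1).
    split; first by apply: derivableB; [exact: derivable_cst|exact: derivable_id].
    by rewrite deriveB; [rewrite derive_cst derive_id sub0r|exact: derivable_cst|exact: derivable_id].
  have := @is_derive1_comp _ (flat 0) (fun s : R => 1 - s) t _ _ d3 d4.
  by rewrite mulrN1.
have d5 := is_deriveD d1 d2.
have d6 : is_derive t 1 (fun s : R => (flat 0 s + flat 0 (1 - s))^-1)
   (- (flat 0 t + flat 0 (1 - t)) ^- 2 * (dflat 0 t - dflat 0 (1 - t))).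
  split.
    apply: derivableV; first exact: step_den_neq0.
    exact: (@ex_derive _ _ _ _ _ _ _ d5).
  rewrite deriveV; [|exact: step_den_neq0|exact: (@ex_derive _ _ _ _ _ _ _ d5)].
  by rewrite (@derive_val _ _ _ _ _ _ _ d5).
have d7 := is_deriveM d1 d6; apply: is_derive_eq d7 _.
rewrite /dstep /GRing.scale /=; field; exact: step_den_neq0.
Qed.

Lemma continuous_dstep : continuous dstep.
Proof.
have c1 m : continuous (fun t : R => flat m (1 - t)).
  move=> t; apply: (@continuous_comp _ _ _ (fun s : R => 1 - s) (flat m)).
    by apply: cvgB; [exact: cvg_cst|exact: cvg_id].
  exact: continuous_flat.
have c2 m : continuous (dflat m : R -> R).
  move=> t; apply: cvgB; first exact: continuous_flat.
  by apply: cvgMr; exact: continuous_flat.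
have c3 m : continuous (fun t : R => dflat m (1 - t)).
  move=> t; apply: (@continuous_comp _ _ _ (fun s : R => 1 - s) (dflat m)).
    by apply: cvgB; [exact: cvg_cst|exact: cvg_id].
  exact: c2.
have c4 : continuous (fun t : R => flat 0 t + flat 0 (1 - t)).
  by move=> t; apply: continuousD; [exact: continuous_flat|exact: c1].
have c5 : continuous (fun t : R => dflat 0 t - dflat 0 (1 - t)).
  by move=> t; apply: continuousB; [exact: c2|exact: c3].
have c6 : continuous (fun t : R => (flat 0 t + flat 0 (1 - t)) * (flat 0 t + flat 0 (1 - t))).
  by move=> t; exact: (continuousM (c4 t) (c4 t)).
have c7 : continuous (fun t : R => ((flat 0 t + flat 0 (1 - t)) * (flat 0 t + flat 0 (1 - t)))^-1).
  move=> t; have h : (flat 0 t + flat 0 (1 - t)) * (flat 0 t + flat 0 (1 - t)) != 0.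
    by rewrite mulf_neq0 // step_den_neq0.
  by apply: cvgV; [exact: h|exact: (c6 t)].
have c8 : continuous (fun t : R => dflat 0 t * (flat 0 t + flat 0 (1 - t))).
  by move=> t; exact: (continuousM (c2 0%N t) (c4 t)).
have c9 : continuous (fun t : R => flat 0 t * (dflat 0 t - dflat 0 (1 - t))).
  by move=> t; apply: cvgM; [exact: continuous_flat|exact: c5].
move=> t; exact: (continuousM (continuousB (c8 t) (c9 t)) (c7 t)).
Qed.

Lemma dstep_out t : t <= 0 \/ 1 <= t -> dstep t = 0.
Proof.
case=> t0; rewrite /dstep.
  by rewrite /dflat !(@flat_le0 _ _ t) // !(mul0r, mulr0, subr0).
have h m : flat m (1 - t) = 0 by rewrite flat_le0 // subr_le0.
by rewrite /dflat !h !(mulr0, subr0, addr0) [flat 0 t * _]mulrC subrr mul0r.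
Qed.

Lemma dstep_bounded : exists2 B : R, 1 <= B & forall t, `|dstep t| <= B.
Proof.
have [|c _ hc] := @EVT_max R (fun t => `|dstep t|) 0 1 ler01.
  apply: continuous_subspaceT => t; apply: continuous_comp; last exact: norm_continuous.
  exact: continuous_dstep.
exists (1 + `|dstep c|) => [|t]; first by rewrite lerDl.
have [t01|] := boolP (t \in `[0, 1]%R).
  by rewrite (le_trans (hc _ t01)) // lerDr.
rewrite in_itv /= negb_and -!ltNge => /orP h.
by rewrite dstep_out ?normr0 ?addr_ge0 //; case: h => /ltW; [left|right].
Qed.

Lemma elementary_step n (f : 'rV[R]_n -> R) :
  elementary f -> elementary (fun x => step (f x)).
Proof.
move=> ef; apply: elementary_mul; first exact: elementary_flat.
apply: elementary_inv => [x|]; first exact: step_den_neq0.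
apply: elementary_add; apply: elementary_flat => //.
by apply: elementary_sub => //; exact: elementary_cst.
Qed.

(** Differences of consecutive steps: translates by integers telescope, so
    they form a partition of unity on the line. *)
Definition bump_fun t : R := step (t + 1) - step t.

Definition dbump t : R := dstep (t + 1) - dstep t.

Lemma sum_bump N t : 0 <= t <= N%:R ->
  \sum_(c < N.+1) bump_fun (t - c%:R) = 1.
Proof.
move=> /andP[t0 tN].
have -> : \sum_(c < N.+1) bump_fun (t - c%:R) = step (t + 1) - step (t - N%:R).
  elim: N {tN} => [|N IH]; first by rewrite big_ord1 subr0.
  rewrite big_ord_recr /= IH /bump_fun (_ : t - N.+1%:R + 1 = t - N%:R); last first; rewrite -natr1; lra.
by rewrite step_ge1 ?lerDr // step_le0 ?subr0 // subr_le0.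
Qed.

Lemma sum_dbump N t : 0 <= t <= N%:R ->
  \sum_(c < N.+1) dbump (t - c%:R) = 0.
Proof.
move=> /andP[t0 tN].
have -> : \sum_(c < N.+1) dbump (t - c%:R) = dstep (t + 1) - dstep (t - N%:R).
  elim: N {tN} => [|N IH]; first by rewrite big_ord1 subr0.
  rewrite big_ord_recr /= IH /dbump (_ : t - N.+1%:R + 1 = t - N%:R); last first; rewrite -natr1; lra.
by rewrite !dstep_out ?subr0 //; [left; rewrite subr_le0|right; rewrite lerDr].
Qed.

Lemma bump_out t : 1 < `|t| -> bump_fun t = 0.
Proof.
rewrite /bump_fun lter_normr => /orP[t1|t1].
  by rewrite !step_ge1 ?subrr //; lra.
by rewrite !step_le0 ?subrr //; lra.
Qed.

Lemma dbump_out t : 1 < `|t| -> dbump t = 0.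
Proof.
rewrite /dbump lter_normr => h; rewrite !dstep_out ?subr0 //.
  by case/orP: h => h; [right|left]; lra.
by case/orP: h => h; [right|left]; lra.
Qed.

Lemma is_derive_bump t : is_derive t 1 bump_fun (dbump t).
Proof.
have d1 := is_derive_step t.
have d2 : is_derive t 1 (fun s : R => step (s + 1)) (dstep (t + 1)).
  have d4 : is_derive t 1 (fun s : R => s + 1) 1.
    split; first by apply: derivableD; [exact: derivable_id|exact: derivable_cst].
    by rewrite deriveD; [rewrite derive_cst derive_id addr0|exact: derivable_id|exact: derivable_cst].
  have := @is_derive1_comp _ step (fun s : R => s + 1) t _ _ (is_derive_step _) d4.
  by rewrite mulr1.
exact: is_deriveB.
Qed.

Lemma bump_bounded : exists2 B : R, 1 <= B &
  forall t, `|bump_fun t| <= B /\ `|dbump t| <= B.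
Proof.
have [B B1 hB] := dstep_bounded.
exists (B + B) => [|t]; first by lra.
split.
  have := step_ge0 (t + 1); have := step_ge0 t.
  have := step_le1 (t + 1); have := step_le1 t.
  rewrite /bump_fun ler_norml => *; apply/andP; split; lra.
by rewrite (le_trans (ler_normB _ _)) // lerD.
Qed.

Lemma elementary_bump n (f : 'rV[R]_n -> R) :
  elementary f -> elementary (fun x => bump_fun (f x)).
Proof.
move=> ef; apply: elementary_sub; apply: elementary_step => //.
by apply: elementary_add => //; exact: elementary_cst.
Qed.

End Step.

(** * Hausdorff measures are Borel measures *)

(** Caratheodory's criterion, in the form needed for coordinate functions: if
    mu is superadditive on sets separated by a gap in the values of f, then the
    sublevel sets of f are mu-measurable. *)
Section SublevelCaratheodory.
Variables (R : realType) (T : Type) (mu : {outer_measure set T -> \bar R}).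
Variable f : T -> R.
Hypothesis mu_sep : forall (A B : set T) (s t : R), s < t ->
  (forall x, A x -> f x <= s) -> (forall x, B x -> t <= f x) ->
  (mu A + mu B <= mu (A `|` B))%E.

Let t_ (a : R) (i : nat) : R := a + i.+1%:R^-1.

Let t_dec a i j : (i < j)%N -> t_ a j < t_ a i.
Proof. by move=> ij; rewrite ltrD2l ltf_pV2 ?posrE ?ltr0n // ltr_nat ltnS. Qed.

(** The thin shells a + 1/(i+2) <= f < a + 1/(i+1) exhaust the part of X
    where f exceeds a by less than 1. *)
Let shell X a i : set T := X `&` [set x | t_ a i.+1 <= f x < t_ a i].

(** Shells of indices of the same parity are separated by gaps, hence their
    measures add up. *)
Let sum_shell X a p M :
  (\sum_(i < M.+1) mu (shell X a (i.*2 + p)) <=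
   mu (X `&` [set x | (t_ a (M.*2 + p).+1 <= f x)%R]))%E.
Proof.
elim: M => [|M IH].
  rewrite big_ord1 /=.
  by apply: le_outer_measure => x [Xx /= /andP[h1 _]].
rewrite big_ord_recr /=; apply: le_trans (leeD2r _ IH) _; rewrite addeC.
apply: le_trans (mu_sep (s := t_ a (M.+1.*2 + p)) (t := t_ a (M.*2 + p).+1) _ _ _) _.
- by apply: t_dec; rewrite doubleS.
- by move=> x [_ /= /andP[_ /ltW]].
- by move=> x [_ /=].
apply: le_outer_measure => x [] [Xx /=]; first by move=> /andP[h _]; split.
move=> h; split=> //=; apply: le_trans h; apply/ltW/t_dec.
by rewrite doubleS !addSn.
Qed.

Let sum_shells X a M : (\sum_(0 <= i < M.*2) mu (shell X a i) <= mu X + mu X)%E.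
Proof.
have -> : (\sum_(0 <= i < M.*2) mu (shell X a i) =
    \sum_(i < M) mu (shell X a (i.*2 + 0)) + \sum_(i < M) mu (shell X a (i.*2 + 1)))%E.
  elim: M => [|M IH]; first by rewrite big_nil !big_ord0 adde0.
  rewrite doubleS !big_nat_recr //= IH !big_ord_recr /= addn0 addn1 -!addeA.
  by congr (_ + _)%E; rewrite addeCA.
case: M => [|M]; first by rewrite !big_ord0 adde0 adde_ge0 ?outer_measure_ge0.
by apply: leeD; (apply: le_trans (sum_shell _ _ _ _) _; apply: le_outer_measure; exact: subIsetl).
Qed.

(** The shells of even and those of odd indices have summable measures, so
    the tail of the series tends to 0: the part of X where f > a is reached, in
    measure, by its parts at positive distance from the sublevel set. *)
Lemma caratheodory_sublevel a : mu.-caratheodory [set x | f x <= a].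
Proof.
apply: le_caratheodory_measurable => X; set C := [set x | f x <= a].
have [->|Xoo] := eqVneq (mu X) +oo%E; first by rewrite leey.
have Xfin : mu X \is a fin_num by rewrite ge0_fin_numE ?outer_measure_ge0 // ltey.
pose Y N := X `&` [set x | t_ a N <= f x].
have sum_lty : (\sum_(0 <= i <oo) mu (shell X a i) < +oo)%E.
  apply: (@le_lt_trans _ _ (mu X + mu X)%E); last by rewrite -ge0_fin_numE ?adde_ge0 ?outer_measure_ge0 // fin_numD Xfin.
  apply: lime_le; first by apply: is_cvg_nneseries => i _ _; exact: outer_measure_ge0.
  apply: nearW => N; apply: le_trans (sum_shells X a N).
  rewrite -addnn [leRHS](@big_cat_nat _ _ _ N) //=; last by rewrite leq_addl.
  by rewrite leeDl // sume_ge0 // => i _; exact: outer_measure_ge0.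
have tail : (\sum_(N <= i <oo) mu (shell X a i))%E @[N --> \oo] --> 0%E.
  by apply: nneseries_tail_cvg => // i _; exact: outer_measure_ge0.
suff key N : (mu (X `&` C) + mu (X `&` ~` C) <= mu X + \sum_(N <= i <oo) mu (shell X a i))%E.
  have lim : (mu X + \sum_(N <= i <oo) mu (shell X a i))%E @[N --> \oo] --> (mu X + 0)%E.
    by apply: cvgeD => //; [exact: fin_num_adde_defr|exact: cvg_cst].
  rewrite adde0 in lim; apply: (cvge_ge _ lim).
  by apply: nearW => N; exact: key.
have cover : X `&` ~` C `<=` Y N `|` \bigcup_(i in ~` `I_N) shell X a i.
  move=> x [Xx /= /negP]; rewrite -ltNge => afx.
  have [h|h] := leP (t_ a N) (f x); first by left.
  right.
  have ex : exists i, t_ a i <= f x.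
    have fa0 : 0 < f x - a by rewrite subr_gt0.
    exists (Num.trunc (f x - a)^-1).
    rewrite /t_ -lerBrDl -[leRHS]invrK lef_pV2 ?posrE ?invr_gt0 //.
    by rewrite ltW // truncnS_gt.
  have := ex_minnP ex => -[i hi mini].
  have Ni : (N < i)%N.
    rewrite ltnNge; apply/negP => iN; move: hi; apply/negP; rewrite -ltNge.
    by apply: lt_le_trans h _; move: iN; rewrite leq_eqVlt => /orP[/eqP->//|/t_dec/ltW].
  case: i Ni hi mini => // i Ni hi mini.
  exists i; first by apply/negP; rewrite -leqNgt -ltnS.
  split => //=; rewrite hi /= ltNge; apply/negP => /mini.
  by rewrite ltnn.
apply: (@le_trans _ _ (mu (X `&` C) + (mu (Y N) + \sum_(N <= i <oo) mu (shell X a i)))%E).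
  apply: leeD2l; apply: le_trans (le_outer_measure mu _ _ cover) _.
  apply: le_trans (outer_measureU2 _ _ _) _; apply: leeD2l.
  exact: outer_measure_sigma_subadditive_tail.
rewrite addeA; apply: leeD2r.
apply: le_trans (mu_sep (s := a) (t := t_ a N) _ _ _) _.
- by rewrite ltrDl invr_gt0.
- by move=> x [].
- by move=> x [].
- by apply: le_outer_measure => x [] [].
Qed.

End SublevelCaratheodory.

Section Boxes.
Variables (R : realType) (n : nat).
Local Notation pt := 'rV[R]_n.

Definition obox (a b : pt) : set pt := [set x | forall j, a 0 j < x 0 j < b 0 j].

Lemma ball_obox (x : pt) (r : R) : 0 < r ->
  ball x r = obox (x - const_mx r) (x + const_mx r).
Proof.
move=> r0; apply/seteqP; split=> [y [_ h] j|y h].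
  have := h 0 j; rewrite /ball /= !mxE ltr_distlC => /andP[h1 h2].
  by apply/andP; split; lra.
split=> // i j; rewrite (ord1 i); have := h j; rewrite !mxE /ball /= ltr_distlC.
by move=> /andP[h1 h2]; apply/andP; split; lra.
Qed.

Lemma oboxI (a b c d : pt) : obox a b `&` obox c d =
  obox (\row_j Num.max (a 0 j) (c 0 j)) (\row_j Num.min (b 0 j) (d 0 j)).
Proof.
apply/seteqP; split=> [x [h1 h2] j|x h].
  rewrite !mxE gt_max lt_min.
  by have /andP[-> ->] := h1 j; have /andP[-> ->] := h2 j.
by split=> j; have := h j; rewrite !mxE gt_max lt_min => /andP[/andP[h1 h2] /andP[h3 h4]]; rewrite ?h1 ?h2 ?h3 ?h4.
Qed.

Lemma open_bigcup_obox (U : set pt) : open U ->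
  exists (D : set nat) (a b : nat -> pt), U = \bigcup_(i in D) obox (a i) (b i).
Proof.
move=> oU.
pose q (i : nat) : 'rV[rat]_n * 'rV[rat]_n := odflt (0, 0) (unpickle i).
pose a i : pt := map_mx (@ratr R) (q i).1.
pose b i : pt := map_mx (@ratr R) (q i).2.
exists [set i | obox (a i) (b i) `<=` U], a, b.
apply/seteqP; split=> [x Ux|x [i /= h] /h //].
have /nbhs_ballP[e /= e0 he] := open_nbhs_nbhs (conj oU Ux).
have ex1 j : exists r : rat, (ratr r : R) \in `](x 0 j - e), (x 0 j)[%R.
  by apply: rat_in_itvoo; rewrite ltrBlDr ltrDl.
have ex2 j : exists r : rat, (ratr r : R) \in `](x 0 j), (x 0 j + e)[%R.
  by apply: rat_in_itvoo; rewrite ltrDl.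
pose p : 'rV[rat]_n := \row_j sval (cid (ex1 j)).
pose p' : 'rV[rat]_n := \row_j sval (cid (ex2 j)).
have qE : q (pickle (p, p')) = (p, p') by rewrite /q pickleK.
exists (pickle (p, p')).
  rewrite /= /a /b qE /= => y hy; apply: he; rewrite ball_obox // => j.
  have := hy j; rewrite !mxE.
  have := svalP (cid (ex1 j)); have := svalP (cid (ex2 j)); rewrite !in_itv /=.
  by move=> /andP[h1 h2] /andP[h3 h4] /andP[h5 h6]; apply/andP; split; lra.
move=> j; rewrite /a /b qE /= !mxE.
have := svalP (cid (ex1 j)); have := svalP (cid (ex2 j)); rewrite !in_itv /=.
by move=> /andP[-> _] /andP[_ ->].
Qed.

End Boxes.

Section HausdorffOuter.
Variables (R : realType) (n : nat).
Local Notation pt := (borel_rV R n).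
Local Open Scope ereal_scope.
Implicit Types (h : nat) (A B : set pt) (delta : R).

Lemma unit_ball_volume_gt0 h : (0 < unit_ball_volume R h)%R.
Proof.
elim/ltn_ind: h => -[|[|h]] IH //=.
by rewrite mulr_gt0 ?IH // divr_gt0 ?mulr_gt0 ?pi_gt0 // ltr0n.
Qed.

Lemma enorm_coord (x : 'rV[R]_n) j : (`|x ord0 j| <= enorm x)%R.
Proof.
rewrite /enorm -sqrtr_sqr ler_wsqrtr // (bigD1 j) //= lerDl sumr_ge0 // => i _.
exact: sqr_ge0.
Qed.

Lemma ediam_ge0 A : A !=set0 -> 0 <= ediam A.
Proof.
move=> [x Ax]; apply: (@le_trans _ _ (enorm (x - x))%:E).
  by rewrite lee_fin sqrtr_ge0.
by apply: ereal_sup_ubound; exists x => //; exists x.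
Qed.

Lemma ediam_set0 : ediam (set0 : set pt) = -oo.
Proof. by apply/ereal_sup_ninfty => _ [x []]. Qed.

Lemma hausdorff_gauge0 h : hausdorff_gauge h (set0 : set pt) = 0.
Proof. by rewrite /hausdorff_gauge eqxx. Qed.

Lemma hausdorff_gauge_ge0 h A : 0 <= hausdorff_gauge h A.
Proof.
rewrite /hausdorff_gauge; case: ifPn => // /set0P A0.
by rewrite mule_ge0 ?lee_fin ?(ltW (unit_ball_volume_gt0 _)) // expe_ge0 // mule_ge0 // ediam_ge0.
Qed.

(** Restricting the covers to sets of small diameter amounts to giving
    infinite weight to the other sets; in this way [hausdorff_size] is an
    instance of the outer measure extension of a set function.  The ambient
    sigma-algebra is the discrete one, since covers may use arbitrary sets. *)
Definition small_gauge h delta (A : set (g_sigma_algebraType [set: set pt])) :=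
  if `[< ediam (A : set pt) <= delta%:E >] then hausdorff_gauge h A else +oo.

Lemma small_gauge_ge0 h delta A : 0 <= small_gauge h delta A.
Proof.
by rewrite /small_gauge; case: ifPn => // _; exact: hausdorff_gauge_ge0.
Qed.

Lemma small_gauge0 h delta : small_gauge h delta set0 = 0.
Proof.
by rewrite /small_gauge ediam_set0 asboolT ?leNye // hausdorff_gauge0.
Qed.

Lemma hausdorff_size_mu_ext h delta A :
  hausdorff_size h delta A = mu_ext (small_gauge h delta) A.
Proof.
apply/eqP; rewrite eq_le; apply/andP; split.
  apply: le_ereal_inf_tmp => _ [E [_ AE] <-].
  have [hE|] := pselect (forall i, ediam (E i : set pt) <= delta%:E).
    apply: ge_ereal_inf; exists (\sum_(0 <= i <oo) hausdorff_gauge h (E i)).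
      by exists E.
    by apply: lee_nneseries => i *; rewrite ?hausdorff_gauge_ge0 // /small_gauge asboolT.
  move=> /existsNP[i hi].
  rewrite (@nneseries_pinfty _ _ _ i) ?leey // => [j _|]; first exact: small_gauge_ge0.
  by rewrite /small_gauge asboolF.
apply: ereal_inf_le_tmp => _ [E [AE hE] <-].
exists E; first by split=> // i; exact: sub_sigma_algebra.
by apply: eq_eseriesr => i _; rewrite /small_gauge asboolT.
Qed.

Lemma hausdorff_size_ge0 h delta A : 0 <= hausdorff_size h delta A.
Proof. by rewrite hausdorff_size_mu_ext mu_ext_ge0 //; exact: small_gauge_ge0. Qed.

Lemma hausdorff_size_le_hausdorff h delta A : (0 < delta)%R ->
  hausdorff_size h delta A <= hausdorff h A.
Proof. by move=> d0; apply: ereal_sup_ubound; exists delta. Qed.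

Lemma hausdorff0 h : hausdorff h (set0 : set pt) = 0.
Proof.
apply/eqP; rewrite eq_le; apply/andP; split.
  apply: ge_ereal_sup => _ [d d0 <-]; rewrite hausdorff_size_mu_ext mu_ext0 //.
    exact: small_gauge0.
  exact: small_gauge_ge0.
exact: le_trans (hausdorff_size_ge0 h 1 _) (hausdorff_size_le_hausdorff _ _ ltr01).
Qed.

Lemma hausdorff_ge0 h A : 0 <= hausdorff h A.
Proof.
exact: le_trans (hausdorff_size_ge0 h 1 _) (hausdorff_size_le_hausdorff _ _ ltr01).
Qed.

Lemma le_hausdorff h : {homo @hausdorff R n h : A B / A `<=` B >-> A <= B}.
Proof.
move=> A B AB; apply: ge_ereal_sup => _ [d d0 <-].
apply: le_trans (hausdorff_size_le_hausdorff _ _ d0).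
by rewrite !hausdorff_size_mu_ext; exact: le_mu_ext.
Qed.

Lemma hausdorff_sigma_subadditive h : sigma_subadditive (@hausdorff R n h).
Proof.
move=> F; apply: ge_ereal_sup => _ [d d0 <-].
rewrite hausdorff_size_mu_ext.
apply: (@le_trans _ _ (\sum_(0 <= i <oo) mu_ext (small_gauge h d) (F i))).
  exact: (@mu_ext_sigma_subadditive _ (g_sigma_algebraType [set: set pt]) R
    (small_gauge h d) (small_gauge_ge0 h d) F).
apply: lee_nneseries => [i *|i _].
  by rewrite -hausdorff_size_mu_ext hausdorff_size_ge0.
by rewrite -hausdorff_size_mu_ext hausdorff_size_le_hausdorff.
Qed.

HB.instance Definition _ h := isOuterMeasure.Build R pt (@hausdorff R n h)
  (hausdorff0 h) (hausdorff_ge0 h) (@le_hausdorff h) (@hausdorff_sigma_subadditive h).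

Lemma hausdorff_size_anti h d1 d2 A : (d1 <= d2)%R ->
  hausdorff_size h d2 A <= hausdorff_size h d1 A.
Proof.
move=> d12; apply: ereal_inf_le_tmp => _ [E [AE hE] <-]; exists E => //.
by split=> // i; apply: le_trans (hE i) _; rewrite lee_fin.
Qed.

(** When delta is smaller than the distance between A and B, no member of a
    cover by sets of diameter at most delta meets both, so a cover of the union
    splits. *)
Lemma hausdorff_size_separated h A B delta (r : R) : (delta < r)%R ->
  (forall x y, A x -> B y -> (r <= enorm (y - x))%R) ->
  hausdorff_size h delta A + hausdorff_size h delta B <=
  hausdorff_size h delta (A `|` B).
Proof.
move=> dr hAB; apply: le_ereal_inf_tmp => _ [E [ABE hE] <-].
pose restr C i := if `[< E i `&` C !=set0 >] then E i else set0.
have cover C : C `<=` A `|` B -> C `<=` \bigcup_i restr C i.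
  move=> CAB x Cx; have [i _ Ei] := ABE x (CAB x Cx); exists i => //.
  by rewrite /restr asboolT //; exists x.
have small C i : ediam (restr C i) <= delta%:E.
  rewrite /restr; case: asboolP => _; first exact: hE.
  by rewrite ediam_set0 leNye.
have size_le C : C `<=` A `|` B ->
    hausdorff_size h delta C <= \sum_(0 <= i <oo) hausdorff_gauge h (restr C i).
  move=> CAB; apply: ereal_inf_lbound; exists (restr C) => //.
  by split; [exact: cover|exact: small].
apply: le_trans (leeD (size_le A (@subsetUl _ _ _)) (size_le B (@subsetUr _ _ _))) _.
rewrite -nneseriesD; [|by move=> *; exact: hausdorff_gauge_ge0|by move=> *; exact: hausdorff_gauge_ge0].
apply: lee_nneseries => [i *|i _].
  by rewrite adde_ge0 // hausdorff_gauge_ge0.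
rewrite {1 2}/restr; case: asboolP => [[x [Ex Ax]]|_]; case: asboolP => [[y [Ey By]]|_];
  rewrite ?hausdorff_gauge0 ?add0r ?addr0 ?hausdorff_gauge_ge0 //.
exfalso; have : (enorm (y - x))%:E <= delta%:E.
  by apply: le_trans (hE i); apply: ereal_sup_ubound; exists y => //; exists x.
by rewrite lee_fin leNgt (lt_le_trans dr) // hAB.
Qed.

Lemma hausdorff_separated h A B (r : R) : (0 < r)%R ->
  (forall x y, A x -> B y -> (r <= enorm (y - x))%R) ->
  hausdorff h A + hausdorff h B <= hausdorff h (A `|` B).
Proof.
move=> r0 hAB.
have [->|/eqP Hfin] := eqVneq (hausdorff h (A `|` B)) +oo; first by rewrite leey.
have fin C : C `<=` A `|` B -> hausdorff h C \is a fin_num.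
  move=> CAB; rewrite ge0_fin_numE ?hausdorff_ge0 //.
  by apply: le_lt_trans (le_hausdorff h CAB) _; rewrite ltey; exact/eqP.
have finB := fin B (@subsetUr _ _ _).
rewrite -leeBrDr //.
apply: ge_ereal_sup => _ [d1 d10 <-].
have finA : hausdorff_size h d1 A \is a fin_num.
  rewrite ge0_fin_numE ?hausdorff_size_ge0 //.
  apply: le_lt_trans (hausdorff_size_le_hausdorff _ _ d10) _.
  by rewrite -ge0_fin_numE ?hausdorff_ge0 ?fin //; exact: subsetUl.
rewrite leeBrDr // addeC -leeBrDr //.
apply: ge_ereal_sup => _ [d2 d20 <-]; rewrite leeBrDr // addeC.
pose d : R := Num.min (Num.min d1 d2) (r / 2)%R.
have d0 : (0 < d)%R by rewrite !lt_min d10 d20 divr_gt0.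
have dd1 : (d <= d1)%R by rewrite !ge_min lexx.
have dd2 : (d <= d2)%R by rewrite !ge_min lexx orbT.
have dr : (d < r)%R by rewrite !gt_min; apply/orP; right; lra.
apply: le_trans (leeD (hausdorff_size_anti h A dd1) (hausdorff_size_anti h B dd2)) _.
apply: le_trans (hausdorff_size_separated h dr hAB) _.
exact: hausdorff_size_le_hausdorff.
Qed.

(** A box is the complement of finitely many half-spaces, which are sublevel
    sets of coordinates; these are 1-Lipschitz for the Euclidean norm. *)
Lemma caratheodory_obox h (a b : 'rV[R]_n) :
  (@hausdorff R n h).-caratheodory (obox a b : set pt).
Proof.
have sub (f : pt -> R) c : (forall x y, (`|f y - f x| <= enorm (y - x))%R) ->
    (@hausdorff R n h).-caratheodory [set x | (f x <= c)%R].
  move=> hf; apply: caratheodory_sublevel => A B s t st fA fB.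
  apply: (@hausdorff_separated h A B (t - s)%R); first by rewrite subr_gt0.
  move=> x y Ax By; apply: le_trans (hf x y).
  by apply: le_trans (ler_norm _); apply: lerB; [exact: fB|exact: fA].
have -> : obox a b = ~` (\big[setU/set0]_(j < n)
    ([set x : pt | (x ord0 j <= a ord0 j)%R] `|` [set x : pt | (- x ord0 j <= - b ord0 j)%R])).
  apply/seteqP; split=> [x hx|x hx j].
    apply: (big_ind (fun S : set pt => ~ S x)) => //= [S1 S2 h1 h2 []//|j _].
    have /andP[h1 h2] := hx j; move=> []; apply/negP; rewrite -ltNge // ltrN2 //.
  have : ~ ([set x : pt | (x ord0 j <= a ord0 j)%R] `|` [set x : pt | (- x ord0 j <= - b ord0 j)%R]) x.
    by move=> hj; apply: hx; rewrite (bigD1 j) //=; left.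
  by move=> /not_orP[/negP + /negP]; rewrite -!ltNge ltrN2 => -> ->.
apply: caratheodory_measurable_setC.
apply: big_ind => [|A B hA hB|j _].
- exact: caratheodory_measurable_set0.
- exact: caratheodory_measurable_setU.
- apply: caratheodory_measurable_setU; apply: sub => x y.
    by apply: le_trans (enorm_coord _ j); rewrite !mxE.
  by apply: le_trans (enorm_coord _ j); rewrite -opprD normrN !mxE.
Qed.

Lemma caratheodory_borel h A : measurable A -> (@hausdorff R n h).-caratheodory A.
Proof.
suff : @measurable _ pt `<=` (@hausdorff R n h).-caratheodory by apply.
apply: smallest_sub.
  split; first exact: caratheodory_measurable_set0.
    by move=> B hB; rewrite setTD; exact: caratheodory_measurable_setC.
  by move=> F hF; exact: caratheodory_measurable_bigcup.
move=> U /open_bigcup_obox[D [a [b ->]]]; rewrite bigcup_mkcond.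
apply: caratheodory_measurable_bigcup => i; case: ifPn => _.
  exact: caratheodory_obox.
exact: caratheodory_measurable_set0.
Qed.

Lemma hausdorff_semi_sigma_additive h : semi_sigma_additive (@hausdorff R n h).
Proof.
move=> F mF tF mUF.
apply: (@caratheodory_measure_sigma_additive R pt (@hausdorff R n h) F) => //.
  by move=> i; exact: caratheodory_borel.
exact: caratheodory_borel.
Qed.

HB.instance Definition _ h := isMeasure.Build _ pt R (@hausdorff R n h)
  (hausdorff0 h) (hausdorff_ge0 h) (@hausdorff_semi_sigma_additive h).

Lemma hausdorff_gaugeS h delta A : (0 <= delta)%R -> ediam A <= delta%:E ->
  hausdorff_gauge h.+1 A <=
  (unit_ball_volume R h.+1 / unit_ball_volume R h * delta)%:E * hausdorff_gauge h A.
Proof.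
move=> d0 Ad; rewrite /hausdorff_gauge; case: ifPn => [_|/set0P A0].
  by rewrite mule0.
have D0 := ediam_ge0 A0.
have Dfin : ediam A \is a fin_num by rewrite ge0_fin_numE // (le_lt_trans Ad) ?ltry.
rewrite -(fineK Dfin) in Ad D0 *; move: (fine _) Ad D0 => D; rewrite !lee_fin => Dd D0.
rewrite -!EFinM -!EFin_expe -!EFinM lee_fin.
have u0 := unit_ball_volume_gt0 h; have u1 := unit_ball_volume_gt0 h.+1.
have -> : (unit_ball_volume R h.+1 / unit_ball_volume R h * delta * (unit_ball_volume R h * (D * 2^-1) ^+ h)
  = unit_ball_volume R h.+1 * (delta * (D * 2^-1) ^+ h))%R.
  by field; rewrite gt_eqF.
rewrite ler_pM2l // exprS ler_wpM2r ?exprn_ge0 ?divr_ge0 //.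
by lra.
Qed.

(** Covers by sets of diameter at most delta gain a factor delta when the
    dimension goes up by one.  This is what makes the boundary negligible for the
    measure of the current. *)
Lemma hausdorffS_eq0 h A : hausdorff h A < +oo -> hausdorff h.+1 A = 0.
Proof.
move=> Hoo; apply/eqP; rewrite eq_le hausdorff_ge0 andbT.
have Hfin : hausdorff h A \is a fin_num by rewrite ge0_fin_numE ?hausdorff_ge0.
pose C := (unit_ball_volume R h.+1 / unit_ball_volume R h)%R.
have C0 : (0 < C)%R by rewrite divr_gt0 ?unit_ball_volume_gt0.
have key (d : R) : (0 < d)%R -> hausdorff_size h.+1 d A <= (C * d)%:E * hausdorff h A.
  move=> d0; apply: (@le_trans _ _ ((C * d)%:E * hausdorff_size h d A)); last first.
    apply: lee_wpmul2l; last exact: hausdorff_size_le_hausdorff.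
    by rewrite lee_fin ltW // mulr_gt0 // divr_gt0 ?unit_ball_volume_gt0.
  rewrite -ereal_inf_pZl; last exact: mulr_gt0.
  apply: le_ereal_inf_tmp => _ [_ [E [AE hE] <-] <-].
  apply: ge_ereal_inf; exists (\sum_(0 <= i <oo) hausdorff_gauge h.+1 (E i)); first by exists E.
  rewrite -nneseriesZl; last by move=> *; exact: hausdorff_gauge_ge0.
  apply: lee_nneseries => [i *|i _]; first exact: hausdorff_gauge_ge0.
  by apply: hausdorff_gaugeS; [exact: ltW|exact: hE].
apply: ge_ereal_sup => _ [d d0 <-].
apply/lee_addgt0Pr => e e0; rewrite add0e.
pose H := fine (hausdorff h A).
have H0 : (0 <= H)%R by rewrite fine_ge0 // hausdorff_ge0.
pose d' := Num.min d (e / (C * (H + 1)))%R.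
have CH0 : (0 < C * (H + 1))%R by rewrite mulr_gt0 // ltr_wpDl.
have d'0 : (0 < d')%R by rewrite lt_min d0 divr_gt0.
apply: le_trans (hausdorff_size_anti _ _ (_ : (d' <= d)%R)) _; first by rewrite ge_min lexx.
apply: le_trans (key _ d'0) _; rewrite -(fineK Hfin) -/H -EFinM lee_fin.
have : (d' <= e / (C * (H + 1)))%R by rewrite ge_min lexx orbT.
rewrite ler_pdivlMr // => h1; apply: le_trans h1.
rewrite -mulrA mulrCA ler_pM2l // ler_pM2l // lerDl //.
Qed.

End HausdorffOuter.

(** * Contractions of a simple multivector *)

Section Enumeration.
Local Close Scope classical_set_scope.
Variable n : nat.
Implicit Types (A J : {set 'I_n}) (i j : 'I_n).

(** The sign of e_j /\ e_J relative to e_(j |: J) is given by the parity of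
    this number. *)
Definition nbelow A j := #|[set l in A | (l < j)%N]|.

Lemma enum_val_ltn A (i i' : 'I_#|A|) :
  (enum_val i < enum_val i')%N = (i < i')%N.
Proof.
have mono (a b : 'I_#|A|) : (a < b)%N -> (enum_val a < enum_val b)%N.
  move=> ab; have x0 := enum_val a; rewrite !(enum_val_nth x0).
  have srt : sorted ltn (map val (enum A)).
    rewrite /enum_mem -enumT; apply: (subseq_sorted ltn_trans (s2 := map val (enum 'I_n))).
      by apply: map_subseq; exact: filter_subseq.
    by rewrite val_enum_ord iota_ltn_sorted.
  have := sorted_ltn_nth ltn_trans 0%N srt a b.
  rewrite !inE size_map -cardE !ltn_ord => /(_ isT isT ab).
  by rewrite !(nth_map x0) -?cardE.
case: (ltngtP i i') => [h|h|/val_inj->]; first exact: mono.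
  by apply/negbTE; rewrite -leqNgt ltnW // mono.
by rewrite ltnn.
Qed.

Lemma nbelow_enum_val A (i : 'I_#|A|) : nbelow A (enum_val i) = i.
Proof.
rewrite /nbelow.
have -> : [set l in A | (l < enum_val i)%N] =
    [set enum_val i' | i' : 'I_#|A| in [set i' : 'I_#|A| | (i' < i)%N]].
  apply/setP => l; rewrite !inE; apply/andP/imsetP => [[lA li]|[i' + ->]].
    exists (enum_rank_in lA l); last by rewrite enum_rankK_in.
    by rewrite inE -enum_val_ltn enum_rankK_in.
  by rewrite inE -enum_val_ltn => h; split=> //; exact: enum_valP.
rewrite card_imset; last exact: enum_val_inj.
have -> : [set i' : 'I_#|A| | (i' < i)%N] =
    [set widen_ord (ltnW (ltn_ord i)) q | q : 'I_i].
  apply/setP => l; rewrite !inE; apply/idP/imsetP => [li|[q _ ->]] /=.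
    by exists (Ordinal li) => //; apply: val_inj.
  exact: ltn_ord.
by rewrite card_imset ?card_ord // => a b /(congr1 val) /= /val_inj.
Qed.

Lemma nbelowU1 J i j : i \notin J -> nbelow (i |: J) j = ((i < j)%N + nbelow J j)%N.
Proof.
move=> iJ; rewrite /nbelow; case: (boolP (i < j)%N) => ij.
  have -> : [set l in i |: J | (l < j)%N] = i |: [set l in J | (l < j)%N].
    by apply/setP => l; rewrite !inE; case: eqVneq => [->|].
  by rewrite cardsU1 inE (negbTE iJ).
rewrite add0n; apply: eq_card => l; rewrite !inE; case: eqVneq => [->|//].
by rewrite (negbTE ij) !andbF.
Qed.

Lemma nbelow_leq J x j : x \in J -> j \notin J ->
  (nbelow J j <= nbelow J x)%N = (j < x)%N.
Proof.
move=> xJ jJ; case: (ltngtP j x) => h.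
- have sub : [set l in J | (l < j)%N] \subset [set l in J | (l < x)%N].
    apply/fintype.subsetP => l; rewrite !inE => /andP[-> /= lj]; exact: ltn_trans h.
  exact: subset_leq_card sub.
- apply/negbTE; rewrite -ltnNge; apply: proper_card; apply/properP; split.
    apply/fintype.subsetP => l; rewrite !inE => /andP[-> /= lj].
    exact: ltn_trans h.
  by exists x; rewrite !inE ?xJ // ltnn andbF.
- by move: xJ jJ; rewrite (val_inj h) => ->.
Qed.

End Enumeration.

Section Contraction.
Local Close Scope classical_set_scope.
Variables (R : realType) (n : nat).
Implicit Types (w : multivector R n) (J K : {set 'I_n}) (i j : 'I_n).

Definition isign J j : R := (-1) ^+ nbelow J j.

Lemma isignM J j : isign J j * isign J j = 1.
Proof. by rewrite /isign -exprD addnn -mul2n exprM sqrrN !expr1n. Qed.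

Lemma isign_neq0 J j : isign J j != 0.
Proof. by rewrite /isign expf_neq0 // oppr_eq0 oner_eq0. Qed.

Lemma isignU1 J i j : i \notin J ->
  isign (i |: J) j = (-1) ^+ (i < j)%N * isign J j.
Proof. by move=> iJ; rewrite /isign nbelowU1 // exprD. Qed.

Lemma isign_swap K i j : i \notin K -> j \notin K -> i != j ->
  isign (i |: K) j * isign (j |: K) i = - (isign K i * isign K j).
Proof.
move=> iK jK ij; rewrite !isignU1 // mulrACA -exprD.
have -> : ((i < j) + (j < i) = 1)%N.
  by move: ij; rewrite -(inj_eq val_inj) /=; case: ltngtP.
by rewrite expr1 mulN1r mulrC.
Qed.

(** The vector obtained by contracting w with the elementary covector dx_J:
    its i-th coordinate is <w; dx_i /\ dx_J>. *)
Definition contr w J : 'rV[R]_n :=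
  \row_i (if i \in J then 0 else isign J i * w (i |: J)).

Lemma wedge_card h (A : 'M[R]_(h, n)) J : #|J| != h -> wedge A J = 0.
Proof. by rewrite /wedge; case: eqP. Qed.

Lemma wedge_mulmx h (M : 'M[R]_h) (A : 'M[R]_(h, n)) J :
  wedge (M *m A) J = \det M * wedge A J.
Proof.
rewrite /wedge; case: eqP => [e|_]; last by rewrite mulr0.
rewrite -det_mulmx; congr (\det _); apply/matrixP => i j.
by rewrite !mxE; apply: eq_bigr => l _; rewrite !mxE.
Qed.

(** The contraction of a simple multivector lies in its span: expanding
    each minor along the column of j exhibits the contraction as a combination
    of the rows of A, with cofactors as coefficients. *)
Lemma contr_wedge_sub h (A : 'M[R]_(h.+1, n)) J : #|J| = h ->
  (contr (wedge A) J <= A)%MS.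
Proof.
move=> Jh.
pose f (b : 'I_h) : 'I_n := enum_val (cast_ord (esym Jh) b).
have fJ b : f b \in J by exact: enum_valP.
have f_below b : nbelow J (f b) = b by rewrite nbelow_enum_val.
pose c (b : 'I_h.+1) : R := (-1) ^+ b * \det (row' b (colsub f A)).
suff -> : contr (wedge A) J = (\row_b c b) *m A by exact: submxMl.
apply/rowP => j; rewrite !mxE; under eq_bigr do rewrite mxE.
case: ifPn => [jJ|jJ].
  (* for j in J the same expansion is that of a minor with a repeated column *)
  pose M : 'M[R]_h.+1 := \matrix_(a, b) (if unlift ord0 b is Some b' then A a (f b') else A a j).
  have -> : \sum_b c b * A b j = \det M.
    rewrite (expand_det_col M ord0); apply: eq_bigr => b _.
    rewrite mxE unlift_none mulrC /cofactor addn0; congr (_ * ((-1) ^+ _ * \det _)).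
    by apply/matrixP => a b'; rewrite !mxE liftK.
  rewrite -det_tr; pose q := cast_ord Jh (enum_rank_in jJ j).
  have fq : f q = j by rewrite /f /q cast_ordK enum_rankK_in.
  apply/esym; apply: (@determinant_alternate _ _ _ ord0 (lift ord0 q)) => [|b].
    by rewrite -(inj_eq val_inj).
  by rewrite !mxE unlift_none liftK fq.
have JU : #|j |: J| = h.+1 by rewrite cardsU1 jJ Jh.
rewrite /wedge; case: eqP => [e|]; last by rewrite JU.
pose g (b : 'I_h.+1) : 'I_n := enum_val (cast_ord (esym e) b).
have g_below b : nbelow (j |: J) (g b) = b by rewrite nbelow_enum_val.
have gE x : x \in j |: J -> exists b, g b = x /\ b = nbelow (j |: J) x :> nat.
  move=> xJ; exists (cast_ord e (enum_rank_in xJ x)).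
  have gx : g (cast_ord e (enum_rank_in xJ x)) = x.
    by rewrite /g cast_ordK enum_rankK_in.
  by split=> //; have := g_below (cast_ord e (enum_rank_in xJ x)); rewrite gx => ->.
have [p [gp pE]] := gE j (setU11 _ _).
have {}pE : p = nbelow J j :> nat by rewrite pE nbelowU1 // ltnn.
have gl b : g (lift p b) = f b.
  have [b' [gb' b'E]] := gE (f b) (setU1r _ (fJ b)).
  rewrite -gb'; congr g; apply: val_inj; rewrite /= b'E nbelowU1 // f_below /bump.
  by rewrite pE -{1}(f_below b) nbelow_leq.
rewrite (expand_det_col _ p) mulr_sumr; apply: eq_bigr => b _.
rewrite /cofactor mxE -/(g p) gp mulrCA [RHS]mulrC; congr (_ * _).
rewrite /c mulrA; congr (_ * _).
  by rewrite /isign -pE exprD mulrCA -exprD addnn -mul2n exprM sqrrN !expr1n mulr1.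
congr (\det _); apply/matrixP => a b'; rewrite !mxE.
by congr (A _ _); rewrite -gl.
Qed.

End Contraction.

Section NormalFrame.
Local Close Scope classical_set_scope.
Variables (R : realType) (n h : nat) (F : 'M[R]_(h.+1, n)) (I0 : {set 'I_n}).
Hypothesis p_neq0 : wedge F I0 != 0.
Local Notation p := (wedge F I0).

Lemma minor_card : #|I0| = h.+1.
Proof. by apply/eqP; apply: contraNT p_neq0 => /wedge_card ->. Qed.

Lemma minor_sub_eq0 (u : 'rV[R]_n) : (u <= F)%MS ->
  (forall i, i \in I0 -> u 0 i = 0) -> u = 0.
Proof.
move=> /submxP[y ->] hu.
have := p_neq0; rewrite /wedge; case: eqP => [e|]; last by rewrite eqxx.
pose f (b : 'I_h.+1) : 'I_n := enum_val (cast_ord (esym e) b).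
rewrite -/f => det0.
have yf : y *m colsub f F = 0.
  apply/rowP => b; have := hu (f b) (enum_valP _).
  by rewrite !mxE => h0; rewrite -[RHS]h0; apply: eq_bigr => i _; rewrite !mxE.
have fu : colsub f F \in unitmx by rewrite unitmxE unitfE.
by rewrite -[y](mulmxK fu) yf !mul0mx.
Qed.

(** The basis of the row span of F whose coordinates in the columns I0 are
    those of the identity matrix. *)
Definition nframe (a : 'I_n) : 'rV[R]_n :=
  (isign R (I0 :\ a) a * p)^-1 *: contr (wedge F) (I0 :\ a).

Lemma nframe_sub a : a \in I0 -> (nframe a <= F)%MS.
Proof.
move=> aI; apply: scalemx_sub; apply: contr_wedge_sub.
by have := cardsD1 a I0; rewrite aI minor_card => -[].
Qed.

Lemma nframe_coord a i : a \in I0 -> i \in I0 -> nframe a 0 i = (i == a)%:R.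
Proof.
move=> aI iI; rewrite !mxE !inE iI andbT.
have [->|ia] := eqVneq i a; last by rewrite mulr0.
by rewrite /= finset.setD1K // mulVf // mulf_neq0 // isign_neq0.
Qed.

Lemma sub_nframe (u : 'rV[R]_n) : (u <= F)%MS ->
  u = \sum_(a in I0) u 0 a *: nframe a.
Proof.
move=> uF; apply/eqP; rewrite -subr_eq0; apply/eqP; apply: minor_sub_eq0.
  rewrite addmx_sub // eqmx_opp summx_sub // => a aI.
  by apply: scalemx_sub; exact: nframe_sub.
move=> i iI; rewrite !mxE summxE (bigD1 i) //= big1 => [|a /andP[aI ai]].
  by rewrite mxE nframe_coord // eqxx mulr1 addr0 subrr.
by rewrite mxE nframe_coord // eq_sym (negbTE ai) mulr0.
Qed.

(** The sign found by comparing the orderings of J = j |: (I0 :\ a :\ b) and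
    of I0 after exchanging columns. *)
Definition swap_sign a b j : R :=
  isign R (j |: (I0 :\ a :\ b)) a * isign R (I0 :\ b) j * isign R (I0 :\ b) b.

(** The contraction by J = j |: (I0 :\ a :\ b) is in the row span, hence
    determined by its coordinates in the columns of I0; all of them vanish except
    those in the columns a and b, which are minors of F obtained from I0 by
    exchanging one column.  The coefficients involve exactly the entries in
    column j of the basis vectors of indices a and b, which is what later turns
    the relation into a commutation relation. *)
Lemma contr_nframe a b j : a \in I0 -> b \in I0 -> a != b -> j \notin I0 ->
    let e := swap_sign a b j in
    contr (wedge F) (j |: (I0 :\ a :\ b)) =
    (e * nframe b 0 j * isign R (I0 :\ a) a) *: contr (wedge F) (I0 :\ a)
    - (e * nframe a 0 j * isign R (I0 :\ b) b) *: contr (wedge F) (I0 :\ b).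
Proof.
move=> aI bI ab jI e; set K := I0 :\ a :\ b.
have aK : a \notin K by rewrite !inE eqxx andbF.
have bK : b \notin K by rewrite !inE eqxx.
have jK : j \notin K by rewrite !inE (negbTE jI) !andbF.
have ja : j != a by apply: contraNneq jI => ->.
have jb : j != b by apply: contraNneq jI => ->.
have Ia : I0 :\ a = b |: K by rewrite finset.setD1K // !inE eq_sym ab.
have Ib : I0 :\ b = a |: K.
  by apply/setP => x; rewrite !inE; case: (eqVneq x a) => [->|_]; rewrite ?aI ?ab.
have eE : e = isign R (j |: K) a * isign R (I0 :\ b) j * isign R (I0 :\ b) b by [].
pose e' := isign R (j |: K) b * isign R (I0 :\ a) j * isign R (I0 :\ a) a.
have ee' : e * e' = -1.
  have -> : e * e' = (isign R (j |: K) a * isign R (a |: K) j) *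
      (isign R (a |: K) b * isign R (b |: K) a) *
      (isign R (j |: K) b * isign R (b |: K) j).
    by rewrite eE /e' Ia Ib; ring.
  rewrite !isign_swap // 1?eq_sym //.
  have := isignM R K a; have := isignM R K b; have := isignM R K j.
  move=> h1 h2 h3.
  transitivity (- (isign R K j * isign R K j) * (isign R K b * isign R K b) * (isign R K a * isign R K a)); first by ring.
  by rewrite h1 h2 h3; ring.
have e2 : e * e = 1.
  transitivity ((isign R (j |: K) a * isign R (j |: K) a) *
    (isign R (I0 :\ b) j * isign R (I0 :\ b) j) * (isign R (I0 :\ b) b * isign R (I0 :\ b) b)).
    by rewrite eE; ring.
  by rewrite !isignM !mulr1.
have e'E : e' = - e by rewrite -[LHS]mul1r -e2 -mulrA ee' mulrN1.
have cE x : x \in I0 -> j \notin I0 :\ x ->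
    wedge F (j |: (I0 :\ x)) = isign R (I0 :\ x) j * isign R (I0 :\ x) x * p * nframe x 0 j.
  move=> xI jx; rewrite !mxE (negbTE jx).
  have := isignM R (I0 :\ x) j; set s := isign R _ j; set t := isign R _ x => ss.
  have t0 : t != 0 by exact: isign_neq0.
  rewrite -[LHS]mul1r -ss; field; by rewrite p_neq0 t0.
have jIa : j \notin I0 :\ a by rewrite !inE negb_and jI orbT.
have jIb : j \notin I0 :\ b by rewrite !inE negb_and jI orbT.
have JK : #|j |: K| = h.
  have := cardsD1 a I0; have := cardsD1 b (I0 :\ a).
  by rewrite -/K !inE aI bI (eq_sym b) ab cardsU1 jK minor_card => -> [].
rewrite [LHS]sub_nframe; last exact: contr_wedge_sub.
rewrite (bigD1 a) //= (bigD1 b) /=; last by rewrite bI eq_sym.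
rewrite big1 => [|i /andP[/andP[iI ia] ib]]; last first.
  by rewrite mxE !inE ia ib iI orbT scale0r.
have ca : contr (wedge F) (j |: K) 0 a = e * p * nframe b 0 j.
  rewrite mxE !inE eqxx andbF orbF eq_sym (negbTE ja).
  have -> : a |: (j |: K) = j |: (I0 :\ b) by rewrite Ib finset.setUCA.
  by rewrite cE // eE; ring.
have cb : contr (wedge F) (j |: K) 0 b = - (e * p * nframe a 0 j).
  rewrite mxE !inE eqxx orbF eq_sym (negbTE jb).
  have -> : b |: (j |: K) = j |: (I0 :\ a) by rewrite Ia finset.setUCA.
  by rewrite cE // -mulNr -mulNr -e'E /e'; ring.
rewrite ca cb addr0 scaleNr /nframe !scalerA.
have s2 x : x / (isign R (I0 :\ a) a * p) = x * isign R (I0 :\ a) a / p.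
  have := isignM R (I0 :\ a) a; have := isign_neq0 R (I0 :\ a) a.
  set s := isign R _ a => s0 ss; rewrite -[x in LHS]mulr1 -ss; field; by rewrite p_neq0 s0.
have s3 x : x / (isign R (I0 :\ b) b * p) = x * isign R (I0 :\ b) b / p.
  have := isignM R (I0 :\ b) b; have := isign_neq0 R (I0 :\ b) b.
  set s := isign R _ b => s0 ss; rewrite -[x in LHS]mulr1 -ss; field; by rewrite p_neq0 s0.
rewrite [X in X *: _ - _]s2 [X in _ - X *: _]s3.
by congr (_ *: _ - _ *: _); rewrite /nframe; field.
Qed.

End NormalFrame.

(** * Functions of class C1 *)

Section C1Calculus.
Variables (R : realType) (V : normedModType R) (U : set V).
Hypothesis openU : open U.
Implicit Types f g : V -> R.

Lemma near_continuous f g x : (\forall y \near x, f y = g y) ->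
  {for x, continuous f} -> {for x, continuous g}.
Proof.
move=> fg cf; rewrite /prop_for /continuous_at -(nbhs_singleton fg).
by apply: cvg_trans cf; exact: near_eq_cvg.
Qed.

Lemma C1_on_is_derive (f : V -> R) (df : V -> V -> R) :
  (forall y, U y -> differentiable f y) ->
  (forall y u, U y -> 'D_u f y = df y u) ->
  (forall y u, U y -> {for y, continuous (fun z => df z u)}) -> C1_on U f.
Proof.
move=> h1 h2 h3 x Ux; split=> [|u]; first exact: h1.
have near_eq : \forall y \near x, df y u = 'd f y u.
  have /open_nbhs_nbhs : open_nbhs x U by [].
  by apply: filterS => y Uy; rewrite -h2 // deriveE //; exact: h1.
exact: near_continuous near_eq (h3 x u Ux).
Qed.

Lemma C1_on_derive_continuous f y u : C1_on U f -> U y ->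
  {for y, continuous (fun z => 'D_u f z)}.
Proof.
move=> Cf Uy; have [dfy cf] := Cf y Uy.
have near_eq : \forall z \near y, 'd f z u = 'D_u f z.
  have /open_nbhs_nbhs : open_nbhs y U by [].
  by apply: filterS => z Uz; rewrite deriveE //; exact: (Cf z Uz).1.
exact: near_continuous near_eq (cf u).
Qed.

Lemma C1_on_continuous f y : C1_on U f -> U y -> {for y, continuous f}.
Proof. by move=> Cf Uy; apply: differentiable_continuous; exact: (Cf y Uy).1. Qed.

Lemma C1_on_derivable f y u : C1_on U f -> U y -> derivable f y u.
Proof. by move=> Cf Uy; apply: diff_derivable; exact: (Cf y Uy).1. Qed.

Lemma C1_on_cst (c : R) : C1_on U (fun=> c).
Proof.
apply: (@C1_on_is_derive _ (fun _ _ => 0)) => [y _|y u _|y u _].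
- exact: differentiable_cst.
- by rewrite derive_cst.
- exact: cvg_cst.
Qed.

Lemma C1_on_add f g : C1_on U f -> C1_on U g -> C1_on U (fun x => f x + g x).
Proof.
move=> Cf Cg; apply: (@C1_on_is_derive _ (fun y u => 'D_u f y + 'D_u g y)).
- by move=> y Uy; apply: differentiableD; [exact: (Cf y Uy).1|exact: (Cg y Uy).1].
- by move=> y u Uy; rewrite deriveD //; exact: C1_on_derivable.
- by move=> y u Uy; apply: cvgD; exact: C1_on_derive_continuous.
Qed.

Lemma C1_on_mul f g : C1_on U f -> C1_on U g -> C1_on U (fun x => f x * g x).
Proof.
move=> Cf Cg; apply: (@C1_on_is_derive _ (fun y u => f y * 'D_u g y + g y * 'D_u f y)).
- by move=> y Uy; apply: differentiableM; [exact: (Cf y Uy).1|exact: (Cg y Uy).1].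
- by move=> y u Uy; rewrite deriveM //; exact: C1_on_derivable.
- move=> y u Uy; apply: cvgD; apply: cvgM; try exact: C1_on_derive_continuous;
    exact: C1_on_continuous.
Qed.

Lemma C1_on_inv f : (forall y, U y -> f y != 0) -> C1_on U f ->
  C1_on U (fun x => (f x)^-1).
Proof.
move=> f0 Cf.
apply: (@C1_on_is_derive _ (fun y u => - ((f y)^-1 * (f y)^-1) * 'D_u f y)).
- by move=> y Uy; apply: differentiableV; [exact: (Cf y Uy).1|exact: f0].
- move=> y u Uy; rewrite deriveV ?f0 //; last exact: C1_on_derivable.
  by rewrite /GRing.scale /= expr2 invfM.
- move=> y u Uy; apply: cvgM; last exact: C1_on_derive_continuous.
  by apply: cvgN; apply: cvgM; (apply: cvgV; [exact: f0|exact: C1_on_continuous]).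
Qed.

Lemma C1_on_sum (I : Type) (r : seq I) (P : pred I) (G : I -> V -> R) :
  (forall i, P i -> C1_on U (G i)) -> C1_on U (fun x => \sum_(i <- r | P i) G i x).
Proof.
move=> CG; elim: r => [|i r IH].
  by under eq_fun do rewrite big_nil; exact: C1_on_cst.
under eq_fun do rewrite big_cons.
have [Pi|_] := boolP (P i); last exact: IH.
by apply: C1_on_add; [exact: CG|exact: IH].
Qed.

Lemma C1_on_prod (I : Type) (r : seq I) (P : pred I) (G : I -> V -> R) :
  (forall i, P i -> C1_on U (G i)) -> C1_on U (fun x => \prod_(i <- r | P i) G i x).
Proof.
move=> CG; elim: r => [|i r IH].
  by under eq_fun do rewrite big_nil; exact: C1_on_cst.
under eq_fun do rewrite big_cons.
have [Pi|_] := boolP (P i); last exact: IH.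
by apply: C1_on_mul; [exact: CG|exact: IH].
Qed.

Lemma C1_on_det (m : nat) (M : V -> 'M[R]_m) :
  (forall i j, C1_on U (fun x => M x i j)) -> C1_on U (fun x => \det (M x)).
Proof.
move=> CM; apply: C1_on_sum => s _; apply: C1_on_mul; first exact: C1_on_cst.
by apply: C1_on_prod => i _; exact: CM.
Qed.

Lemma C1_on_coord (n : nat) (f : V -> 'rV[R]_n) j : C1_on U f ->
  C1_on U (fun x => f x 0 j).
Proof.
move=> Cf; apply: (@C1_on_is_derive _ (fun y u => 'd f y u 0 j)).
- move=> y Uy; apply: (@differentiable_comp _ _ _ _ f (fun M : 'rV[R]_n => M 0 j)).
    exact: (Cf y Uy).1.
  exact: differentiable_coord.
- move=> y u Uy; have [dfy _] := Cf y Uy.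
  have := derive_mx (@diff_derivable _ _ _ f y u dfy).
  by rewrite deriveE // => ->; rewrite mxE.
- move=> y u Uy.
  apply: (@continuous_comp _ _ _ (fun z => 'd f z u) (fun M : 'rV[R]_n => M 0 j)).
    exact: (Cf y Uy).2.
  exact: coord_continuous.
Qed.

Lemma C1_on_wedge (n k : nat) (v : 'I_k -> V -> 'rV[R]_n) (I : {set 'I_n}) :
  (forall i, C1_on U (v i)) ->
  C1_on U (fun x => wedge (\matrix_i v i x) I).
Proof.
move=> Cv; rewrite /wedge; case: eqP => [e|_]; last exact: C1_on_cst.
apply: C1_on_det => i j.
rewrite (_ : (fun _ => _) = fun x => v i x 0 (enum_val (cast_ord (esym e) j))).
  exact: C1_on_coord.
by apply/funext => x; rewrite !mxE.
Qed.

End C1Calculus.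

(** * From the contraction identity to involutivity *)

Lemma is_derive_big_sum (R : realType) (V : normedModType R) (I : Type)
    (r : seq I) (P : pred I) (G : I -> V -> R) (dG : I -> R) (x u : V) :
  (forall i, P i -> is_derive x u (G i) (dG i)) ->
  is_derive x u (fun y => \sum_(i <- r | P i) G i y) (\sum_(i <- r | P i) dG i).
Proof.
move=> hG; elim: r => [|i r IH].
  by under eq_fun do rewrite big_nil; rewrite big_nil; exact: is_derive_cst.
under eq_fun do rewrite big_cons; rewrite big_cons.
have [Pi|_] := boolP (P i); last exact: IH.
by have hi := hG i Pi; exact: is_deriveD.
Qed.

Lemma cancel_swap (R : fieldType) (p d1 d2 e sa sb : R) :
  e != 0 -> p != 0 -> sa * sa = 1 -> sb * sb = 1 ->
  sa * p * (- e * sa * d1) + sb * p * (e * sb * d2) = 0 -> d1 = d2.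
Proof.
move=> e0 p0 ssa ssb H.
apply/eqP; rewrite -subr_eq0; apply/eqP/(mulfI e0)/(mulfI p0).
rewrite !mulr0 -[RHS]oppr0 -[in RHS]H.
transitivity (e * p * ((sa * sa) * d1 - (sb * sb) * d2)); last by ring.
by rewrite ssa ssb; ring.
Qed.

(** Pure index bookkeeping: for symmetric D the two double sums are exchanged
    by swapping the indices. *)
Lemma sum_antisym (R : comPzRingType) (I : finType) (P : pred I) (s t : I -> R)
    (D : I -> I -> R) : (forall a b, P a -> P b -> D a b = D b a) ->
  \sum_(a | P a) (t a * (\sum_(b | P b) s b * D b a) -
                  s a * (\sum_(b | P b) t b * D b a)) = 0.
Proof.
move=> Dsym; rewrite sumrB; apply/eqP; rewrite subr_eq0; apply/eqP.
under eq_bigr do rewrite mulr_sumr.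
under [RHS]eq_bigr do rewrite mulr_sumr.
rewrite [RHS]exchange_big; apply: eq_bigr => a Pa; apply: eq_bigr => b Pb.
by rewrite (Dsym _ _ Pa Pb) mulrCA.
Qed.

(** The hypothesis [contraction_id] is the infinitesimal content of Stokes'
    identity at x0: whenever C1 coefficients g annihilate the contractions of v,
    the sum of their derivatives along these contractions vanishes. *)
Section Involutive.
Variables (R : realType) (n h : nat) (U : set 'rV[R]_n).
Variable v : 'I_h.+1 -> 'rV[R]_n -> 'rV[R]_n.
Variables (x0 : 'rV[R]_n) (I0 : {set 'I_n}).
Hypotheses (openU : open U) (Ux0 : U x0) (Cv : forall i, C1_on U (v i)).
Local Notation wF x := (wedge (frame v x)).
Hypothesis p_neq0 : forall x, U x -> wF x I0 != 0.
Hypothesis contraction_id : forall g : {set 'I_n} -> 'rV[R]_n -> R,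
  (forall J, C1_on U (g J)) -> (forall (J : {set 'I_n}) x, #|J| != h -> g J x = 0) ->
  (forall x, U x -> \sum_J g J x *: contr (wF x) J = 0) ->
  \sum_J 'D_(contr (wF x0) J) (g J) x0 = 0.

Let c a j x := nframe (frame v x) I0 a 0 j.

Let C1_c a j : C1_on U (c a j).
Proof.
rewrite (_ : c a j = fun x => (isign R (I0 :\ a)%SET a * wF x I0)^-1 *
    (if j \in (I0 :\ a)%SET then 0 else isign R (I0 :\ a)%SET j * wF x (j |: I0 :\ a)%SET)); last first.
  by apply/funext => x; rewrite /c !mxE.
apply: C1_on_mul => //.
  apply: C1_on_inv => // [y Uy|].
    by rewrite mulf_neq0 ?isign_neq0 ?p_neq0.
  by apply: C1_on_mul => //; [exact: C1_on_cst|exact: C1_on_wedge].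
case: (boolP (j \in (I0 :\ a)%SET)) => _; first exact: C1_on_cst.
by apply: C1_on_mul => //; [exact: C1_on_cst|exact: C1_on_wedge].
Qed.

Let diff_x0 (f : 'rV[R]_n -> R) : C1_on U f -> differentiable f x0.
Proof. by move=> Cf; exact: (Cf x0 Ux0).1. Qed.

Let derive_scale (f : 'rV[R]_n -> R) (a : R) u : C1_on U f ->
  'D_(a *: u) f x0 = a * 'D_u f x0.
Proof. by move=> /diff_x0 df; rewrite !deriveE // linearZ. Qed.

Let derive_sumv (f : 'rV[R]_n -> R) (t : 'I_n -> R) (w : 'I_n -> 'rV[R]_n) :
  C1_on U f ->
  'D_(\sum_(a in I0) t a *: w a) f x0 = \sum_(a in I0) t a * 'D_(w a) f x0.
Proof.
move=> /diff_x0 df; rewrite deriveE // linear_sum; apply: eq_bigr => a _.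
by rewrite linearZ deriveE.
Qed.

Let w a := nframe (frame v x0) I0 a.

(** The relation [contr_nframe], read as a relation among three contractions
    with C1 coefficients, is fed to [contraction_id]; one coefficient is constant
    and the other two are multiples of c b j and c a j. *)
Let commute a b j : a \in I0 -> b \in I0 -> j \notin I0 ->
  'D_(w a) (c b j) x0 = 'D_(w b) (c a j) x0.
Proof.
move=> aI bI jI; have [->//|ab] := eqVneq a b.
pose J1 := (I0 :\ a)%SET; pose J2 := (I0 :\ b)%SET.
pose J3 := (j |: (I0 :\ a :\ b))%SET.
pose e := swap_sign R I0 a b j; pose sa := isign R J1 a; pose sb := isign R J2 b.
have key x : U x -> contr (wF x) J3 =
    (e * c b j x * sa) *: contr (wF x) J1 - (e * c a j x * sb) *: contr (wF x) J2.
  by move=> Ux; exact: (contr_nframe (p_neq0 Ux) aI bI ab jI).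
have ja : j != a by apply: contraNneq jI => ->.
have jb : j != b by apply: contraNneq jI => ->.
have J12 : J1 != J2.
  by apply/eqP => /setP/(_ a); rewrite !inE eqxx ab aI.
have J13 : J1 != J3.
  by apply/eqP => /setP/(_ j); rewrite !inE eqxx (negbTE jI) andbF.
have J23 : J2 != J3.
  by apply/eqP => /setP/(_ j); rewrite !inE eqxx (negbTE jI) andbF.
have J1h : #|J1| = h.
  by have := cardsD1 a I0; rewrite aI (minor_card (p_neq0 Ux0)) => -[].
have J2h : #|J2| = h.
  by have := cardsD1 b I0; rewrite bI (minor_card (p_neq0 Ux0)) => -[].
have J3h : #|J3| = h.
  rewrite cardsU1 !inE (negbTE jI) !andbF /=.
  by have := cardsD1 b J1; rewrite !inE (eq_sym b) ab bI J1h => ->.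
pose g (J : {set 'I_n}) (x : 'rV[R]_n) : R :=
  if J == J1 then - (e * c b j x * sa) else if J == J2 then e * c a j x * sb
  else if J == J3 then 1 else 0.
have g1 : g J1 = fun x => - e * sa * c b j x.
  by apply/funext => x; rewrite /g eqxx; ring.
have g2 : g J2 = fun x => e * sb * c a j x.
  by apply/funext => x; rewrite /g eq_sym (negbTE J12) eqxx; ring.
have g3 : g J3 = fun=> 1.
  by apply/funext => x; rewrite /g !(eq_sym J3) (negbTE J13) (negbTE J23) eqxx.
have g0 J : J != J1 -> J != J2 -> J != J3 -> g J = fun=> 0.
  by move=> h1 h2 h3; apply/funext => x; rewrite /g (negbTE h1) (negbTE h2) (negbTE h3).
have Cg J : C1_on U (g J).
  have [->|n1] := eqVneq J J1.
    by rewrite g1; apply: C1_on_mul; [|exact: C1_on_cst|exact: C1_c].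
  have [->|n2] := eqVneq J J2.
    by rewrite g2; apply: C1_on_mul; [|exact: C1_on_cst|exact: C1_c].
  have [->|n3] := eqVneq J J3; first by rewrite g3; exact: C1_on_cst.
  by rewrite g0 //; exact: C1_on_cst.
have sum3 (M : zmodType) (G : {set 'I_n} -> M) :
    (forall J, J != J1 -> J != J2 -> J != J3 -> G J = 0) ->
    \sum_J G J = G J1 + G J2 + G J3.
  move=> G0; rewrite (bigD1 J1) //= (bigD1 J2) /=; last by rewrite eq_sym.
  rewrite (bigD1 J3) /=; last by rewrite eq_sym J13 eq_sym.
  by rewrite big1 ?addr0 ?addrA // => J /andP[/andP[h1 h2] h3]; exact: G0.
have gh (J : {set 'I_n}) x : #|J| != h -> g J x = 0.
  by move=> hJ; rewrite g0 //; apply: contraNneq hJ => ->; exact/eqP.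
have rel x : U x -> \sum_J g J x *: contr (wF x) J = 0.
  move=> Ux; rewrite sum3; last by move=> J h1 h2 h3; rewrite g0 // scale0r.
  rewrite g1 g2 g3 scale1r key //.
  have -> : - e * sa * c b j x = - (e * c b j x * sa) by ring.
  have -> : e * sb * c a j x = e * c a j x * sb by ring.
  by rewrite scaleNr addrACA addNr add0r subrr.
have := contraction_id Cg gh rel.
rewrite sum3; last by move=> J h1 h2 h3; rewrite g0 // derive_cst.
rewrite g1 g2 g3 derive_cst addr0.
have contrE x0a : x0a \in I0 -> contr (wF x0) (I0 :\ x0a)%SET =
    (isign R (I0 :\ x0a)%SET x0a * wF x0 I0) *: w x0a.
  move=> xI; rewrite /w /nframe scalerA divff ?scale1r //.
  by rewrite mulf_neq0 ?isign_neq0 ?p_neq0.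
rewrite !contrE // -/J1 -/J2 -/sa -/sb.
have dc (r : R) x y u : 'D_u (fun z => r * c x y z) x0 = r * 'D_u (c x y) x0.
  rewrite deriveM; [|exact: derivable_cst|by apply: diff_derivable; apply: diff_x0; exact: C1_c].
  by rewrite derive_cst /GRing.scale /= mulr0 addr0.
have Cg1 := Cg J1; have Cg2 := Cg J2; rewrite g1 in Cg1; rewrite g2 in Cg2.
rewrite (derive_scale _ _ Cg1) (derive_scale _ _ Cg2) !dc.
have ssa : sa * sa = 1 by exact: isignM.
have ssb : sb * sb = 1 by exact: isignM.
have e0 : e != 0 by rewrite /e /swap_sign !mulf_neq0 ?isign_neq0.
have p0 := p_neq0 Ux0.
exact: (cancel_swap e0 p0 ssa ssb).
Qed.

(** Writing v_i = sum_a (v_i)_a w_a, the bracket [v_i, v_l] splits into a part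
    in the span of the w_a and a double sum of the derivatives D_(w_b) of the
    coordinates of w_a; the latter vanishes since the w_a commute. *)
Lemma involutive_of_contraction_identity : involutive_at v x0.
Proof.
have Cvi i j : C1_on U (fun x => v i x 0 j) by exact: C1_on_coord.
have vF i x : (v i x <= frame v x)%MS.
  by have := row_sub i (frame v x); rewrite rowK.
have v_exp i x j : U x -> v i x 0 j = \sum_(a in I0) v i x 0 a * c a j x.
  move=> Ux; rewrite {1}(sub_nframe (p_neq0 Ux) (vF i x)) summxE.
  by apply: eq_bigr => a _; rewrite mxE.
have vx0 i : v i x0 = \sum_(a in I0) v i x0 0 a *: w a.
  exact: (sub_nframe (p_neq0 Ux0) (vF i x0)).
have Dv i a j : 'D_(v i x0) (c a j) x0 =
    \sum_(b in I0) v i x0 0 b * 'D_(w b) (c a j) x0.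
  by have := derive_sumv (fun b => v i x0 0 b) w (C1_c a j); rewrite -vx0.
have dv_coord i u j : 'D_u (v i) x0 0 j = 'D_u (fun x => v i x 0 j) x0.
  have [dvi _] := Cv i Ux0.
  by rewrite (derive_mx (@diff_derivable _ _ _ (v i) x0 u dvi)) mxE.
have dv_exp i u j : 'D_u (fun x => v i x 0 j) x0 =
    \sum_(a in I0) ('D_u (fun x => v i x 0 a) x0 * c a j x0 + v i x0 0 a * 'D_u (c a j) x0).
  rewrite (@near_eq_derive _ _ _ _ (fun x => \sum_(a in I0) v i x 0 a * c a j x)); last first.
    have /open_nbhs_nbhs : open_nbhs x0 U by [].
    by apply: filterS => y Uy; exact: v_exp.
  have dac a : is_derive x0 u (fun x => v i x 0 a * c a j x)
      ('D_u (fun x => v i x 0 a) x0 * c a j x0 + v i x0 0 a * 'D_u (c a j) x0).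
    have d1 : derivable (fun x => v i x 0 a) x0 u.
      by apply: diff_derivable; exact: diff_x0.
    have d2 : derivable (c a j) x0 u.
      by apply: diff_derivable; apply: diff_x0; exact: C1_c.
    split; first exact: derivableM.
    by rewrite deriveM // /GRing.scale /= addrC mulrC.
  have := @is_derive_big_sum _ _ _ (index_enum 'I_n) (mem I0) _ _ x0 u (fun a _ => dac a).
  by move=> dsum; exact: (@derive_val _ _ _ _ _ _ _ dsum).
move=> i l.
pose z := lie_bracket (v i) (v l) x0.
have zA a : z 0 a = 'D_(v i x0) (fun x => v l x 0 a) x0 - 'D_(v l x0) (fun x => v i x 0 a) x0.
  by rewrite /z /lie_bracket -!dv_coord !mxE.
have zE j : z 0 j = \sum_(a in I0) z 0 a * c a j x0 + \sum_(a in I0) (v l x0 0 a * 'D_(v i x0) (c a j) x0 - v i x0 0 a * 'D_(v l x0) (c a j) x0).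
  rewrite zA !dv_exp -sumrB -big_split /=.
  by apply: eq_bigr => a _; rewrite zA opprD addrACA -mulrBl.
rewrite /row_span /= -/z.
have -> : z = \sum_(a in I0) z 0 a *: w a.
  apply/rowP => j; rewrite {1}zE summxE [X in _ + X](_ : _ = 0) ?addr0.
    by apply: eq_bigr => a _; rewrite [RHS]mxE.
  have [jI|jI] := boolP (j \in I0).
    rewrite big1 // => a aI.
    have dc0 u : 'D_u (c a j) x0 = 0.
      rewrite (@near_eq_derive _ _ R _ (fun=> (j == a)%:R : R)) ?derive_cst //.
      have /open_nbhs_nbhs : open_nbhs x0 U by [].
      by apply: filterS => y Uy; exact: (nframe_coord (p_neq0 Uy) aI jI).
    by rewrite !dc0 !mulr0 subr0.
  pose D b a := 'D_(w b) (c a j) x0.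
  have Dsym a b : a \in I0 -> b \in I0 -> D a b = D b a.
    by move=> aI bI; exact: commute.
  apply: etrans (sum_antisym (v i x0 0) (v l x0 0) Dsym).
  by apply: eq_bigr => a _; rewrite (Dv i) (Dv l).
rewrite summx_sub // => a aI; apply: scalemx_sub.
exact: (nframe_sub (p_neq0 Ux0) aI).
Qed.

End Involutive.

(** * Smooth approximation of functions of class C1 *)

Section RowNorm.
Variables (R : realType) (n : nat).
Implicit Types x y z : 'rV[R]_n.

Lemma coord_le_norm z l : `|z 0 l| <= `|z|.
Proof. by rewrite [leRHS]/Num.Def.normr /= mx_normrE; exact: (le_bigmax _ (fun i => `|z i.1 i.2|) (0, l)). Qed.

Lemma norm_le_coord z (d : R) : 0 <= d -> (forall l, `|z 0 l| <= d) -> `|z| <= d.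
Proof.
move=> d0 h; rewrite [leLHS]/Num.Def.normr /= mx_normrE; apply: bigmax_le => // -[i l] _ /=.
by rewrite (ord1 i).
Qed.

Lemma ball_rV x y (r : R) : ball x r y <-> `|y - x| < r.
Proof. by rewrite -ball_normE /ball_ /= distrC. Qed.

Lemma derive_basis (f : 'rV[R]_n -> R) x u : differentiable f x ->
  'D_u f x = \sum_l 'D_(basis_vec R l) f x * u 0 l.
Proof.
move=> df; rewrite deriveE // {1}[u]row_sum_delta linear_sum.
by apply: eq_bigr => l _; rewrite linearZ deriveE // /GRing.scale /= mulrC.
Qed.

(** The point z has to stay close to x, not only in the ball, as the
    oscillation of the derivatives is controlled near x only. *)
Lemma mean_value_ball (f : 'rV[R]_n -> R) x0 (r : R) x y :
  (forall z, ball x0 r z -> differentiable f z) -> ball x0 r x -> ball x0 r y ->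
  exists z, [/\ ball x0 r z, `|z - x| <= `|y - x| &
    f y - f x = \sum_l 'D_(basis_vec R l) f z * (y - x) 0 l].
Proof.
move=> df bx by_.
pose z t : 'rV[R]_n := t *: (y - x) + x.
have bz t : t \in `[0, 1]%R -> ball x0 r (z t).
  rewrite in_itv /= => /andP[t0 t1]; apply/ball_rV.
  have -> : z t - x0 = t *: (y - x0) + (1 - t) *: (x - x0).
    by apply/rowP => l; rewrite !mxE; ring.
  apply: le_lt_trans (ler_normD _ _) _; rewrite !normrZ (ger0_norm t0) ger0_norm ?subr_ge0 //.
  move/ball_rV : bx => bx; move/ball_rV : by_ => by_.
  have [->|t0'] := eqVneq t 0; first by rewrite mul0r add0r subr0 mul1r.
  have tp : 0 < t by rewrite lt_neqAle eq_sym t0'.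
  have h1 : t * `|y - x0| < t * r by rewrite ltr_pM2l.
  have h2 : (1 - t) * `|x - x0| <= (1 - t) * r by rewrite ler_wpM2l ?subr_ge0 // ltW.
  lra.
have dz (t : R) : t \in `[0, 1]%R ->
    is_derive t 1 (fun s => f (z s)) ('D_(y - x) f (z t)).
  move=> t01; have dfz := df _ (bz t t01).
  have dzt : is_diff t (z : R -> 'rV[R]_n) ( *:%R^~ (y - x)).
    have -> : z = (fun s : R => s *: (y - x)) + cst x by [].
    by apply: is_diff_eq; rewrite addr0.
  have dfzt : differentiable (fun s => f (z s)) t.
    by apply: (@differentiable_comp _ _ _ _ z f) => //; exact: ex_diff.
  split; first exact: diff_derivable.
  rewrite deriveE // (@diff_comp _ _ _ _ z f) //.
  by rewrite /= diff_val scale1r deriveE.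
pose g s := f (z s); pose dg s := 'D_(y - x) f (z s).
have H1 (t : R) : t \in `]0, 1[%R -> is_derive t 1 g (dg t).
  by move=> t01; apply: dz; exact: subset_itv_oo_cc.
have H2 : {within `[0, 1], continuous g}.
  apply: derivable_within_continuous => t t01.
  exact: (@ex_derive _ _ _ _ _ _ _ (dz t t01)).
have [t t01] := @MVT_segment R g dg 0 1 ler01 H1 H2; rewrite /g /dg.
rewrite /z scale1r scale0r add0r subrK subr0 mulr1 => E.
exists (z t); split; first exact: bz.
  rewrite /z addrK normrZ; move: t01; rewrite in_itv /= => /andP[t0 t1].
  by rewrite ger0_norm // ler_piMl.
by rewrite E derive_basis //; apply: df; exact: bz.
Qed.

End RowNorm.

Section Counting.
Variable R : realType.

(** At most three integers lie within distance 1 of t. *)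
Lemma sum_unit_window (b : R -> R) (B t : R) N : 0 <= B ->
  (forall s, `|b s| <= B) -> (forall s, 1 < `|s| -> b s = 0) ->
  \sum_(c < N.+1) `|b (t - c%:R)| <= 3 * B.
Proof.
move=> B0 bB bout.
pose S := [pred c : 'I_N.+1 | `|t - c%:R| <= 1].
have -> : \sum_(c < N.+1) `|b (t - c%:R)| = \sum_(c in S) `|b (t - c%:R)|.
  rewrite [RHS]big_mkcond; apply: eq_bigr => c _; case: ifPn => //.
  by rewrite inE -ltNge => h; rewrite bout // normr0.
apply: (@le_trans _ _ (\sum_(c in S) B)); first by apply: ler_sum => c _.
rewrite sumr_const; apply: (@le_trans _ _ (#|S|%:R * B)); first by rewrite mulr_natl.
rewrite ler_wpM2r // ler_nat.
have [c0 Sc0|S0] := pickP S; last by rewrite eq_card0.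
have [c1 Sc1 minc1] := arg_minnP (fun c : 'I_N.+1 => (c : nat)) Sc0.
have sub : S \subset [set inord (c1 + i) | i : 'I_3]%SET.
  apply/fintype.subsetP => c Sc; have := minc1 c Sc => c1c.
  move: Sc1 Sc; rewrite !inE !ler_distl => /andP[h1 h2] /andP[h3 h4].
  have c3 : (c - c1 < 3)%N.
    rewrite ltnS leq_subLR -(ler_nat R) natrD; lra.
  apply/imsetP; exists (Ordinal c3) => //; apply: val_inj.
  by rewrite /= subnKC // inordK.
by apply: leq_trans (subset_leq_card sub) _; apply: leq_trans (leq_imset_card _ _) _; rewrite card_ord.
Qed.

End Counting.

(** A smooth partition of unity on the cube of centre x0 and half side d M,
    subordinate to the grid of step d. *)
Section Partition.
Variables (R : realType) (n : nat) (x0 : 'rV[R]_n) (d : R) (M : nat).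
Hypothesis d_gt0 : 0 < d.
Local Notation pt := 'rV[R]_n.
Local Notation index := {ffun 'I_n -> 'I_(M.*2.+1)}.
Implicit Types (i : index) (x : pt) (j l : 'I_n).

Definition node i : pt := \row_l (x0 0 l + d * ((i l)%:R - M%:R)).

Definition node_coord x l : R := (x 0 l - x0 0 l) / d + M%:R.

Definition cell i x : R := \prod_l bump_fun (node_coord x l - (i l)%:R).

Definition cell_factor j l (t : R) : R :=
  if l == j then d^-1 * dbump t else bump_fun t.

Lemma elementary_cell i : elementary (cell i).
Proof.
apply: elementary_prod => l _; apply: elementary_bump.
apply: elementary_sub; last exact: elementary_cst.
apply: elementary_add; last exact: elementary_cst.
apply: elementary_mul; last exact: elementary_cst.
apply: elementary_sub; last exact: elementary_cst.
exact: elementary_coord.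
Qed.

Lemma derive_cell i x j :
  'D_(basis_vec R j) (cell i) x =
  \prod_l cell_factor j l (node_coord x l - (i l)%:R).
Proof.
pose u l (y : pt) := node_coord y l - (i l)%:R.
have eu l : elementary (u l).
  apply: elementary_sub; last exact: elementary_cst.
  apply: elementary_add; last exact: elementary_cst.
  apply: elementary_mul; last exact: elementary_cst.
  apply: elementary_sub; last exact: elementary_cst.
  exact: elementary_coord.
rewrite (_ : cell i = fun y => bump_fun (u j y) * \prod_(l | l != j) bump_fun (u l y)); last first.
  by apply/funext => y; rewrite /cell (bigD1 j).
rewrite deriveM; last 2 first.
- apply: diff_derivable; apply: elementary_differentiable.
  exact: elementary_bump.
- apply: diff_derivable; apply: elementary_differentiable.
  by apply: elementary_prod => l _; exact: elementary_bump.
have -> : 'D_(basis_vec R j) (fun y => \prod_(l | l != j) bump_fun (u l y)) x = 0.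
  apply: lim_near_cst => //; apply: nearW => h /=.
  rewrite (_ : \prod_(l | l != j) bump_fun (u l (h *: basis_vec R j + x)) =
    \prod_(l | l != j) bump_fun (u l x)) ?subrr ?scaler0 //.
  apply: eq_bigr => l lj; congr (bump_fun _).
  by rewrite /u /node_coord !mxE eqxx (negbTE lj) mulr0 add0r.
rewrite scaler0 add0r (derive_comp1 (basis_vec R j) (is_derive_bump (u j x))); last first.
  exact: elementary_differentiable.
have -> : 'D_(basis_vec R j) (u j) x = d^-1.
  have h0 y : derivable (fun y : pt => y 0 j) y (basis_vec R j).
    by apply: diff_derivable; exact: differentiable_coord.
  have -> : u j = (fun y => d^-1 * (fun y : pt => y 0 j) y + (- x0 0 j / d + M%:R - (i j)%:R)).
    by apply/funext => y; rewrite /u /node_coord; ring.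
  rewrite deriveD; [|exact: derivableM|exact: derivable_cst].
  rewrite derive_cst addr0 deriveM //.
  by rewrite derive_cst scaler0 addr0 derive_coord mxE !eqxx /GRing.scale /= mulr1.
rewrite [RHS](bigD1 j) //= {1}/cell_factor eqxx /GRing.scale /=.
rewrite mulrC [dbump _ * _]mulrC; congr (_ * _); apply: eq_bigr => l lj.
by rewrite /cell_factor (negbTE lj).
Qed.

Section InCube.
Variable x : pt.
Hypothesis x_cube : `|x - x0| <= d * M%:R.

Let coord_bound l : 0 <= node_coord x l <= M.*2%:R.
Proof.
have := le_trans (coord_le_norm (x - x0) l) x_cube.
rewrite !mxE ler_norml => /andP[h1 h2]; rewrite /node_coord -addnn natrD.
have h3 : - M%:R <= (x 0 l - x0 0 l) / d by rewrite ler_pdivlMr // mulNr mulrC.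
have h4 : (x 0 l - x0 0 l) / d <= M%:R by rewrite ler_pdivrMr // mulrC.
by apply/andP; split; lra.
Qed.

Lemma sum_cell : \sum_i cell i x = 1.
Proof.
rewrite /cell -(bigA_distr_bigA (fun l (c : 'I_M.*2.+1) => bump_fun (node_coord x l - c%:R))).
by rewrite big1 // => l _; exact: sum_bump.
Qed.

Lemma sum_derive_cell j : \sum_i 'D_(basis_vec R j) (cell i) x = 0.
Proof.
under eq_bigr do rewrite derive_cell.
rewrite -(bigA_distr_bigA (fun l (c : 'I_M.*2.+1) => cell_factor j l (node_coord x l - c%:R))).
rewrite (bigD1 j) //= /cell_factor eqxx -mulr_sumr sum_dbump // mulr0 mul0r //.
Qed.

End InCube.

Lemma node_coord_near i x l : `|node_coord x l - (i l)%:R| <= 1 ->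
  `|(x - node i) 0 l| <= d.
Proof.
rewrite !mxE /node_coord.
have -> : (x 0 l - x0 0 l) / d + M%:R - (i l)%:R = (x 0 l - (x0 0 l + d * ((i l)%:R - M%:R))) / d.
  by field; rewrite gt_eqF.
by rewrite normrM normfV (gtr0_norm d_gt0) ler_pdivrMr // mul1r.
Qed.

Lemma derive_cell_near j i x : 'D_(basis_vec R j) (cell i) x != 0 ->
  `|x - node i| <= d.
Proof.
rewrite derive_cell => /prodf_neq0 h; apply: norm_le_coord; first exact: ltW.
move=> l; apply: node_coord_near; rewrite leNgt; apply/negP => h1; have := h l isT.
by rewrite /cell_factor dbump_out ?bump_out // mulr0 if_same eqxx.
Qed.

Lemma cell_near i x : cell i x != 0 -> `|x - node i| <= d.
Proof.
move=> /prodf_neq0 h; apply: norm_le_coord; first exact: ltW.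
move=> l; apply: node_coord_near; rewrite leNgt; apply/negP => h1; have := h l isT.
by rewrite bump_out ?eqxx.
Qed.

Variable B : R.
Hypotheses (B1 : 1 <= B) (bumpB : forall t : R, `|bump_fun t| <= B /\ `|dbump t| <= B).

Let B0 : 0 <= B. Proof. exact: le_trans ler01 B1. Qed.

Lemma sum_norm_cell x : \sum_i `|cell i x| <= (3 * B) ^+ n.
Proof.
under eq_bigr do rewrite normr_prod.
rewrite -(bigA_distr_bigA (fun l (c : 'I_M.*2.+1) => `|bump_fun (node_coord x l - c%:R)|)).
rewrite -[X in _ <= _ ^+ X]card_ord -prodr_const; apply: ler_prod => l _.
rewrite sumr_ge0 //=; apply: sum_unit_window => // s; first by case: (bumpB s).
exact: bump_out.
Qed.

Lemma sum_norm_derive_cell x j :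
  \sum_i `|'D_(basis_vec R j) (cell i) x| <= d^-1 * (3 * B) ^+ n.
Proof.
under eq_bigr do rewrite derive_cell normr_prod.
rewrite -(bigA_distr_bigA (fun l (c : 'I_M.*2.+1) => `|cell_factor j l (node_coord x l - c%:R)|)).
have -> : d^-1 * (3 * B) ^+ n = \prod_(l < n) (if l == j then d^-1 * (3 * B) else 3 * B).
  rewrite (bigD1 j) //= eqxx -mulrA; congr (_ * _).
  rewrite -[X in _ ^+ X]card_ord -prodr_const (bigD1 j) //=; congr (_ * _).
  by apply: eq_bigr => l /negbTE ->.
apply: ler_prod => l _; rewrite sumr_ge0 //= /cell_factor.
case: ifPn => _; last first.
  by apply: sum_unit_window => // s; [case: (bumpB s)|exact: bump_out].
under eq_bigr do rewrite normrM ger0_norm ?invr_ge0 ?(ltW d_gt0) //.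
rewrite -mulr_sumr ler_pM2l ?invr_gt0 //.
by apply: sum_unit_window => // s; [case: (bumpB s)|exact: dbump_out].
Qed.

End Partition.

Lemma is_derive_scaled (R : realType) (V : normedModType R) (f : V -> R)
    (c df : R) (x u : V) :
  is_derive x u f df -> is_derive x u (fun z => c * f z) (c * df).
Proof. by move=> h; exact: (is_deriveZ c h). Qed.

Lemma is_derive_prod (R : realType) (V : normedModType R) (f g : V -> R)
    (df dg : R) (x u : V) :
  is_derive x u f df -> is_derive x u g dg ->
  is_derive x u (fun z => f z * g z) (f x * dg + g x * df).
Proof. by move=> hf hg; exact: (is_deriveM hf hg). Qed.

Section Approximation.
Variables (R : realType) (n : nat) (x0 : 'rV[R]_n) (r C : R) (f : 'rV[R]_n -> R).
Hypotheses (r_gt0 : 0 < r) (C1f : C1_on (ball x0 (r *+ 2)) f).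
Local Notation pt := 'rV[R]_n.
Local Notation D_ j f x := ('D_(basis_vec R j) f x).
Hypothesis boundDf : forall x j, ball x0 (r *+ 2) x -> `|D_ j f x| <= C.

Let d m : R := r / m.+1%:R.
Let d_gt0 m : 0 < d m. Proof. by rewrite divr_gt0. Qed.

Let d_le m : d m <= r.
Proof. by rewrite ler_pdivrMr // ler_peMr ?(ltW r_gt0) // ler1n. Qed.

Let taylor (y x : pt) : R := f y + \sum_l D_ l f y * (x - y) 0 l.

Local Notation index m := {ffun 'I_n -> 'I_((m.+1).*2.+1)}.

Let node_poly m (i : index m) (x : pt) : R :=
  if `[< ball x0 (r *+ 2) (node x0 (d m) i) >]
  then taylor (node x0 (d m) i) x else 0.

(** At the nodes outside the ball, where f may fail to be differentiable, the
    polynomial is replaced by 0; these nodes do not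
    contribute at the points of the ball of radius r. *)
Definition taylor_glue m (x : pt) : R := \sum_(i : index m) cell x0 (d m) i x * node_poly i x.

Let elementary_node_poly m (i : index m) : elementary (node_poly i).
Proof.
rewrite /node_poly; case: asboolP => _; last exact: elementary_cst.
apply: elementary_add; first exact: elementary_cst.
apply: elementary_sum => l _; apply: elementary_mul; first exact: elementary_cst.
rewrite (_ : (fun _ => _) = fun x : pt => x 0 l - node x0 (d m) i 0 l).
  by apply: elementary_sub; [exact: elementary_coord|exact: elementary_cst].
by apply/funext => x; rewrite !mxE.
Qed.

Lemma elementary_glue m : elementary (taylor_glue m).
Proof.
apply: elementary_sum => i _; apply: elementary_mul.
  exact: elementary_cell.
exact: elementary_node_poly.
Qed.

Let derive_node_poly m (i : index m) x j : ball x0 (r *+ 2) (node x0 (d m) i) ->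
  D_ j (node_poly i) x = D_ j f (node x0 (d m) i).
Proof.
move=> hb; set y := node _ _ _ in hb *.
have -> : node_poly i = fun x => f y + \sum_l D_ l f y * (x 0 l - y 0 l).
  apply/funext => z; rewrite /node_poly asboolT // /taylor; congr (_ + _).
  by apply: eq_bigr => l _; rewrite !mxE.
have dl l : is_derive x (basis_vec R j) (fun z : pt => D_ l f y * (z 0 l - y 0 l)) (D_ l f y * (j == l)%:R).
  have d0 : derivable (fun z : pt => z 0 l) x (basis_vec R j).
    by apply: diff_derivable; exact: differentiable_coord.
  apply: is_derive_scaled; split.
    by apply: derivableB; [exact: d0|exact: derivable_cst].
  rewrite deriveB; [|exact: d0|exact: derivable_cst].
  by rewrite derive_cst subr0 derive_coord mxE eqxx /= eq_sym.
have ds := @is_derive_big_sum _ _ _ (index_enum 'I_n) xpredT _ _ x (basis_vec R j) (fun l _ => dl l).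
rewrite deriveD; [|exact: derivable_cst|exact: (@ex_derive _ _ _ _ _ _ _ ds)].
rewrite derive_cst add0r (@derive_val _ _ _ _ _ _ _ ds) (bigD1 j) //= eqxx mulr1.
by rewrite big1 ?addr0 // => l lj; rewrite eq_sym (negbTE lj) mulr0.
Qed.

Variable B : R.
Hypotheses (B1 : 1 <= B) (bumpB : forall t : R, `|bump_fun t| <= B /\ `|dbump t| <= B).

Let K := (3 * B) ^+ n * (1 + n%:R *+ 2).

Let B3 : 0 <= (3 * B) ^+ n.
Proof. by rewrite exprn_ge0 // mulr_ge0 // (le_trans ler01). Qed.

Let K_ge0 : 0 <= K.
Proof. by rewrite mulr_ge0 // addr_ge0 // mulrn_wge0. Qed.

Section Estimate.
Variables (m : nat) (x : pt) (eta : R).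
Hypothesis bx : ball x0 r x.
Hypothesis osc : forall y l, ball x0 (r *+ 2) y -> `|y - x| <= d m -> `|D_ l f y - D_ l f x| <= eta.

Let bx2 : ball x0 (r *+ 2) x.
Proof. by apply: le_ball bx; rewrite mulr2n lerDl ltW. Qed.

Let near_ball (i : index m) : `|x - node x0 (d m) i| <= d m -> ball x0 (r *+ 2) (node x0 (d m) i).
Proof.
set y := node _ _ _ => h; apply/ball_rV.
have -> : y - x0 = (y - x) + (x - x0) by rewrite addrA subrK.
apply: le_lt_trans (ler_normD _ _) _.
have := d_le m; move/ball_rV : bx; rewrite distrC in h; rewrite mulr2n; lra.
Qed.

Let eta_ge0 : (0 < n)%N -> 0 <= eta.
Proof.
by move=> n0; apply: le_trans (osc (y := x) (Ordinal n0) bx2 _); rewrite ?normr_ge0 // subrr normr0 ltW.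
Qed.

Let poly_err (i : index m) : `|x - node x0 (d m) i| <= d m ->
  `|node_poly i x - f x| <= (n%:R *+ 2) * eta * d m.
Proof.
move=> h; have by_ := near_ball h; rewrite /node_poly asboolT //.
set y := node _ _ _ in h by_ *.
have [z [bz zy E]] := mean_value_ball (fun z bz => (C1f bz).1) bx2 by_.
have -> : taylor y x - f x = \sum_l (D_ l f y - D_ l f z) * (x - y) 0 l.
  rewrite /taylor addrAC E -big_split /=; apply: eq_bigr => l _.
  by rewrite !mxE; ring.
apply: le_trans (ler_norm_sum _ _ _) _.
have -> : (n%:R *+ 2) * eta * d m = \sum_(l < n) ((eta *+ 2) * d m).
  by rewrite sumr_const card_ord -mulr_natl; ring.
apply: ler_sum => l _; rewrite normrM; apply: ler_pM => //.
  have hy : `|y - x| <= d m by rewrite distrC.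
  have h1 := osc l by_ hy; have h2 := osc l bz (le_trans zy hy).
  have -> : D_ l f y - D_ l f z = (D_ l f y - D_ l f x) - (D_ l f z - D_ l f x) by ring.
  by apply: le_trans (ler_normB _ _) _; rewrite mulr2n lerD.
exact: le_trans (coord_le_norm _ _) h.
Qed.

Let x_cube : `|x - x0| <= d m * m.+1%:R.
Proof. by rewrite /d divfK ?pnatr_eq0 // ltW //; apply/ball_rV. Qed.

(** The polynomials that contribute at x are those of nodes at distance at
    most d m, and each differs from f x by the oscillation eta of the first
    derivatives times d m; the weights sum to 1. *)
Lemma glue_err : (0 < n)%N -> `|taylor_glue m x - f x| <= K * eta * d m.
Proof.
move=> n0; have e0 := eta_ge0 n0.
have -> : taylor_glue m x - f x = \sum_(i : index m) cell x0 (d m) i x * (node_poly i x - f x).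
  rewrite -[f x in LHS]mul1r -(sum_cell (d_gt0 m) x_cube) mulr_suml -sumrB.
  by apply: eq_bigr => i _; rewrite mulrBr.
apply: le_trans (ler_norm_sum _ _ _) _.
apply: (@le_trans _ _ (\sum_(i : index m) `|cell x0 (d m) i x| * ((n%:R *+ 2) * eta * d m))).
  apply: ler_sum => i _; rewrite normrM.
  have [->|c0] := eqVneq (cell x0 (d m) i x) 0; first by rewrite normr0 !mul0r.
  by rewrite ler_wpM2l //; apply: poly_err; exact: cell_near.
rewrite -mulr_suml /K -!mulrA.
apply: ler_pM; rewrite ?sumr_ge0 ?mulr_ge0 ?mulrn_wge0 ?(ltW r_gt0) //.
  exact: sum_norm_cell.
by apply: ler_wpM2r; [rewrite mulr_ge0 // (ltW (d_gt0 m))|rewrite lerDr].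
Qed.

(** The derivatives of the cells are of order 1 / d m, but they sum to 0, so f x
    may be subtracted from the polynomials; the gain d m of the Taylor estimate
    then compensates the loss. *)
Lemma derive_glue_err j : `|D_ j (taylor_glue m) x - D_ j f x| <= K * eta.
Proof.
have n0 : (0 < n)%N by case: (n) j => // -[].
have e0 := eta_ge0 n0.
pose c (i : index m) := cell x0 (d m) i.
have dc i : is_derive x (basis_vec R j) (fun z => c i z * node_poly i z)
   (c i x * D_ j (node_poly i) x + node_poly i x * D_ j (c i) x).
  apply: is_derive_prod; apply: derivableP; apply: diff_derivable;
    apply: elementary_differentiable; [exact: elementary_cell|exact: elementary_node_poly].
have ds := @is_derive_big_sum _ _ _ (index_enum _) xpredT _ _ x (basis_vec R j) (fun i _ => dc i).
have -> : D_ j (taylor_glue m) x =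
    \sum_i (c i x * D_ j (node_poly i) x + node_poly i x * D_ j (c i) x).
  exact: (@derive_val _ _ _ _ _ _ _ ds).
have -> : \sum_i (c i x * D_ j (node_poly i) x + node_poly i x * D_ j (c i) x) - D_ j f x
  = \sum_i (c i x * (D_ j (node_poly i) x - D_ j f x) + D_ j (c i) x * (node_poly i x - f x)).
  have E : D_ j f x = \sum_i (c i x * D_ j f x + D_ j (c i) x * f x).
    by rewrite big_split /= -!mulr_suml (sum_cell (d_gt0 m) x_cube) (sum_derive_cell (d_gt0 m) x_cube) mul1r mul0r addr0.
  by rewrite [X in _ - X]E -sumrB; apply: eq_bigr => i _; ring.
apply: le_trans (ler_norm_sum _ _ _) _.
apply: (@le_trans _ _ (\sum_i (`|c i x| * eta + `|D_ j (c i) x| * ((n%:R *+ 2) * eta * d m)))).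
  apply: ler_sum => i _; apply: le_trans (ler_normD _ _) _; rewrite !normrM; apply: lerD.
    have [->|c0] := eqVneq (c i x) 0; first by rewrite normr0 !mul0r.
    have near := cell_near (d_gt0 m) c0.
    rewrite ler_wpM2l // derive_node_poly; last exact: near_ball.
    by apply: osc; [exact: near_ball|rewrite distrC].
  have [->|c0] := eqVneq (D_ j (c i) x) 0; first by rewrite normr0 !mul0r.
  have near := derive_cell_near (d_gt0 m) c0.
  by rewrite ler_wpM2l //; exact: poly_err.
rewrite big_split /= -!mulr_suml.
have h1 := sum_norm_cell x0 (d m) m.+1 B1 bumpB x.
have h2 := sum_norm_derive_cell x0 m.+1 (d_gt0 m) B1 bumpB x j.
have -> : K * eta = (3 * B) ^+ n * eta + ((d m)^-1 * (3 * B) ^+ n) * ((n%:R *+ 2) * eta * d m).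
  by rewrite /K; field; rewrite gt_eqF.
apply: lerD; first by rewrite ler_wpM2r.
by rewrite ler_wpM2r // !mulr_ge0 ?mulrn_wge0 // ltW.
Qed.

End Estimate.

Let d_cvg0 : d m @[m --> \oo] --> (0 : R).
Proof.
rewrite -[X in _ --> X](mulr0 r); apply: cvgMr; exact: cvg_harmonic.
Qed.

Let C_ge0 : (0 < n)%N -> 0 <= C.
Proof.
move=> n0; apply: le_trans (boundDf (x := x0) (Ordinal n0) _); rewrite ?normr_ge0 //.
by apply: ballxx; rewrite mulrn_wgt0.
Qed.

Let osc_bound m x : ball x0 r x -> forall y l, ball x0 (r *+ 2) y -> `|y - x| <= d m ->
  `|D_ l f y - D_ l f x| <= C *+ 2.
Proof.
move=> bx y l by_ _; apply: le_trans (ler_normB _ _) _; rewrite mulr2n lerD ?boundDf //.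
by apply: le_ball bx; rewrite mulr2n lerDl ltW.
Qed.

Lemma glue_bounded j m x : ball x0 r x ->
  `|D_ j (taylor_glue m) x| <= K * C *+ 2 + C /\ `|taylor_glue m x| <= K * (C *+ 2) * r + `|f x|.
Proof.
move=> bx; have n0 : (0 < n)%N by case: (n) j => // -[].
have C0 := C_ge0 n0.
have h1 := derive_glue_err bx (osc_bound bx) j.
have h2 := glue_err bx (osc_bound bx) n0.
split.
  rewrite -[D_ j (taylor_glue m) x](subrK (D_ j f x)); apply: le_trans (ler_normD _ _) _.
  rewrite lerD //; first by rewrite -mulrnAr.
  by apply: boundDf; apply: le_ball bx; rewrite mulr2n lerDl ltW.
rewrite -[taylor_glue m x](subrK (f x)); apply: le_trans (ler_normD _ _) _.
rewrite lerD2r; apply: le_trans (h2 m) _; rewrite ler_wpM2l // mulr_ge0 // mulrn_wge0 //.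
Qed.

Lemma glue_cvg x : (0 < n)%N -> ball x0 r x -> taylor_glue m x @[m --> \oo] --> f x.
Proof.
move=> n0 bx; apply/cvgrPdist_le => e e0.
pose K' := K * (C *+ 2) + 1.
have K'0 : 0 < K' by rewrite ltr_wpDl // mulr_ge0 // mulrn_wge0 // C_ge0.
move/cvgrPdist_le : d_cvg0 => /(_ (e / K') (divr_gt0 e0 K'0)).
apply: filterS => m; rewrite sub0r normrN (ger0_norm (ltW (d_gt0 m))) => hm.
rewrite distrC; apply: le_trans (glue_err bx (osc_bound bx) n0) _.
apply: (@le_trans _ _ (K' * d m)); first by rewrite ler_wpM2r ?(ltW (d_gt0 m)) // lerDl.
by rewrite mulrC -ler_pdivlMr.
Qed.

Lemma derive_glue_cvg x j : ball x0 r x -> D_ j (taylor_glue m) x @[m --> \oo] --> D_ j f x.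
Proof.
move=> bx; have n0 : (0 < n)%N by case: (n) j => // -[].
have bx2 : ball x0 (r *+ 2) x by apply: le_ball bx; rewrite mulr2n lerDl ltW.
apply/cvgrPdist_le => e e0.
pose eta := e / (K + 1).
have K1 : 0 < K + 1 by rewrite ltr_wpDl.
have eta0 : 0 < eta by rewrite divr_gt0.
have near_osc : \forall y \near x, forall l, `|D_ l f y - D_ l f x| <= eta.
  apply: (@filter_forall _ 'I_n (fun l y => `|D_ l f y - D_ l f x| <= eta) (nbhs x)) => l.
  have := C1_on_derive_continuous (ball_open x0 (r *+ 2)) (u := basis_vec R l) C1f bx2.
  move=> /cvgrPdist_le /(_ eta eta0); apply: filterS => y; by rewrite distrC.
have [s s0 hs] : exists2 s : R, 0 < s & forall y l, `|y - x| < s -> `|D_ l f y - D_ l f x| <= eta.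
  have /nbhs_ballP[s /= s0 hs] := near_osc; exists s => // y l ys.
  by apply: hs; apply/ball_rV.
move/cvgrPdist_lt : d_cvg0 => /(_ s s0).
apply: filterS => m; rewrite sub0r normrN (ger0_norm (ltW (d_gt0 m))) => hm.
rewrite distrC; apply: le_trans (derive_glue_err (eta := eta) bx _ j) _.
  by move=> y l _ yx; apply: hs; exact: le_lt_trans hm.
rewrite /eta mulrA ler_pdivrMr // mulrC ler_wpM2l ?(ltW e0) // lerDl //.
Qed.

End Approximation.

(** * Mutually singular measures that agree on test functions *)

(** Stated for densities with respect to two measures, so that no signed
    measure is needed: if f mu on D and g nu on the disjoint set E have the same
    values on a generating pi-system, then both vanish. *)
Section SingularMeasures.
Local Open Scope ereal_scope.
Context d (T : measurableType d) (R : realType).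
Variables (mu nu : {measure set T -> \bar R}) (D E : set T) (f g : T -> \bar R).
Variable G : set (set T).
Hypotheses (mD : measurable D) (mE : measurable E) (DE : D `&` E = set0).
Hypotheses (intf : mu.-integrable D f) (intg : nu.-integrable E g).
Hypotheses (G_gen : @measurable _ T = <<s G >>) (GI : setI_closed G).
Hypothesis fgT : \int[mu]_(x in D) f x = \int[nu]_(x in E) g x.
Hypothesis fgG : forall A, G A ->
  \int[mu]_(x in D `&` A) f x = \int[nu]_(x in E `&` A) g x.

Let integral_setIC (rho : {measure set T -> \bar R}) C k A : measurable C ->
  rho.-integrable C k -> measurable A ->
  \int[rho]_(x in C `&` ~` A) k x =
  \int[rho]_(x in C) k x - \int[rho]_(x in C `&` A) k x.
Proof.
move=> mC ik mA; have mCA := measurableI _ _ mC mA.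
have mCA' : measurable (C `&` ~` A) by apply: measurableI => //; exact: measurableC.
have E1 : \int[rho]_(x in C) k x =
    \int[rho]_(x in C `&` A) k x + \int[rho]_(x in C `&` ~` A) k x.
  rewrite -integral_setU //.
  - by rewrite -setIUr setUv setIT.
  - by rewrite -setIUr setUv setIT; exact: measurable_int ik.
  - by apply/disj_setPS => x [[_ Ax] [_ /(_ Ax)]].
rewrite E1 addeAC subee ?add0e //; apply: integrable_fin_num => //.
by apply: (integrableS mC) ik => //; exact: subIsetl.
Qed.

(** By Dynkin's lemma the two densities have the same integral on every
    measurable A.  Taking A inside D makes the right-hand side an integral over
    the empty set. *)
Lemma mutually_singular_ae0 : ae_eq mu D f (cst 0).
Proof.
have key A : measurable A ->
    \int[mu]_(x in D `&` A) f x = \int[nu]_(x in E `&` A) g x.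
  rewrite G_gen; apply: (dynkin_induction (P := fun A => \int[mu]_(x in D `&` A) f x = \int[nu]_(x in E `&` A) g x) G_gen GI) => //.
  - by rewrite !setIT.
  - by move=> S mS fgS; rewrite !integral_setIC // fgT fgS.
  - move=> F mF tF fgF; rewrite !setI_bigcupr !integral_bigcup //.
    + by apply: eq_eseriesr => i _; exact: fgF.
    + by apply: trivIset_setIl.
    + by move=> k; exact: measurableI.
    + apply: (integrableS mE) intg => //; first by apply: bigcup_measurable => k _; exact: measurableI.
      by move=> x [k _ []].
    + by apply: trivIset_setIl.
    + by move=> k; exact: measurableI.
    + apply: (integrableS mD) intf => //; first by apply: bigcup_measurable => k _; exact: measurableI.
      by move=> x [k _ []].
apply: integral_ae_eq => // S SD mS.
rewrite integral0 -(_ : D `&` S = S); last by rewrite setIC; exact/setIidPl.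
rewrite key // (_ : E `&` S = set0) ?integral_set0 // -subset0 -DE.
by move=> x [Ex /SD].
Qed.

End SingularMeasures.

Section BoxTests.
Variables (R : realType) (n : nat).
Local Notation pt := 'rV[R]_n.
Local Notation bpt := (borel_rV R n).

Lemma measurable_open (U : set bpt) : open (U : set pt) -> measurable U.
Proof. by move=> oU; exact: sub_sigma_algebra. Qed.

Definition boxes : set (set bpt) := [set A | exists a b : pt, A = obox a b].

Lemma obox_ball (a b x : pt) : obox a b x ->
  exists2 e : R, 0 < e & ball x e `<=` obox a b.
Proof.
move=> hx; have near_all : \forall e \near (0 : R)^'+, forall j : 'I_n,
    (a 0 j <= x 0 j - e) && (x 0 j + e <= b 0 j).
  apply: (@filter_forall _ 'I_n (fun j e => (a 0 j <= x 0 j - e) && (x 0 j + e <= b 0 j)) (at_right 0)) => j.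
  have /andP[h1 h2] := hx j; near=> e; apply/andP; split.
    rewrite lerBrDr -lerBrDl; near: e; apply: nbhs_right_le; by rewrite subr_gt0.
  rewrite -lerBrDl; near: e; apply: nbhs_right_le; by rewrite subr_gt0.
near (0 : R)^'+ => e; exists e => //.
have he : forall j : 'I_n, (a 0 j <= x 0 j - e) && (x 0 j + e <= b 0 j) by near: e.
have e0 : 0 < e by [].
rewrite ball_obox // => y hy j; have := hy j; rewrite !mxE => /andP[h1 h2].
by have /andP[h3 h4] := he j; apply/andP; split; lra.
Unshelve. all: by end_near. Qed.

Lemma open_obox (a b : pt) : open (obox a b).
Proof.
rewrite openE => x /obox_ball[e e0 he]; apply/nbhs_ballP; exists e => //.
Qed.

Lemma measurable_boxes : @measurable _ bpt = <<s boxes >>.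
Proof.
apply/seteqP; split.
  apply: smallest_sub; first exact: smallest_sigma_algebra.
  move=> U /open_bigcup_obox[D [a [b ->]]].
  rewrite bigcup_mkcond.
  apply: sigma_algebra_bigcup => i.
  case: ifPn => _; last exact: sigma_algebra0.
  by apply: sub_sigma_algebra; exists (a i), (b i).
apply: smallest_sub; first exact: smallest_sigma_algebra.
by move=> _ [a [b ->]]; apply: sub_sigma_algebra; exact: open_obox.
Qed.

Lemma setI_closed_boxes : setI_closed boxes.
Proof. by move=> _ _ [a [b ->]] [c [d ->]]; rewrite oboxI; do 2 eexists. Qed.

Lemma continuous_measurable (U : set bpt) (f : bpt -> R) : open (U : set pt) ->
  (forall x, U x -> {for (x : pt), continuous (f : pt -> R)}) ->
  measurable_fun U f.
Proof.
move=> oU cf; apply: (measurability _ (RGenOInfty.measurableE R)) => //.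
move=> _ [_ [a ->] <-]; apply: measurable_open.
rewrite openE => x [Ux fx]; rewrite /interior.
apply: filterI; first exact: open_nbhs_nbhs.
by apply: (cf x Ux); apply: open_nbhs_nbhs; split.
Qed.

(** Smooth functions converging pointwise to the indicator of the open box. *)
Definition box_test (a b : pt) m (x : pt) : R :=
  \prod_j (step (m%:R * (x 0 j - a 0 j)) * step (m%:R * (b 0 j - x 0 j))).

Lemma elementary_box_test a b m : elementary (box_test a b m).
Proof.
apply: elementary_prod => j _; apply: elementary_mul; apply: elementary_step;
  (apply: elementary_mul; first exact: elementary_cst); apply: elementary_sub;
  (exact: elementary_coord || exact: elementary_cst).
Qed.

Lemma box_test_ge0 a b m x : 0 <= box_test a b m x.
Proof. by apply: prodr_ge0 => j _; rewrite mulr_ge0 // step_ge0. Qed.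

Lemma box_test_le1 a b m x : box_test a b m x <= 1.
Proof.
apply: prodr_ile1 => j _; rewrite mulr_ge0 ?step_ge0 //=.
by rewrite mulr_ile1 ?step_ge0 ?step_le1.
Qed.

Lemma box_test_out a b m x : ~ obox a b x -> box_test a b m x = 0.
Proof.
move=> /existsNP[j /negP]; rewrite negb_and -!leNgt => h.
rewrite /box_test (bigD1 j) //=; case/orP: h => h.
  by rewrite step_le0 ?mul0r // mulr_ge0_le0 // subr_le0.
by rewrite [X in _ * X * _]step_le0 ?mulr0 ?mul0r // mulr_ge0_le0 // subr_le0.
Qed.

Lemma box_test_cvg a b x : box_test a b m x @[m --> \oo] --> (\1_(obox a b) x : R).
Proof.
rewrite indicE; case: (boolP (x \in obox a b)) => [|/negP] hx; last first.
  apply: cvg_near_cst; apply: nearW => m; rewrite box_test_out //.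
  by move=> h; apply: hx; rewrite inE.
rewrite inE in hx; apply: cvg_near_cst.
have near_all : \forall m \near \oo, forall j : 'I_n,
    (1 <= m%:R * (x 0 j - a 0 j)) && (1 <= m%:R * (b 0 j - x 0 j)).
  apply: (@filter_forall _ 'I_n (fun j m => (1 <= m%:R * (x 0 j - a 0 j)) && (1 <= m%:R * (b 0 j - x 0 j))) \oo) => j.
  have /andP[h1 h2] := hx j.
  near=> m; apply/andP; split.
    rewrite -ler_pdivrMr ?subr_gt0 // mul1r; near: m; exact: nbhs_infty_ger.
  rewrite -ler_pdivrMr ?subr_gt0 // mul1r; near: m; exact: nbhs_infty_ger.
apply: filterS near_all => m hm; rewrite /box_test big1 // => j _.
by have /andP[h1 h2] := hm j; rewrite !step_ge1 ?mulr1.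
Unshelve. all: by end_near. Qed.

(** Boxes inside the ball are reached from test functions by dominated
    convergence, and boxes form a pi-system generating the Borel sets.  The ball
    of the sup norm is itself a box, so intersecting with it costs nothing. *)
Lemma tests_ae0 (mu nu : {measure set bpt -> \bar R}) (D E : set bpt)
    (f g : bpt -> R) (x0 : pt) (r : R) :
  0 < r -> measurable D -> measurable E -> D `&` E = set0 ->
  D `<=` ball x0 r -> E `<=` ball x0 r ->
  mu.-integrable D (EFin \o f) -> nu.-integrable E (EFin \o g) ->
  (forall phi : pt -> R, elementary phi -> (forall x, 0 <= phi x <= 1) ->
    (forall x, ~ ball x0 r x -> phi x = 0) ->
    (\int[mu]_(x in D) (phi x * f x)%:E = \int[nu]_(x in E) (phi x * g x)%:E)%E) ->
  ae_eq mu D (EFin \o f) (cst 0%E).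
Proof.
move=> r0 mD mE DE Dr Er intf intg tests.
have key (rho : {measure set bpt -> \bar R}) (C : set bpt) (k : bpt -> R) a b : measurable C ->
    C `<=` ball x0 r -> rho.-integrable C (EFin \o k) ->
    (\int[rho]_(x in C) (box_test a b m x * k x)%:E)%E @[m --> \oo] -->
    (\int[rho]_(x in C `&` obox a b) (k x)%:E)%E.
  move=> mC Cr ik.
  rewrite integral_mkcondr.
  have mk : measurable_fun C k by apply/measurable_EFinP; exact: measurable_int ik.
  have [] := @dominated_convergence _ bpt R rho C mC
    (fun m x => (box_test a b m x * k x)%:E) ((EFin \o k) \_ (obox a b))
    (fun x => `|(k x)%:E|%E).
  - move=> m; apply/measurable_EFinP; apply: measurable_funM => //.
    apply: measurable_funS (measurableT) _ _ => //.
    apply: continuous_measurable; first exact: openT.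
    by move=> x _; apply: elementary_continuous; exact: elementary_box_test.
  - apply/measurable_restrict => //.
      by apply: measurable_open; exact: open_obox.
    apply: measurable_funS mC _ _; first exact: subIsetl.
    exact: measurable_int ik.
  - apply: aeW => x Cx.
    rewrite patchE; have := @box_test_cvg a b x; rewrite indicE.
    case: (boolP (x \in obox a b)) => hx h.
      apply: cvg_EFin; first by apply: nearW.
      rewrite -[X in _ --> X]mul1r; apply: cvgMl; exact: h.
    apply: cvg_EFin; first by apply: nearW.
    rewrite -[X in _ --> X](mul0r (k x)); apply: cvgMl; exact: h.
  - exact: integrable_abse.
  - apply: aeW => x m Cx /=; rewrite lee_fin normrM ger0_norm ?box_test_ge0 //.
    by rewrite ler_piMl // box_test_le1.
  by move=> _ _.
have cvg_unique_box a b : (forall x, obox a b x -> ball x0 r x) ->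
    (\int[mu]_(x in D `&` obox a b) (f x)%:E = \int[nu]_(x in E `&` obox a b) (g x)%:E)%E.
  move=> hab; have c1 := key mu D f a b mD Dr intf.
  have c2 := key nu E g a b mE Er intg.
  apply: cvg_unique c1 _ => //.
  suff -> : (fun m => \int[mu]_(x in D) (box_test a b m x * f x)%:E)%E =
    (fun m => \int[nu]_(x in E) (box_test a b m x * g x)%:E)%E by [].
  apply/funext => m; apply: tests; first exact: elementary_box_test.
    by move=> x; rewrite box_test_ge0 box_test_le1.
  by move=> x hx; apply: box_test_out => /hab.
apply: (@mutually_singular_ae0 _ bpt R mu nu D E _ (EFin \o g) boxes) => //.
- exact: measurable_boxes.
- exact: setI_closed_boxes.
- have DB : D = D `&` ball x0 r by rewrite -[LHS](setIidl Dr).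
  have EB : E = E `&` ball x0 r by rewrite -[LHS](setIidl Er).
  rewrite DB EB ball_obox //; apply: cvg_unique_box => x; by rewrite -ball_obox.
- move=> _ [a [b ->]].
  have DB : D `&` obox a b = D `&` (obox a b `&` ball x0 r).
    by rewrite setICA (setIidl Dr) setIC.
  have EB : E `&` obox a b = E `&` (obox a b `&` ball x0 r).
    by rewrite setICA (setIidl Er) setIC.
  rewrite DB EB ball_obox // oboxI; apply: cvg_unique_box => x.
  by rewrite -oboxI -ball_obox // => -[].
Qed.

End BoxTests.

(** * The orientation of a rectifiable set tangent to a distribution *)

Section Orientation.
Variables (R : realType) (n : nat).
Local Notation pt := 'rV[R]_n.
Local Notation bpt := (borel_rV R n).

Lemma hausdorff_null_sub h (A B : set bpt) :
  A `<=` B -> hausdorff h B = 0%E -> hausdorff h A = 0%E.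
Proof.
by move=> AB B0; apply/eqP; rewrite eq_le hausdorff_ge0 andbT -B0; exact: le_hausdorff.
Qed.

Lemma hausdorff_null_bigcup h (F : (set bpt)^nat) :
  (forall i, hausdorff h (F i) = 0%E) -> hausdorff h (\bigcup_i F i) = 0%E.
Proof.
move=> F0; apply/eqP; rewrite eq_le hausdorff_ge0 andbT.
by apply: le_trans (hausdorff_sigma_subadditive h F) _; rewrite eseries0.
Qed.

Lemma hausdorff_nullU h (A B : set bpt) :
  hausdorff h A = 0%E -> hausdorff h B = 0%E -> hausdorff h (A `|` B) = 0%E.
Proof.
by move=> A0 B0; rewrite -bigcup2E; apply: hausdorff_null_bigcup => -[|[|i]] //=.
Qed.

(** Both bundles agree almost everywhere with the tangent spaces of the
    surfaces of a countable cover. *)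
Lemma approx_tangent_unique (Omega Sigma : set bpt) h (P1 P2 : pt -> set pt) :
  rectifiable_set Omega h Sigma ->
  approx_tangent_bundle h Sigma P1 -> approx_tangent_bundle h Sigma P2 ->
  hausdorff_ae h Sigma (fun x => P1 x = P2 x).
Proof.
move=> [_ _ _ [S [surfS S0]]] tan1 tan2; rewrite /hausdorff_ae.
pose bad P i := [set x : bpt | (Sigma `&` S i) x /\ ~ P x = tangent_space (S i) x].
apply: (hausdorff_null_sub (B := (Sigma `\` \bigcup_i S i) `|` \bigcup_i (bad P1 i `|` bad P2 i))).
  move=> x [Sx P12]; have [[i _ Six]|nS] := pselect ((\bigcup_i S i) x); last by left.
  right; exists i => //; have [e1|ne1] := pselect (P1 x = tangent_space (S i) x); last by left.
  right; split=> // e2; apply: P12; by rewrite e1 e2.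
apply: hausdorff_nullU => //; apply: hausdorff_null_bigcup => i.
by apply: hausdorff_nullU; [exact: (tan1 _ (surfS i))|exact: (tan2 _ (surfS i))].
Qed.

Lemma mvnorm_eq1 (w : multivector R n) : mvnorm w = 1 -> \sum_I w I ^+ 2 = 1.
Proof.
move=> w1; have w0 : 0 <= \sum_I w I ^+ 2 by apply: sumr_ge0 => I _; exact: sqr_ge0.
by rewrite -(sqr_sqrtr w0) -/(mvnorm w) w1 expr1n.
Qed.

(** A polynomial in the coordinates that vanishes exactly when w is a unit
    multivector proportional to u (for u a unit multivector): it turns the
    exceptional set of [tangent_orientation_sign] into a Borel set. *)
Definition misalignment (w u : multivector R n) : R :=
  \sum_I \sum_K (w I * u K - w K * u I) ^+ 2 + (\sum_I w I ^+ 2 - 1) ^+ 2.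

Lemma misalignment_eq0 w u : misalignment w u = 0 -> \sum_I u I ^+ 2 = 1 ->
  exists2 s : R, s ^+ 2 = 1 & forall I, w I = s * u I.
Proof.
move=> /eqP; rewrite paddr_eq0 ?sqr_ge0 //; last first.
  by apply: sumr_ge0 => I _; apply: sumr_ge0 => K _; exact: sqr_ge0.
move=> /andP[/eqP h1 h2] u1.
have w1 : \sum_I w I ^+ 2 = 1 by apply/eqP; rewrite -subr_eq0 -sqrf_eq0.
have wu I K : w I * u K = w K * u I.
  apply/eqP; rewrite -subr_eq0 -sqrf_eq0.
  have /eqP := h1; rewrite psumr_eq0; last by move=> ? _; apply: sumr_ge0 => ? _; exact: sqr_ge0.
  move=> /allP /(_ I (mem_index_enum _)) /=; rewrite psumr_eq0; last by move=> ? _; exact: sqr_ge0.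
  by move=> /allP /(_ K (mem_index_enum _)).
have ws I : w I = (\sum_K w K * u K) * u I.
  rewrite -[LHS]mulr1 -u1 mulr_sumr mulr_suml; apply: eq_bigr => K _.
  by rewrite expr2 mulrA wu mulrAC.
exists (\sum_K w K * u K) => //.
rewrite -w1; under [RHS]eq_bigr do rewrite ws exprMn.
by rewrite -mulr_sumr u1 mulr1.
Qed.

Lemma misalignment_scale w u (s : R) : (forall I, w I = s * u I) ->
  \sum_I w I ^+ 2 = 1 -> misalignment w u = 0.
Proof.
move=> ws w1; rewrite /misalignment w1 subrr expr0n addr0 big1 // => I _.
by rewrite big1 // => K _; rewrite !ws; ring.
Qed.

(** Almost everywhere tau is simple, spans the approximate tangent space and
    the latter is contained in V; writing its basis in terms of the frame shows
    that tau is a multiple of v, by a determinant.  Both have norm 1. *)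
Lemma tangent_orientation_sign (Omega Sigma : set bpt) k
    (v : 'I_k -> pt -> pt) (tau : bpt -> multivector R n) :
  open (Omega : set pt) -> (forall i, C1_on (Omega : set pt) (v i)) ->
  (forall x, Omega x -> mvnorm (wedge (frame v x)) = 1) ->
  rectifiable_set Omega k Sigma -> orientation k Sigma tau ->
  tangent_to k Sigma (fun x => row_span (frame v x)) ->
  exists N : set bpt, [/\ measurable N, hausdorff k N = 0%E &
    forall x, Sigma x -> ~ N x ->
      exists2 s : R, s ^+ 2 = 1 & forall I, tau x I = s * wedge (frame v x) I].
Proof.
move=> oO Cv v1 rectS [mtau _ [P tanP orP]] [Q tanQ QV].
have [SO mS _ _] := rectS.
pose mis (x : bpt) := misalignment (tau x) (wedge (frame v x)).
have mv I : measurable_fun Sigma (fun x : bpt => wedge (frame v x) I).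
  apply: (measurable_funS (E := Omega)) => //; first exact: measurable_open.
  apply: continuous_measurable => // x Ox.
  apply: (C1_on_continuous (U := Omega)) => //; exact: C1_on_wedge.
have mmis : measurable_fun Sigma mis.
  apply: measurable_funD.
    apply: measurable_sum => I; apply: measurable_sum => K.
    by apply: measurable_funX; apply: measurable_funB; apply: measurable_funM.
  apply: measurable_funX; apply: measurable_funB => //.
  by apply: measurable_sum => I; apply: measurable_funX.
exists (Sigma `&` mis @^-1` (~` [set 0])); split.
- by apply: mmis => //; apply: measurableC.
- apply: (hausdorff_null_sub (B := [set x | Sigma x /\ ~ (simple_spanning k (tau x) (P x) /\ mvnorm (tau x) = 1)]
     `|` ([set x | Sigma x /\ ~ (P x = Q x)] `|` [set x | Sigma x /\ ~ (Q x `<=` row_span (frame v x))]))).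
    move=> x [Sx misx]; apply: contrapT => /not_orP[h1 /not_orP[h2 h3]].
    have {}h1 : simple_spanning k (tau x) (P x) /\ mvnorm (tau x) = 1.
      by apply: contrapT => h; apply: h1.
    have {}h2 : P x = Q x by apply: contrapT => h; apply: h2.
    have {}h3 : Q x `<=` row_span (frame v x) by apply: contrapT => h; apply: h3.
    apply: misx; have [[c [A [tauA PA]]] tau1] := h1.
    have /submxP[M AM] : (A <= frame v x)%MS.
      apply/row_subP => i; apply: h3; rewrite -h2 PA; exact: row_sub.
    apply: (@misalignment_scale _ _ (c * \det M)); last exact: mvnorm_eq1.
    by move=> I; rewrite tauA AM wedge_mulmx mulrA.
  apply: hausdorff_nullU; first exact: orP.
  apply: hausdorff_nullU; last exact: QV.
  exact: approx_tangent_unique rectS tanP tanQ.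
- move=> x Sx Nx; apply: misalignment_eq0.
    by apply: contrapT => h; apply: Nx.
  by apply: mvnorm_eq1; apply: v1; exact: SO.
Qed.

End Orientation.

(** * Stokes' identity for forms of class C1 *)

Section ExteriorDerivative.
Variables (R : realType) (n : nat).
Local Notation pt := 'rV[R]_n.
Local Notation D j f x := ('D_(basis_vec R j) f x).

(** Reindexing the pairs (I, j), j in I, as pairs (J, j) with J = I :\ j moves
    the signs of the exterior derivative from the form to the contraction. *)
Lemma pairing_ext_d (w : multivector R n) (omega : diff_form R n) (x : pt) :
  pairing w (ext_d omega x) =
  \sum_J \sum_j contr w J 0 j * D j (fun y => omega y J) x.
Proof.
rewrite /pairing /ext_d.
under eq_bigr do rewrite mulr_sumr big_mkcond.
rewrite exchange_big [RHS]exchange_big /=; apply: eq_bigr => j _.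
rewrite -big_mkcond /=.
rewrite (reindex_onto (fun J => (j |: J)%SET) (fun I => (I :\ j)%SET)) /=; last first.
  by move=> I jI; rewrite finset.setD1K.
have E (J : {set 'I_n}) : (j \in (j |: J)%SET) && ((j |: J) :\ j == J)%SET = (j \notin J).
  rewrite setU11 /=; apply/eqP/idP => [<-|jJ]; first by rewrite !inE eqxx.
  by rewrite setU1K.
rewrite (eq_bigl _ _ E) big_mkcond; apply: eq_bigr => J _; rewrite mxE.
case: (boolP (j \in J)) => jJ /=; first by rewrite mul0r.
rewrite setU1K // mulrA; congr (_ * _); rewrite mulrC; congr (_ * _).
by rewrite /isign -/(nbelow (j |: J)%SET j) nbelowU1 // ltnn.
Qed.

Lemma derive_eq0_off (K : set pt) (f : pt -> R) x u :
  closed K -> (forall y, ~ K y -> f y = 0) -> ~ K x -> 'D_u f x = 0.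
Proof.
move=> cK f0 Kx; rewrite (@near_eq_derive _ _ R _ (fun=> 0 : R)) ?derive_cst //.
have oK : open_nbhs x (~` K) by split; [exact: closed_openC|].
by apply: filterS (open_nbhs_nbhs oK) => y; exact: f0.
Qed.

Section ElementaryForm.
Variables (Omega K : set pt) (h : nat) (omega : diff_form R n).
Hypotheses (cK : compact K) (KO : K `<=` Omega).
Hypothesis degree : forall x (I : {set 'I_n}), #|I| <> h -> omega x I = 0.
Hypothesis elem : forall I, elementary (fun x => omega x I).
Hypothesis supp : forall x I, ~ K x -> omega x I = 0.

Lemma elementary_ext_d J : elementary (fun x => ext_d omega x J).
Proof.
apply: elementary_sum => j _; apply: elementary_mul; first exact: elementary_cst.
exact: (elementary_derive (basis_vec R j) (elem _)).
Qed.

Lemma elementary_test_form : test_form Omega h omega.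
Proof.
by exists K; split=> //; split=> // I; exact: elementary_smooth.
Qed.

Lemma ext_d_test_form : test_form Omega h.+1 (ext_d omega).
Proof.
exists K; split=> //; split.
- move=> x I hI; rewrite /ext_d big1 // => j jI.
  rewrite (_ : (fun y => omega y (I :\ j)%SET) = fun=> 0) ?derive_cst ?mulr0 //.
  apply/funext => y; apply: degree => Ih; apply: hI.
  by have := cardsD1 j I; rewrite jI Ih.
- by move=> I; apply: elementary_smooth; exact: elementary_ext_d.
- move=> x I Kx; rewrite /ext_d big1 // => j jI.
  rewrite (derive_eq0_off (K := K)) ?mulr0 //.
    by apply: compact_closed => //; exact: norm_hausdorff.
  by move=> y Ky; exact: supp.
Qed.

End ElementaryForm.

End ExteriorDerivative.

Lemma cvg_finite_sum (R : realType) (T : Type) (F : set_system T)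
    (I : Type) (r : seq I) (P : pred I) (f_ : I -> T -> R) (l : I -> R) :
  Filter F -> (forall i, f_ i m @[m --> F] --> l i) ->
  (\sum_(i <- r | P i) f_ i m) @[m --> F] --> \sum_(i <- r | P i) l i.
Proof.
move=> FF fl; elim: r => [|i r IH].
  by under eq_fun do rewrite big_nil; rewrite big_nil; exact: cvg_cst.
under eq_fun do rewrite big_cons; rewrite big_cons.
have [_|_] := boolP (P i); last exact: IH.
by apply: cvgD; [exact: fl|exact: IH].
Qed.

Section WeightedLimit.
Variables (R : realType) (n : nat).
Local Notation bpt := (borel_rV R n).
Variables (mu : {measure set bpt -> \bar R}) (S N : set bpt).
Variables (tau : bpt -> multivector R n) (theta : bpt -> nat).
Hypotheses (mS : measurable S) (mN : measurable N) (N0 : mu N = 0%E).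
Hypothesis mtau : forall I, measurable_fun S (fun x => tau x I).
Hypothesis tau1 : forall x I, S x -> ~ N x -> `|tau x I| <= 1.
Hypothesis itheta : mu.-integrable S (fun x => (theta x)%:R%:E).

Lemma pairing_norm_le (w alpha : multivector R n) (M : R) :
  (forall I, `|w I| <= 1) -> (forall I, `|alpha I| <= M) ->
  `|pairing w alpha| <= M *+ #|{set 'I_n}|.
Proof.
move=> w1 aM; apply: le_trans (ler_norm_sum _ _ _) _.
rewrite -sumr_const; apply: ler_sum => I _; rewrite normrM.
by apply: le_trans (ler_wpM2r _ (w1 I)) _; rewrite ?mul1r.
Qed.

(** Bounded convergence, the weight theta being integrable and tau bounded
    almost everywhere. *)
Lemma weighted_limit (alpha_ : nat -> diff_form R n) (alpha : diff_form R n) (M : R) :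
  (forall m I, elementary (fun x => alpha_ m x I)) ->
  (forall x I, alpha_ m x I @[m --> \oo] --> alpha x I) ->
  (forall m x I, `|alpha_ m x I| <= M) ->
  mu.-integrable S (fun x => (pairing (tau x) (alpha x) * (theta x)%:R)%:E) /\
  (\int[mu]_(x in S) (pairing (tau x) (alpha_ m x) * (theta x)%:R)%:E)%E @[m --> \oo] -->
  (\int[mu]_(x in S) (pairing (tau x) (alpha x) * (theta x)%:R)%:E)%E.
Proof.
move=> elem lim bound.
have M0 : 0 <= M by apply: le_trans (bound 0%N 0 finset.set0); exact: normr_ge0.
have mtheta : measurable_fun S (fun x => (theta x)%:R : R).
  by apply/measurable_EFinP; exact: measurable_int itheta.
have mf m : measurable_fun S (fun x => (pairing (tau x) (alpha_ m x) * (theta x)%:R)%:E).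
  apply/measurable_EFinP; apply: measurable_funM => //.
  apply: measurable_sum => I; apply: measurable_funM => //.
  apply: (measurable_funS (E := setT)) => //; apply: continuous_measurable; first exact: openT.
  by move=> x _; exact: elementary_continuous.
have cvgf x : (pairing (tau x) (alpha_ m x) * (theta x)%:R)%:E @[m --> \oo] -->
    (pairing (tau x) (alpha x) * (theta x)%:R)%:E.
  apply: cvg_EFin; first by apply: nearW.
  apply: cvgMl; apply: cvg_finite_sum => I; apply: cvgMr; exact: lim.
pose c := M *+ #|{set 'I_n}|.
have [] := @dominated_convergence _ bpt R mu S mS
  (fun m x => (pairing (tau x) (alpha_ m x) * (theta x)%:R)%:E)
  (fun x => (pairing (tau x) (alpha x) * (theta x)%:R)%:E)
  (fun x => c%:E * (theta x)%:R%:E)%E.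
- exact: mf.
- by apply: (emeasurable_fun_cvg _ _ mf) => x _; exact: cvgf.
- by apply: aeW => x _; exact: cvgf.
- exact: integrableZl.
- exists N; split=> // x /= hx; apply: contrapT => Nx; apply: hx => m Sx.
  rewrite -EFinM lee_fin normrM; apply: ler_pM => //; last by rewrite ger0_norm.
  by apply: pairing_norm_le => I; [exact: tau1|exact: bound].
- by move=> h1 _ h3; split.
Qed.

End WeightedLimit.

(** The margin between the ball of radius r, where the cutoff phi lives, and the
    ball of radius 4 r, where the coefficients are C1, leaves room for the
    approximation on the ball of radius 2 r. *)
Section StokesC1.
Variables (R : realType) (n h : nat).
Local Notation pt := 'rV[R]_n.
Local Notation bpt := (borel_rV R n).
Local Notation D j f x := ('D_(basis_vec R j) f x).
Variables (Omega : set pt) (Sigma Sigma' N N' : set bpt).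
Variables (tau tau' : bpt -> multivector R n) (theta theta' : bpt -> nat).
Hypotheses (mS : measurable Sigma) (mN : measurable N) (N0 : hausdorff h.+1 N = 0%E).
Hypotheses (mS' : measurable Sigma') (mN' : measurable N') (N'0 : hausdorff h N' = 0%E).
Hypothesis mtau : forall I, measurable_fun Sigma (fun x => tau x I).
Hypothesis mtau' : forall I, measurable_fun Sigma' (fun x => tau' x I).
Hypothesis tau1 : forall x I, Sigma x -> ~ N x -> `|tau x I| <= 1.
Hypothesis tau'1 : forall x I, Sigma' x -> ~ N' x -> `|tau' x I| <= 1.
Hypothesis itheta : (hausdorff h.+1).-integrable Sigma (fun x => (theta x)%:R%:E).
Hypothesis itheta' : (hausdorff h).-integrable Sigma' (fun x => (theta' x)%:R%:E).
Hypothesis stokes : forall omega, test_form Omega h omega ->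
  test_form Omega h.+1 (ext_d omega) ->
  (\int[hausdorff h.+1]_(x in Sigma) (pairing (tau x) (ext_d omega x) * (theta x)%:R)%:E =
   \int[hausdorff h]_(x in Sigma') (pairing (tau' x) (omega x) * (theta' x)%:R)%:E)%E.

Variables (x0 : pt) (r C : R) (g : {set 'I_n} -> pt -> R) (phi : pt -> R).
Hypotheses (n_gt0 : (0 < n)%N) (r_gt0 : 0 < r).
Hypothesis ballO : ball x0 (r *+ 2 *+ 2) `<=` Omega.
Hypothesis C1g : forall J, C1_on (ball x0 (r *+ 2 *+ 2)) (g J).
Hypothesis boundg : forall J x, ball x0 (r *+ 2 *+ 2) x -> `|g J x| <= C.
Hypothesis boundDg : forall J x j, ball x0 (r *+ 2 *+ 2) x -> `|D j (g J) x| <= C.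
Hypothesis gdeg : forall (J : {set 'I_n}) x, #|J| != h -> g J x = 0.
Hypotheses (ephi : elementary phi) (phi01 : forall x, 0 <= phi x <= 1).
Hypothesis phi_out : forall x, ~ ball x0 r x -> phi x = 0.

Let K := closed_ball x0 r.

Let cK : closed K. Proof. exact: closed_ball_closed. Qed.

Let KE x : K x <-> `|x - x0| <= r.
Proof. by rewrite /K closed_ballE // /closed_ball_ /= distrC. Qed.

Let compactK : compact K.
Proof.
apply: bounded_closed_compact => //.
exists (`|x0| + r); split; first exact: num_real.
move=> M hM x /KE xK; apply: le_trans (ltW hM).
rewrite -[x](subrK x0) addrC; apply: le_trans (ler_normD _ _) _.
by rewrite lerD2l.
Qed.

Let ball2 : ball x0 (r *+ 2) `<=` ball x0 (r *+ 2 *+ 2).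
Proof. by apply: le_ball; rewrite [leRHS]mulr2n lerDl mulrn_wge0 // ltW. Qed.

Let K_ball : K `<=` ball x0 (r *+ 2).
Proof. by move=> x /KE xr; apply/ball_rV; apply: le_lt_trans xr _; rewrite mulr2n ltrDl. Qed.

Let phi_offK x : ~ K x -> phi x = 0.
Proof. by move=> Kx; apply: phi_out => bx; apply: Kx; apply: subset_closed_ball. Qed.

Let dphi_bounded : exists2 A : R, 0 <= A & forall x j, `|D j phi x| <= A.
Proof.
have H j : exists2 A : R, 0 <= A & forall x, `|D j phi x| <= A.
  have [||c _ hc] := @EVT_max_rV R n (fun x => `|D j phi x|) K _ compactK.
  - by exists x0; apply/KE; rewrite subrr normr0 ltW.
  - have cont := elementary_continuous (elementary_derive (basis_vec R j) ephi).
    by apply: continuous_subspaceT => x; exact: (continuous_comp (cont x) (@norm_continuous _ _ _)).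
  exists `|D j phi c| => // x; have [Kx|Kx] := pselect (K x); first by apply: hc; rewrite inE.
  by rewrite (derive_eq0_off (K := K)) // normr0.
exists (\sum_j sval (cid2 (H j))).
  by apply: sumr_ge0 => j _; case: (cid2 (H j)).
move=> x j; rewrite (bigD1 j) //=; case: (cid2 (H j)) => A A0 hA /=.
apply: le_trans (hA x) _; rewrite lerDl; apply: sumr_ge0 => l _; by case: (cid2 (H l)).
Qed.

(** Coefficients of the wrong degree are set to 0, so that the approximating
    forms are homogeneous of degree h. *)
Let G (J : {set 'I_n}) m (x : pt) : R := if #|J| == h then taylor_glue x0 (r *+ 2) (g J) m x else 0.

Let elementary_G J m : elementary (G J m).
Proof.
rewrite /G; case: (boolP (#|J| == h)) => _; last exact: elementary_cst.
exact: elementary_glue.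
Qed.

Let r2_gt0 : 0 < r *+ 2. Proof. by rewrite mulrn_wgt0. Qed.

Let G_cvg J x : ball x0 (r *+ 2) x -> G J m x @[m --> \oo] --> g J x.
Proof.
move=> bx; have [B B1 hB] := bump_bounded R; rewrite /G.
case: (boolP (#|J| == h)) => Jh; last by rewrite gdeg //; exact: cvg_cst.
by apply: (glue_cvg r2_gt0 (C1g J) _ B1 hB) => //; exact: boundDg.
Qed.

Let derive_G_cvg J x j : ball x0 (r *+ 2) x -> D j (G J m) x @[m --> \oo] --> D j (g J) x.
Proof.
move=> bx; have [B B1 hB] := bump_bounded R; rewrite /G.
case: (boolP (#|J| == h)) => Jh.
  exact: (derive_glue_cvg r2_gt0 (C1g J) B1 hB).
rewrite (_ : g J = fun=> 0) ?derive_cst; last by apply/funext => y; exact: gdeg.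
exact: cvg_cst.
Qed.

Let C_ge0 : 0 <= C.
Proof.
apply: le_trans (@boundg finset.set0 x0 _); rewrite ?normr_ge0 //.
by apply: ballxx; rewrite !mulrn_wgt0.
Qed.

Let G_bounded : exists2 A : R, 0 <= A & forall J m x j, ball x0 (r *+ 2) x ->
  `|G J m x| <= A /\ `|D j (G J m) x| <= A.
Proof.
have [B B1 hB] := bump_bounded R.
pose A1 := (3 * B) ^+ n * (1 + n%:R *+ 2) * C *+ 2 + C.
pose A2 := (3 * B) ^+ n * (1 + n%:R *+ 2) * (C *+ 2) * (r *+ 2) + C.
have B0 : 0 <= B by exact: le_trans ler01 B1.
have A10 : 0 <= A1.
  by rewrite addr_ge0 // mulrn_wge0 // !mulr_ge0 // ?exprn_ge0 ?mulr_ge0 // addr_ge0 // mulrn_wge0.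
have A20 : 0 <= A2.
  by rewrite addr_ge0 // !mulr_ge0 ?mulrn_wge0 ?(ltW r_gt0) // ?exprn_ge0 ?mulr_ge0.
exists (A1 + A2); first by rewrite addr_ge0.
move=> J m x j bx; rewrite /G; case: (boolP (#|J| == h)) => Jh.
  have [h1 h2] := glue_bounded r2_gt0 (C1g J) (@boundDg J) B1 hB j m bx.
  split; last by apply: le_trans h1 _; rewrite lerDl.
  apply: le_trans h2 _; apply: (@le_trans _ _ A2); last by rewrite lerDr.
  by rewrite lerD2l; apply: boundg; exact: ball2.
by rewrite derive_cst normr0; split; rewrite addr_ge0.
Qed.

Let omega_ m : diff_form R n := fun x J => phi x * G J m x.
Let omega : diff_form R n := fun x J => phi x * g J x.

Let elementary_omega m J : elementary (fun x => omega_ m x J).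
Proof. exact: elementary_mul. Qed.

Let dphi x j : is_derive x (basis_vec R j) phi (D j phi x).
Proof. by apply: derivableP; apply: diff_derivable; exact: elementary_differentiable. Qed.

Let derive_omega_ m J x j : D j (fun y => omega_ m y J) x =
  phi x * D j (G J m) x + G J m x * D j phi x.
Proof.
have d2 : is_derive x (basis_vec R j) (G J m) (D j (G J m) x).
  by apply: derivableP; apply: diff_derivable; exact: elementary_differentiable.
exact: (@derive_val _ _ _ _ _ _ _ (is_derive_prod (dphi x j) d2)).
Qed.

Lemma derive_cutoff J x j : ball x0 (r *+ 2) x ->
  D j (fun y => phi y * g J y) x = phi x * D j (g J) x + g J x * D j phi x.
Proof.
move=> bx; have d2 : is_derive x (basis_vec R j) (g J) (D j (g J) x).
  by apply: derivableP; apply: (@C1_on_derivable _ _ (ball x0 (r *+ 2 *+ 2))) => //; exact: ball2.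
exact: (@derive_val _ _ _ _ _ _ _ (is_derive_prod (dphi x j) d2)).
Qed.

Lemma derive_cutoff_out J x j : ~ ball x0 (r *+ 2) x ->
  D j (fun y => phi y * g J y) x = 0.
Proof.
move=> bx; apply: (derive_eq0_off (K := K)) => // [y Ky|].
  by rewrite phi_offK ?mul0r.
by move=> /K_ball.
Qed.

Let derive_omega_out m J x j : ~ ball x0 (r *+ 2) x -> D j (fun y => omega_ m y J) x = 0.
Proof.
move=> bx; apply: (derive_eq0_off (K := K)) => // [y Ky|].
  by rewrite /omega_ phi_offK ?mul0r.
by move=> /K_ball.
Qed.

(** Stokes' identity for phi times the approximating coefficients passes to the
    limit on both sides, since the coefficients and their first derivatives
    converge pointwise and boundedly. *)
Theorem stokes_C1 :
  [/\ (hausdorff h.+1).-integrable Sigma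
        (fun x => (pairing (tau x) (ext_d (fun y J => phi y * g J y) x) * (theta x)%:R)%:E),
      (hausdorff h).-integrable Sigma'
        (fun x => (pairing (tau' x) (fun J => phi x * g J x) * (theta' x)%:R)%:E)
    & (\int[hausdorff h.+1]_(x in Sigma)
        (pairing (tau x) (ext_d (fun y J => phi y * g J y) x) * (theta x)%:R)%:E =
      \int[hausdorff h]_(x in Sigma')
        (pairing (tau' x) (fun J => phi x * g J x) * (theta' x)%:R)%:E)%E].
Proof.
have [A A0 hA] := dphi_bounded; have [A' A'0 hA'] := G_bounded.
have phi1 x : `|phi x| <= 1 by have /andP[h1 h2] := phi01 x; rewrite ger0_norm.
have lim1 x I : ext_d (omega_ m) x I @[m --> \oo] --> ext_d omega x I.
  apply: cvg_finite_sum => j; apply: cvgMr.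
  have [bx|bx] := pselect (ball x0 (r *+ 2) x).
    under eq_fun do rewrite derive_omega_; rewrite derive_cutoff //.
    by apply: cvgD; [apply: cvgMr; exact: derive_G_cvg|apply: cvgMl; exact: G_cvg].
  under eq_fun do rewrite derive_omega_out //; rewrite derive_cutoff_out //.
  exact: cvg_cst.
have bound1 m x I : `|ext_d (omega_ m) x I| <= (A' + A' * A) *+ n.
  have b j J : `|D j (fun y => omega_ m y J) x| <= A' + A' * A.
    have [bx|bx] := pselect (ball x0 (r *+ 2) x); last first.
      by rewrite derive_omega_out // normr0 addr_ge0 // mulr_ge0.
    have [h1 h2] := hA' J m x j bx.
    rewrite derive_omega_; apply: le_trans (ler_normD _ _) _; rewrite !normrM lerD //.
      by rewrite -[leRHS]mul1r ler_pM.
    by rewrite ler_pM.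
  apply: le_trans (ler_norm_sum _ _ _) _.
  rewrite -[X in _ *+ X]card_ord -sumr_const big_mkcond; apply: ler_sum => j _.
  case: ifP => _; last by rewrite addr_ge0 // mulr_ge0.
  by rewrite normrM normrX normrN1 expr1n mul1r.
have lim2 x J : omega_ m x J @[m --> \oo] --> omega x J.
  have [bx|bx] := pselect (ball x0 (r *+ 2) x).
    by apply: cvgMr; exact: G_cvg.
  have phi0 : phi x = 0 by apply: phi_offK => /K_ball.
  rewrite /omega_ /omega phi0 mul0r; under eq_fun do rewrite mul0r; exact: cvg_cst.
have bound2 m x J : `|omega_ m x J| <= A'.
  have [bx|bx] := pselect (ball x0 (r *+ 2) x); last first.
    by rewrite /omega_ phi_offK ?mul0r ?normr0 // => /K_ball.
  have [h1 _] := hA' J m x (Ordinal n_gt0) bx.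
  by rewrite normrM -[leRHS]mul1r ler_pM.
have KO : K `<=` Omega by move=> x /K_ball/ball2/ballO.
have deg m x (I : {set 'I_n}) : #|I| <> h -> omega_ m x I = 0.
  by move=> /eqP Ih; rewrite /omega_ /G (negbTE Ih) mulr0.
have supp m x I : ~ K x -> omega_ m x I = 0.
  by move=> Kx; rewrite /omega_ phi_offK // mul0r.
have [i1 c1] := weighted_limit mS mN N0 mtau tau1 itheta
  (fun m => elementary_ext_d (elementary_omega m)) lim1 bound1.
have [i2 c2] := weighted_limit mS' mN' N'0 mtau' tau'1 itheta' elementary_omega lim2 bound2.
split; [exact: i1|exact: i2|].
transitivity (lim ((fun m => \int[hausdorff h.+1]_(x in Sigma)
    (pairing (tau x) (ext_d (omega_ m) x) * (theta x)%:R)%:E)%E @ \oo)).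
  by apply/esym; apply: cvg_lim c1.
transitivity (lim ((fun m => \int[hausdorff h]_(x in Sigma')
    (pairing (tau' x) (omega_ m x) * (theta' x)%:R)%:E)%E @ \oo)); last first.
  by apply: cvg_lim c2.
congr (lim (_ @ \oo)); apply/funext => m; apply: stokes.
  exact: (elementary_test_form compactK KO (deg m) (elementary_omega m) (supp m)).
exact: (ext_d_test_form compactK KO (deg m) (elementary_omega m) (supp m)).
Qed.

End StokesC1.

(** * The contraction identity on the support *)

(** The set where the norm is not 1 is cut out by a measurable function, so it
    can itself serve as the null set. *)
Lemma orientation_unit (R : realType) (n h : nat) (Sigma : set (borel_rV R n))
    (tau : borel_rV R n -> multivector R n) :
  measurable Sigma -> orientation h Sigma tau ->
  exists N : set (borel_rV R n), [/\ measurable N, hausdorff h N = 0%E &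
    forall x, Sigma x -> ~ N x -> \sum_I tau x I ^+ 2 = 1].
Proof.
move=> mS [mtau _ [P _ orP]].
have msq : measurable_fun Sigma (fun x => \sum_I tau x I ^+ 2).
  by apply: measurable_sum => I; exact: measurable_funX.
exists (Sigma `&` (fun x => \sum_I tau x I ^+ 2) @^-1` (~` [set 1])); split.
- by apply: msq => //; apply: measurableC.
- apply: hausdorff_null_sub orP => x [Sx h1]; split=> // -[_ t1].
  by apply: h1; exact: mvnorm_eq1.
- by move=> x Sx Nx; apply: contrapT => h1; apply: Nx.
Qed.

Lemma unit_coord_le1 (R : realType) (n : nat) (w : multivector R n) I :
  \sum_K w K ^+ 2 = 1 -> `|w I| <= 1.
Proof.
move=> w1; rewrite -(@ler_pXn2r _ 2) ?nnegrE // expr1n real_normK ?num_real //.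
by rewrite -w1 (bigD1 I) //= lerDl; apply: sumr_ge0 => K _; exact: sqr_ge0.
Qed.

Section Weights.
Variables (R : realType) (n : nat).
Local Notation bpt := (borel_rV R n).
Variable mu : {measure set bpt -> \bar R}.

Lemma integrable_weighted (S D : set bpt) (f : bpt -> R) (theta : bpt -> nat) (A : R) :
  measurable S -> measurable D -> D `<=` S ->
  mu.-integrable S (fun x => (theta x)%:R%:E) -> measurable_fun D f ->
  (forall x, D x -> `|f x| <= A) ->
  mu.-integrable D (EFin \o (fun x => f x * (theta x)%:R)).
Proof.
move=> mS mD DS itheta mf fA.
have iD : mu.-integrable D (fun x => (theta x)%:R%:E) by exact: integrableS itheta.
apply: (@le_integrable _ bpt R mu D mD _ (fun x => A%:E * (theta x)%:R%:E)%E).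
- apply/measurable_EFinP; apply: measurable_funM => //.
  by apply/measurable_EFinP; exact: measurable_int iD.
- move=> x Dx; rewrite -EFinM lee_fin !normrM; apply: ler_wpM2r => //.
  by apply: le_trans (ler_norm A); exact: fA.
- exact: integrableZl.
Qed.

(** A function that vanishes off B, and is known only up to a null set N, may be
    integrated over the part of B outside N. *)
Lemma integral_localize (S N B : set bpt) (f f' : bpt -> R) :
  measurable S -> measurable N -> mu N = 0%E ->
  mu.-integrable S (EFin \o f) ->
  (forall x, S x -> ~ N x -> B x -> f x = f' x) ->
  (forall x, S x -> ~ N x -> ~ B x -> f x = 0) ->
  (\int[mu]_(x in S) (f x)%:E = \int[mu]_(x in (S `\` N) `&` B) (f' x)%:E)%E.
Proof.
move=> mS mN N0 fint ff' f0.
rewrite (negligible_integral mN mS fint N0) [RHS]integral_mkcondr.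
apply: eq_integral => x /set_mem[Sx Nx]; rewrite /patch /=.
have [/set_mem Bx|/negP xB] := boolP (x \in B); first by rewrite ff'.
by rewrite f0 // => Bx; apply: xB; exact/mem_set.
Qed.

End Weights.

Section Core.
Variables (R : realType) (n h : nat).
Local Notation pt := 'rV[R]_n.
Local Notation bpt := (borel_rV R n).
Local Notation D j f x := ('D_(basis_vec R j) f x).
Variables (Omega : set pt) (v : 'I_h.+1 -> pt -> pt) (T : diff_form R n -> R).
Variables (Sigma : set bpt) (tau : bpt -> multivector R n) (theta : bpt -> nat).
Hypotheses (n_gt0 : (0 < n)%N) (oO : open Omega).
Hypothesis Cv : forall i, C1_on Omega (v i).
Hypothesis v1 : forall x, Omega x -> mvnorm (wedge (frame v x)) = 1.
Hypothesis hT : integral_current Omega h.+1 T.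
Hypothesis hrep : represents Omega h.+1 T Sigma tau theta.
Hypothesis htan : tangent_to h.+1 Sigma (fun x => row_span (frame v x)).
Variables (x0 : pt) (U : set pt) (g : {set 'I_n} -> pt -> R).
Hypothesis supp : measure_support Omega (rect_measure h.+1 Sigma theta) x0.
Hypotheses (oU : open U) (Ux0 : U x0) (UO : U `<=` Omega).
Hypothesis Cg : forall J, C1_on U (g J).
Hypothesis gdeg : forall (J : {set 'I_n}) x, #|J| != h -> g J x = 0.
Local Notation wF x := (wedge (frame v x)).
Hypothesis rel : forall x, U x -> \sum_J g J x *: contr (wF x) J = 0.

(** The function <v; d omega> for omega with coefficients g. *)
Let c x := \sum_J \sum_j contr (wF x) J 0 j * D j (g J) x.

Let contr_scale (w u : multivector R n) s J j : (forall I, w I = s * u I) ->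
  contr w J 0 j = s * contr u J 0 j.
Proof. by move=> ws; rewrite !mxE; case: ifP => _; rewrite ?mulr0 // ws mulrCA. Qed.

Let cvg_wedge I : (fun x => wF x I) @ x0 --> wF x0 I.
Proof.
apply: (C1_on_continuous (U := Omega)); last exact: UO.
by apply: C1_on_wedge => //.
Qed.

Let cvg_c : c @ x0 --> c x0.
Proof.
have FF := @nbhs_filter pt x0.
apply: (@cvg_finite_sum R pt (nbhs x0) _ _ _ (fun J x => \sum_j contr (wF x) J 0 j * D j (g J) x)) => J.
apply: (@cvg_finite_sum R pt (nbhs x0) _ _ _ (fun j x => contr (wF x) J 0 j * D j (g J) x)) => j; apply: cvgM.
  under eq_fun do rewrite mxE; rewrite mxE.
  case: (boolP (j \in J)) => _; first exact: cvg_cst.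
  by apply: cvgMr; exact: cvg_wedge.
exact: (C1_on_derive_continuous oU (Cg J) Ux0).
Qed.

Let good_ball : c x0 != 0 -> exists r C : R, [/\ 0 < r,
  ball x0 (r *+ 2 *+ 2) `<=` U,
  forall J x, ball x0 (r *+ 2 *+ 2) x -> `|g J x| <= C,
  forall J x j, ball x0 (r *+ 2 *+ 2) x -> `|D j (g J) x| <= C &
  forall x, ball x0 r x -> c x != 0].
Proof.
move=> c0.
pose C := \sum_J `|g J x0| + \sum_J \sum_j `|D j (g J) x0| + 1.
have near_le (f : pt -> R) : f @ x0 --> f x0 -> `|f x0| + 1 <= C -> \forall x \near x0, `|f x| <= C.
  move=> cf fC; move/cvgrPdist_le : cf => /(_ 1 ltr01); apply: filterS => x hx.
  apply: le_trans fC; rewrite -[f x](subrK (f x0)) addrC.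
  by apply: le_trans (ler_normD _ _) _; rewrite lerD2l distrC.
have S1 J : `|g J x0| <= \sum_J `|g J x0|.
  by rewrite [leRHS](bigD1 J) //= lerDl; apply: sumr_ge0.
have S2 J j : `|D j (g J) x0| <= \sum_J \sum_j `|D j (g J) x0|.
  rewrite [leRHS](bigD1 J) //= (bigD1 j) //= -addrA lerDl addr_ge0 //; first by apply: sumr_ge0.
  by apply: sumr_ge0 => K _; apply: sumr_ge0.
have S10 : 0 <= \sum_J `|g J x0| by apply: sumr_ge0.
have S20 : 0 <= \sum_J \sum_j `|D j (g J) x0| by apply: sumr_ge0 => K _; apply: sumr_ge0.
have n1 : \forall x \near x0, forall J, `|g J x| <= C.
  apply: (@filter_forall _ {set 'I_n} (fun J x => `|g J x| <= C) (nbhs x0)) => J.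
  apply: near_le; first exact: (C1_on_continuous (Cg J)).
  by rewrite /C; have := S1 J; lra.
have n2 : \forall x \near x0, forall Jj : {set 'I_n} * 'I_n, `|D Jj.2 (g Jj.1) x| <= C.
  apply: (@filter_forall _ ({set 'I_n} * 'I_n)%type (fun Jj x => `|D Jj.2 (g Jj.1) x| <= C) (nbhs x0)) => -[J j] /=.
  apply: (near_le (fun x => D j (g J) x)); first exact: (C1_on_derive_continuous oU (Cg J) Ux0).
  by rewrite /C; have := S2 J j; lra.
have n3 : \forall x \near x0, c x != 0 by apply: (cvgr_neq0 _ cvg_c).
have n4 : \forall x \near x0, U x by apply: open_nbhs_nbhs.
have [e /= e0 he] : exists2 e : R, 0 < e & ball x0 e `<=`
    [set x | [/\ (forall J, `|g J x| <= C), (forall Jj : {set 'I_n} * 'I_n, `|D Jj.2 (g Jj.1) x| <= C), c x != 0 & U x]].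
  apply/nbhs_ballP; near=> x; split; by near: x.
exists (e / 4), C.
have eE : (e / 4) *+ 2 *+ 2 = e by rewrite -mulrnA -mulr_natr; field.
rewrite eE; split.
- by rewrite divr_gt0.
- by move=> x /he[].
- by move=> J x /he[].
- by move=> J x j /he[_ h2 _ _]; exact: (h2 (J, j)).
- move=> x bx; suff /he[] : ball x0 e x by [].
  by apply: le_ball bx; rewrite ler_pdivrMr // ler_peMr ?(ltW e0) // ler1n.
Unshelve. all: by end_near. Qed.

(** If c x0 were nonzero, c would have no zero on a small ball B.  There
    <tau; d omega> = c or - c almost everywhere on Sigma, while the comparison of
    the mutually singular measures of Stokes' identity makes it vanish.  So B
    would be negligible for the measure of T, although its centre is in the
    support. *)
Lemma contraction_identity :
  \sum_J 'D_(contr (wF x0) J) (g J) x0 = 0.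
Proof.
(* along the contractions the directional derivatives add up to c *)
have cE x : U x -> \sum_J 'D_(contr (wF x) J) (g J) x = c x.
  move=> Ux; apply: eq_bigr => J _; rewrite derive_basis; last exact: (Cg J Ux).1.
  by apply: eq_bigr => j _; rewrite mulrC.
rewrite cE //; apply/eqP; apply: contraT => /good_ball[r [C [r0 bU bg bDg c0]]].
have [rectS orS mulS TE] := hrep.
have [_ [Sigma' [tau' [theta' [rectS' orS' mulS' TE']]]]] := hT.2 (ltn0Sn h).
have [SO mS _ _] := rectS; have [_ mS' finS' _] := rectS'.
have [mtau _ _] := orS; have [mtau' _ _] := orS'.
have [theta0 itheta] := mulS; have [_ itheta'] := mulS'.
have [N [mN N0 tauE]] := tangent_orientation_sign oO Cv v1 rectS orS htan.
have [N' [mN' N'0 tau'1]] := orientation_unit mS' orS'.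
have S'0 : hausdorff h.+1 Sigma' = 0%E by exact: hausdorffS_eq0.
(* Sigma' is H^k-null, so it may be removed from Sigma: this is what makes the two measures mutually singular *)
pose N2 : set bpt := N `|` Sigma'.
have mN2 : measurable N2 by exact: measurableU.
have N20 : hausdorff h.+1 N2 = 0%E by exact: hausdorff_nullU.
have tau1 x I : Sigma x -> ~ N2 x -> `|tau x I| <= 1.
  move=> Sx N2x; apply: unit_coord_le1.
  have [|s s2 e] := tauE x Sx; first by move=> Nx; apply: N2x; left.
  under eq_bigr do rewrite e exprMn s2 mul1r.
  by apply: mvnorm_eq1; apply: v1; exact: SO.
have tau1' x I : Sigma' x -> ~ N' x -> `|tau' x I| <= 1.
  by move=> Sx N'x; apply: unit_coord_le1; exact: tau'1.
have stokes omega : test_form Omega h omega -> test_form Omega h.+1 (ext_d omega) ->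
    (\int[hausdorff h.+1]_(x in Sigma) (pairing (tau x) (ext_d omega x) * (theta x)%:R)%:E =
     \int[hausdorff h]_(x in Sigma') (pairing (tau' x) (omega x) * (theta' x)%:R)%:E)%E.
  by move=> t1 t2; rewrite -TE // -TE'.
pose B := ball x0 r; pose B4 := ball x0 (r *+ 2 *+ 2).
have r24 : r *+ 2 <= r *+ 2 *+ 2 by rewrite [leRHS]mulr2n lerDl mulrn_wge0 // ltW.
have r12 : r <= r *+ 2 by rewrite mulr2n lerDl ltW.
have B24 : ball x0 (r *+ 2) `<=` B4 by exact: le_ball.
have B12 : B `<=` ball x0 (r *+ 2) by exact: le_ball.
have B14 : B `<=` B4 by move=> x /B12 /B24.
have mB : measurable (B : set bpt) by apply: measurable_open; exact: ball_open.
pose D0 : set bpt := (Sigma `\` N2) `&` B.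
pose E : set bpt := (Sigma' `\` N') `&` B.
have mD : measurable D0 by apply: measurableI => //; exact: measurableD.
have mE : measurable E by apply: measurableI => //; exact: measurableD.
pose F (x : bpt) := \sum_J \sum_j contr (tau x) J 0 j * D j (g J) x.
pose P' (x : bpt) := pairing (tau' x) (fun J => g J x).
have FE x : D0 x -> exists2 s : R, s != 0 & F x = s * c x.
  move=> [[Sx N2x] Bx]; have [|s s2 e] := tauE x Sx; first by move=> Nx; apply: N2x; left.
  exists s; first by apply: contraPneq s2 => ->; rewrite expr0n /= => /esym/eqP; rewrite oner_eq0.
  rewrite /F /c mulr_sumr; apply: eq_bigr => J _; rewrite mulr_sumr; apply: eq_bigr => j _.
  by rewrite (contr_scale _ _ e) mulrA.
have contr_tau (w : multivector R n) J j : (forall I, `|w I| <= 1) -> `|contr w J 0 j| <= 1.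
  by move=> w1; rewrite mxE; case: ifP => _; rewrite ?normr0 // normrM /isign normrX normrN1 expr1n mul1r.
have mContr J j : measurable_fun D0 (fun x => contr (tau x) J 0 j).
  under eq_fun do rewrite mxE.
  case: (boolP (j \in J)) => _; first exact: measurable_cst.
  apply: measurable_funM; first exact: measurable_cst.
  by apply: measurable_funS (mtau _) => // x [[]].
have mOn (f : pt -> R) : (forall x, B4 x -> {for x, continuous f}) -> @measurable_fun _ _ bpt R B4 f.
  by move=> cf; apply: continuous_measurable => //; exact: ball_open.
have mB4 : measurable (B4 : set bpt) by apply: measurable_open; exact: ball_open.
have iF : (hausdorff h.+1).-integrable D0 (EFin \o (fun x => F x * (theta x)%:R)).
  apply: (integrable_weighted (A := \sum_(J : {set 'I_n}) \sum_(j < n) C) mS mD _ itheta).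
  - by move=> x [[]].
  - apply: measurable_sum => J; apply: measurable_sum => j; apply: measurable_funM => //.
    apply: (@measurable_funS _ _ bpt R B4) => //; first by move=> x [_ /B14].
    by apply: mOn => x /bU Ux; exact: (C1_on_derive_continuous oU (Cg J) Ux).
  - move=> x [[Sx N2x] Bx]; apply: le_trans (ler_norm_sum _ _ _) _; apply: ler_sum => J _.
    apply: le_trans (ler_norm_sum _ _ _) _; apply: ler_sum => j _; rewrite normrM.
    apply: le_trans (bDg J x j (B14 _ Bx)); rewrite ler_piMl //; apply: contr_tau => I.
    exact: tau1.
have iP : (hausdorff h).-integrable E (EFin \o (fun x => P' x * (theta' x)%:R)).
  apply: (integrable_weighted (A := C *+ #|{set 'I_n}|) mS' mE _ itheta').
  - by move=> x [[]].
  - apply: measurable_sum => J; apply: measurable_funM.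
      by apply: measurable_funS (mtau' _) => // x [[]].
    apply: (@measurable_funS _ _ bpt R B4) => //; first by move=> x [_ /B14].
    by apply: mOn => x /bU Ux; exact: (C1_on_continuous (Cg J) Ux).
  - move=> x [[Sx N'x] Bx]; apply: pairing_norm_le => I; first exact: tau1'.
    by apply: bg; exact: B14.
have C1g J : C1_on B4 (g J) by move=> x /bU; exact: (Cg J).
have ballO : B4 `<=` Omega by move=> x /bU /UO.
(* the relation satisfied by g, transported from v to tau, kills the terms with a derivative of the cutoff *)
have tau_rel x j : Sigma x -> ~ N2 x -> ball x0 (r *+ 2) x ->
    \sum_J g J x * contr (tau x) J 0 j = 0.
  move=> Sx N2x B2x.
  have [|s s2 e] := tauE x Sx; first by move=> Nx; apply: N2x; left.
  have := rel (bU _ (B24 _ B2x)); move/rowP/(_ j); rewrite summxE [RHS]mxE.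
  move/(congr1 ( *%R s)); rewrite mulr0; apply: etrans; rewrite mulr_sumr; apply: eq_bigr => J _.
  by rewrite (contr_scale _ _ e) [in RHS]mxE mulrCA.
have no_cutoff x (a : 'I_n -> R) : Sigma x -> ~ N2 x -> ball x0 (r *+ 2) x ->
    \sum_J \sum_j a j * (g J x * contr (tau x) J 0 j) = 0.
  move=> Sx N2x B2x; rewrite exchange_big; apply: big1 => j _.
  by rewrite -mulr_sumr tau_rel // mulr0.
have tests (phi : pt -> R) : elementary phi -> (forall x, 0 <= phi x <= 1) ->
    (forall x, ~ B x -> phi x = 0) ->
    (\int[hausdorff h.+1]_(x in D0) (phi x * (F x * (theta x)%:R))%:E =
     \int[hausdorff h]_(x in E) (phi x * (P' x * (theta' x)%:R))%:E)%E.
  move=> ephi phi01 phi_out.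
  have [i1 i2 eq12] := stokes_C1 mS mN2 N20 mS' mN' N'0 mtau mtau' tau1 tau1'
    itheta itheta' stokes n_gt0 r0 ballO C1g bg bDg gdeg ephi phi01 phi_out.
  rewrite -(integral_localize (f := fun x => pairing (tau x)
      (ext_d (fun y J => phi y * g J y) x) * (theta x)%:R) mS mN2 N20 i1); last 2 first.
  - move=> x Sx N2x Bx; rewrite pairing_ext_d mulrA; congr (_ * _).
    transitivity (\sum_J \sum_j (phi x * (contr (tau x) J 0 j * D j (g J) x) +
        D j phi x * (g J x * contr (tau x) J 0 j))).
      apply: eq_bigr => J _; apply: eq_bigr => j _.
      by rewrite (derive_cutoff r0 C1g ephi J j (B12 _ Bx)); ring.
    under eq_bigr do rewrite big_split /= -mulr_sumr.
    rewrite big_split /= -mulr_sumr -[RHS]addr0; congr (_ + _).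
    exact: no_cutoff (B12 _ Bx).
  - move=> x Sx N2x Bx; rewrite pairing_ext_d.
    have [B2x|B2x] := pselect (ball x0 (r *+ 2) x); last first.
      apply: etrans (mul0r _); congr (_ * _).
      apply: big1 => J _; apply: big1 => j _.
      by rewrite (derive_cutoff_out g r0 phi_out J j B2x) mulr0.
    apply: etrans (mul0r _); congr (_ * _).
    apply: etrans (no_cutoff x (fun j => D j phi x) Sx N2x B2x).
    apply: eq_bigr => J _; apply: eq_bigr => j _.
    by rewrite (derive_cutoff r0 C1g ephi J j B2x) (phi_out _ Bx) mul0r add0r; ring.
  rewrite eq12; apply: (integral_localize mS' mN' N'0 i2) => x Sx N'x Bx.
    rewrite mulrA; congr (_ * _); rewrite /P' /pairing mulr_sumr.
    by apply: eq_bigr => J _; rewrite mulrCA.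
  apply: etrans (mul0r _); congr (_ * _).
  by apply: big1 => J _; rewrite (phi_out _ Bx) mul0r mulr0.
have DE0 : D0 `&` E = set0.
  by apply/seteqP; split=> // x [[[_ N2x] _] [[Sx _] _]]; apply: N2x; right.
have F0 := tests_ae0 r0 mD mE DE0 (fun x Dx => Dx.2) (fun x Ex => Ex.2) iF iP tests.
have D00 : hausdorff h.+1 D0 = 0%E.
  have [Z [mZ Z0 hZ]] := F0; apply: hausdorff_null_sub Z0 => x Dx; apply: hZ => /= hx.
  have [Fx|] := pselect (F x * (theta x)%:R = 0); last by apply; have [] := hx Dx.
  have [s s0 e] := FE _ Dx; move/eqP: Fx; rewrite e !mulf_eq0 (negbTE s0) (negbTE (c0 _ Dx.2)) /=.
  by rewrite pnatr_eq0 eqn0Ngt theta0 //; case: Dx => [[]].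
have SB0 : hausdorff h.+1 (Sigma `&` B) = 0%E.
  apply: (hausdorff_null_sub (B := D0 `|` N2)); last exact: hausdorff_nullU.
  by move=> x [Sx Bx]; have [N2x|N2x] := pselect (N2 x); [right|left].
suff /(_ (ballxx _ r0)) : ~ B x0 by [].
apply: supp.2 (~` B) _ _; first by apply: open_closedC; exact: ball_open.
rewrite /rect_measure; apply: null_set_integral.
- apply: measurableI => //; apply: measurableD; first exact: measurable_open.
  exact: measurableC.
- apply: measurable_funS (measurable_int _ itheta) => //; exact: subIsetl.
- by apply: hausdorff_null_sub SB0 => x [Sx [_ Bx]]; split=> //; exact: contrapT.
Qed.

End Core.

(** * Involutivity on the support *)

Unset Implicit Arguments.

Theorem theorem3p6 (R : realType) (n k : nat) (hk : (0 < k < n)%N)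
    (Omega : set 'rV[R]_n) (hOmega : open Omega)
    (v : 'I_k -> 'rV[R]_n -> 'rV[R]_n)
    (hv : forall i, C1_on Omega (v i))
    (hnorm : forall x, Omega x -> mvnorm (wedge (frame v x)) = 1)
    (T : diff_form R n -> R)
    (Sigma : set (borel_rV R n)) (tau : borel_rV R n -> multivector R n)
    (theta : borel_rV R n -> nat)
    (hT : integral_current Omega k T)
    (hrep : represents Omega k T Sigma tau theta)
    (htan : tangent_to k Sigma (fun x => row_span (frame v x))) :
  forall x, measure_support Omega (rect_measure k Sigma theta) x ->
    involutive_at v x.
Proof.
case: k hk v hv hnorm hT hrep htan => // h /= hn v hv hnorm hT hrep htan x supp.
have n_gt0 : (0 < n)%N by exact: leq_ltn_trans hn.
have Ox : Omega x by exact: supp.1.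
(* v has norm 1, hence a nonzero coordinate, which stays nonzero nearby *)
have [I0 I0x] : exists I0, wedge (frame v x) I0 != 0.
  apply: contrapT => /forallNP w0; have := mvnorm_eq1 (hnorm _ Ox).
  rewrite big1 => [/esym/eqP|I _]; first by rewrite oner_eq0.
  by have /negP := w0 I; rewrite negbK => /eqP ->; rewrite expr0n.
have Cw I : C1_on Omega (fun y => wedge (frame v y) I) by apply: C1_on_wedge.
pose U := Omega `&` [set y | wedge (frame v y) I0 != 0].
have oU : open U.
  rewrite openE => y [Oy wy]; rewrite /interior; near=> z; split.
    by near: z; exact: open_nbhs_nbhs.
  by near: z; apply: (cvgr_neq0 _ (C1_on_continuous (Cw I0) Oy)).
have restr (W : normedModType R) (f : 'rV[R]_n -> W) : C1_on Omega f -> C1_on U f.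
  by move=> Cf y [Oy _]; exact: Cf.
apply: (involutive_of_contraction_identity (U := U) (I0 := I0)) => //.
- by move=> i; exact: restr.
- by move=> y [].
- move=> g Cg gdeg rel.
  apply: (contraction_identity n_gt0 hOmega hv hnorm hT hrep htan supp oU) => //.
  by move=> y [].
Unshelve. all: by end_near. Qed.
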